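(* Suppose that the marked surface $\mathbb{S}$ has at least one puncture and that $k\geq 3$. Then the cluster algebra $\mathscr{A}({\rm SL}_k,\mathbb{S})$ has finite mutation type if and only if $\mathbb{S}$ is a once-punctured bigon and $k=3$. Likewise, $\mathscr{A}'({\rm SL}_k,\mathbb{S})$ has finite mutation type if and only if either $\mathbb{S}$ is a once-punctured bigon and $k\in\{3,4\}$, or $\mathbb{S}$ is a once-punctured triangle and $k=3$.
   Context: **Marked surfaces.** $\mathbb{S}=(\mathbf{S},\mathbb{M})$ is an oriented marked surface (Fomin–Shapiro–Thurston); punctures are marked points in the interior. Excluded throughout: spheres with at most $2$ punctures, the unpunctured monogon and digon, the once-punctured monogon. A once-punctured bigon (triangle) is a disk with one puncture and two (three) marked points on the boundary. A boundary interval is a piece of $\partial\mathbf S$ connecting adjacent boundary points. A triangulation is a maximal set of noncrossing arcs. It is regular if it has no loop enclosing a single puncture, and taut if it is regular and each triangle has at most one side which is a boundary interval; any $\mathbb{S}$ with a puncture admits a taut triangulation. **Finite mutation type.** A cluster algebra has finite mutation type if only finitely many quivers arise, up to isomorphism, as mutable parts of quivers of its seeds. **Initial quivers.** $\mathscr{A}({\rm SL}_k,\mathbb{S})$ (resp. $\mathscr{A}'({\rm SL}_k,\mathbb{S})$) is the cluster algebra associated to the moduli space of ${\rm SL}_k$-local systems on $\mathbb{S}$ decorated by affine flags at all marked points (resp. affine flags at punctures and vectors at boundary points). Its initial quivers are as follows. Let $Q_k$ be the quiver with vertices $(a,b,c)\in\mathbb{N}^3$, $a+b+c=k$, excluding $(k,0,0),(0,k,0),(0,0,k)$,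 and, for every $(i,j,l)\in\mathbb{N}^3$ with $i+j+l=k-2$, arrows $(i{+}1,j{+}1,l)\to(i{+}1,j,l{+}1)\to(i,j{+}1,l{+}1)\to(i{+}1,j{+}1,l)$. For a triangle $\delta$ place a copy of $Q_k$ in $\delta$, with $(k,0,0),(0,k,0),(0,0,k)$ at its corners in clockwise order. For $\mathscr{A}({\rm SL}_k,\mathbb{S})$ and any regular triangulation, glue these along the $k-1$ vertices of each common side of triangles and cancel oriented $2$-cycles; the vertices on boundary intervals are frozen. For $\mathscr{A}'({\rm SL}_k,\mathbb{S})$ and any taut triangulation, do the same except that a triangle with a boundary-interval side (drawn as its bottom side) receives instead the quiver $Q_k^1$ with vertices $L_1,\dots,L_{k-1}$ (on the left side), $R_1,\dots,R_{k-1}$ (on the right side; index $k-1$ nearest the top corner), a frozen vertex $M$ on the bottom side, and arrows $R_a\to L_a$ $(1\le a\le k-1)$, $L_a\to R_{a-1}\to R_a$ $(2\le a\le k-1)$, $L_1\to M\to R_1$. Different triangulations give mutation-equivalent seeds. *)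

(* Defs.v *)
From HB Require Import structures.
From mathcomp Require Import all_boot all_order all_algebra.
Set Implicit Arguments.
Unset Strict Implicit.
Unset Printing Implicit Defensive.
Import Order.TTheory GRing.Theory Num.Theory.

Definition eqv_closure (X : finType) (e : rel X) : rel X :=
  connect [rel x y | e x y || e y x].

(** * Quivers and mutation *)

(* A quiver without loops and oriented 2-cycles, given by its signed adjacency
   matrix: [adj x y] is the number of arrows from x to y minus the number of
   arrows from y to x. *)
Record quiver := Quiver { vert : finType; adj : vert -> vert -> int }.

Definition quiver_iso (Q Q' : quiver) : Prop :=
  exists2 f : vert Q -> vert Q',
    bijective f & forall x y, adj (f x) (f y) = adj x y.

Record ice_quiver := IceQuiver {
  iqv :> quiver;
  frozen : {set vert iqv} }.

Section Mutation.
Local Open Scope ring_scope.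

Definition mutate (V : finType) (b : V -> V -> int) (z x y : V) : int :=
  if (x == z) || (y == z) then - b x y
  else b x y + Num.max 0 (b x z) * Num.max 0 (b z y)
             - Num.max 0 (b y z) * Num.max 0 (b z x).

End Mutation.

(* The quivers of the seeds of the cluster algebra with initial quiver Q;
   mutations are allowed at mutable vertices only. *)
Inductive seed_quiver (Q : ice_quiver) : (vert Q -> vert Q -> int) -> Prop :=
| seed_initial : seed_quiver (@adj Q)
| seed_mutate b z :
    seed_quiver b -> z \notin frozen Q -> seed_quiver (mutate b z).

Definition mutable_part (Q : ice_quiver) (b : vert Q -> vert Q -> int) :=
  @Quiver {x : vert Q | x \notin frozen Q} (fun x y => b (val x) (val y)).

Definition finite_mutation_type (Q : ice_quiver) : Prop :=
  exists (n : nat) (L : 'I_n -> quiver),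
    forall b, seed_quiver b -> exists i, quiver_iso (@mutable_part Q b) (L i).

(** * Marked surfaces *)

(* A connected oriented marked surface, up to homeomorphism, is given by its
   genus, the list of the numbers of marked points on its boundary components,
   and its number of punctures. *)
Record marked_surface := MarkedSurface {
  genus : nat;
  boundary : seq nat;
  punctures : nat }.

Definition excluded_surface (S : marked_surface) : Prop :=
  [\/ exists2 p, p <= 2 & S = MarkedSurface 0 [::] p,
      S = MarkedSurface 0 [:: 1] 0,
      S = MarkedSurface 0 [:: 2] 0
    | S = MarkedSurface 0 [:: 1] 1].

(* Every boundary component carries a marked point, and there is at least one
   marked point. *)
Definition admissible (S : marked_surface) : Prop :=
  [/\ all (leq 1) (boundary S),
      0 < sumn (boundary S) + punctures S
    & ~ excluded_surface S].

Definition once_punctured_polygon (n : nat) : marked_surface :=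
  MarkedSurface 0 [:: n] 1.

(** * Triangulations *)

(* An ideal triangulation of a connected oriented marked surface, as the
   combinatorics of its triangles. The corners of a triangle t are (t, 0),
   (t, 1), (t, 2) in clockwise order, and its side (t, i) runs from the corner
   (t, i) to the corner (t, i+1). The involution [glue] sends a side to the side
   to which it is glued, reversing directions; its fixed points are the
   boundary intervals, and its other orbits are the arcs. *)
Record triangulation := Triangulation {
  triangle : finType;
  glue : triangle * 'I_3 -> triangle * 'I_3;
  glueK : involutive glue;
  triangle_gt0 : 0 < #|triangle|;
  triangle_connected : forall t t' : triangle,
    connect [rel u v | [exists i, exists j, glue (u, i) == (v, j)]] t t' }.

Section Topology.
Variable T : triangulation.

Definition side : finType := (triangle T * 'I_3)%type.

Definition next_side (s : side) : side := (s.1, ordS s.2).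

Definition bd_interval (s : side) : bool := glue s == s.

(* The start of an arc s is the end of [glue s]; in particular the ends of arcs
   are matched with starts by exchanging s and [glue s]. *)
Definition same_point : rel side :=
  eqv_closure [rel c d : side | ~~ bd_interval c && (d == next_side (glue c))].

Definition marked_points : {set {set side}} :=
  equivalence_partition same_point [set: side].

Definition is_puncture (P : {set side}) : bool :=
  [forall s, bd_interval s ==> (s \notin P) && (next_side s \notin P)].

Definition edges : {set {set side}} := [set [set s; glue s] | s : side].

Definition bd_components : {set {set side}} :=
  equivalence_partition
    (eqv_closure [rel s s' : side | [&& bd_interval s, bd_interval s' &
                                        same_point (next_side s) s']])
    [set s | bd_interval s].

(* A boundary component has as many marked points as boundary intervals; the
   last condition is V - E + F = 2 - 2g - b. *)
Definition triangulates (S : marked_surface) : Prop :=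
  [/\ #|[set P in marked_points | is_puncture P]| = punctures S,
      perm_eq [seq #|C| | C : {set side} in bd_components] (boundary S)
    & #|marked_points| + #|triangle T| + (genus S).*2 + size (boundary S)
      = #|edges| + 2].

(* In a triangulation, a loop enclosing a single puncture is the outer side of
   a self-folded triangle, one with two sides glued to each other. *)
Definition regular : Prop :=
  forall (t : triangle T) (i j : 'I_3), glue (t, i) = (t, j) -> i = j.

Definition taut : Prop :=
  regular /\
  forall (t : triangle T) (i j : 'I_3),
    bd_interval (t, i) -> bd_interval (t, j) -> i = j.

End Topology.

(** * The initial quivers *)

(* Lattice points of a triangle; the i-th entry is the weight of corner i. *)
Definition lattice (k : nat) := (3.-tuple 'I_k.+1)%type.

Definition wt (k : nat) (v : lattice k) (i : 'I_3) : nat := tnth v i.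

(* [None] is the vertex M of Q_k^1, which is not placed at a lattice point. *)
Definition local_vertex (k : nat) := option (lattice k).

Section LocalQuivers.
Variable k : nat.
Implicit Types (u v : lattice k) (x y : local_vertex k).

Definition Qk_vertex x : bool :=
  if x is Some v then
    (\sum_i wt v i == k) && [forall i, wt v i != k]
  else false.

Definition Qk_arrow x y : bool :=
  if (x, y) is (Some u, Some v) then
    [exists i : 'I_k, exists j : 'I_k, exists l : 'I_k,
      let p := [:: i.+1; j.+1; l : nat] in
      let q := [:: i.+1; j : nat; l.+1] in
      let r := [:: i : nat; j.+1; l.+1] in
      let at_ v s := [seq val n | n <- v] == s in
      (i + j + l + 2 == k) &&
      [|| at_ u p && at_ v q, at_ u q && at_ v r | at_ u r && at_ v p]]
  else false.

(* Q_k^1 in a triangle with bottom side e: going clockwise, e runs from the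
   bottom right corner e to the bottom left corner e+1, and the top corner is
   e+2. The index a of L_a and R_a is the weight of the top corner. *)
Definition isL (e : 'I_3) (a : nat) v : bool :=
  [&& wt v e == 0, wt v (ordS e) == k - a & wt v (ordS (ordS e)) == a].

Definition isR (e : 'I_3) (a : nat) v : bool :=
  [&& wt v e == k - a, wt v (ordS e) == 0 & wt v (ordS (ordS e)) == a].

Definition Qk1_vertex (e : 'I_3) x : bool :=
  if x is Some v then [exists a : 'I_k, (1 <= a) && (isL e a v || isR e a v)]
  else true.

Definition Qk1_arrow (e : 'I_3) x y : bool :=
  match x, y with
  | Some u, Some v =>
      [exists a : 'I_k,
        (1 <= a) && (isR e a u && isL e a v)
        || (2 <= a) && (isL e a u && isR e a.-1 v || isR e a.-1 u && isR e a v)]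
  | Some u, None => isL e 1 u
  | None, Some v => isR e 1 v
  | None, None => false
  end.

(* [v] is the point of side i with weights m at its start and k - m at its
   end. *)
Definition at_side (i : 'I_3) (m : nat) v : bool :=
  [&& wt v i == m, wt v (ordS i) == k - m & wt v (ordS (ordS i)) == 0].

End LocalQuivers.

Section Amalgamation.
Variables (T : triangulation) (k : nat).
Variables (has_vertex : triangle T -> pred (local_vertex k))
          (has_arrow : triangle T -> rel (local_vertex k)).

Definition piece_vertex : finType :=
  {x : triangle T * local_vertex k | has_vertex x.1 x.2}.

Definition piece_arrow (x y : piece_vertex) : bool :=
  ((val x).1 == (val y).1) && has_arrow (val x).1 (val x).2 (val y).2.

Definition identified (x y : piece_vertex) : bool :=
  match val x, val y with
  | (t, Some u), (t', Some v) =>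
      [exists i, exists j, exists m : 'I_k.+1,
        [&& ~~ bd_interval (t, i), glue (t, i) == (t', j),
            at_side i m u & at_side j (k - m) v]]
  | _, _ => false
  end.

Definition frozen_piece (x : piece_vertex) : bool :=
  match val x with
  | (t, Some u) =>
      [exists i, exists m : 'I_k.+1, bd_interval (t, i) && at_side i m u]
  | (_, None) => true
  end.

Definition glued_vertex : finType :=
  {C : {set piece_vertex} |
    C \in equivalence_partition (eqv_closure identified) [set: piece_vertex]}.

Definition glued_adj (C D : glued_vertex) : int :=
  (\sum_(x in val C) \sum_(y in val D)
     ((piece_arrow x y)%:Z - (piece_arrow y x)%:Z))%R.

Definition glued_frozen : {set glued_vertex} :=
  [set C : glued_vertex | [exists x in val C, frozen_piece x]].

Definition amalgam : ice_quiver :=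
  @IceQuiver (Quiver glued_adj) glued_frozen.

End Amalgamation.

(* The initial quiver of A(SL_k, S). *)
Definition quiver_A (T : triangulation) (k : nat) : ice_quiver :=
  amalgam (fun _ : triangle T => @Qk_vertex k) (fun _ => @Qk_arrow k).

Definition bottom (T : triangulation) (t : triangle T) : option 'I_3 :=
  [pick e | bd_interval (t, e)].

(* The initial quiver of A'(SL_k, S), for a taut triangulation T. *)
Definition quiver_A' (T : triangulation) (k : nat) : ice_quiver :=
  amalgam
    (fun t : triangle T =>
       if bottom t is Some e then @Qk1_vertex k e else @Qk_vertex k)
    (fun t : triangle T =>
       if bottom t is Some e then @Qk1_arrow k e else @Qk_arrow k).

(* Main.v *)
Require Import Defs.
From HB Require Import structures.
From mathcomp Require Import all_boot all_order all_algebra.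
From mathcomp Require Import zify.
Set Implicit Arguments.
Unset Strict Implicit.
Unset Printing Implicit Defensive.
Import Order.TTheory GRing.Theory Num.Theory.

(* A quiver is mutation-infinite as soon as some sequence of mutations of a full
   subquiver on mutable vertices produces an oriented triangle x -> y -> z -> x
   with b_xy >= 2 and b_yz > b_zx > 0: mutating at y and x in turn makes its
   weights grow forever. A full subquiver supported on some triangles and on the
   arcs along which they are glued to each other depends only on this partial
   gluing. So one explores the partial gluings around a puncture, starting from
   one of its corners, turning around it first, and adding a triangle at a time;
   every branch of this finite tree ends with such a subquiver of at most ten
   vertices, or with the once-punctured bigon or triangle. For k >= 7 the vertices
   at distance at most 6 from the puncture suffice, and their quiver does not
   depend on k. Conversely, an Euler characteristic count shows that the regular
   (taut) triangulations of the once-punctured bigon (triangle) are the stars of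
   the puncture; the mutable parts of their quivers have the finite mutation
   classes of D_4 (A', bigon, k = 3) and of D_4^(1,1) (the three other cases). *)

(** * Growth of mutation classes *)

(** The obstacle is that surfaces and triangulations form infinite families, and that the valency of
    a puncture is unbounded. The exploration is nevertheless finite, because a branch stops as soon
    as its pattern contains a mutation-infinite subquiver, which for large valencies happens before
    the turn around the puncture is complete. The inequality b_yz > b_zx has to be strict: D_4^(1,1)
    contains oriented triangles of weights 2, 1, 1, which mutation reproduces instead of enlarging.
    The bound 7 comes from the side opposite to the puncture: a point at distance at most 6 cannot
    lie on it once k >= 7, and this side is the only place where the coordinates measured from the
    puncture feel k. The trees, the mutation sequences and the relabellings are data. What is proved
    is the soundness of boolean checkers for them, which work on natural numbers and lists of
    integers so that [vm_compute] can run them. Much of the work lies in the dictionary between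
    these codes and the glued quiver, whose vertices are classes of lattice points in finite
    types. *)

Section MutationType.
Variable Q : ice_quiver.
Implicit Types b : vert Q -> vert Q -> int.

Definition antisym b := forall x y, b x y = (- b y x)%R.

Lemma antisym_mutate b z : antisym b -> antisym (mutate b z).
Proof.
move=> bA x y; rewrite /mutate orbC; case: ifP => _; first by rewrite (bA x y).
rewrite (bA x y); lia.
Qed.

Lemma antisym_seed b : antisym (@adj Q) -> seed_quiver b -> antisym b.
Proof.
move=> QA sb; elim: sb => [|b0 z _ bA _]; first by [].
exact: antisym_mutate.
Qed.

Definition unbounded_entries :=
  forall n : nat, exists b x y, [/\ seed_quiver b, x \notin frozen Q,
    y \notin frozen Q & (n%:Z <= b x y)%R].

(** Isomorphisms preserve entries, and a finite list of finite quivers bounds them. Only entries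
    between mutable vertices are considered, since only mutable parts are compared. *)
Lemma unbounded_infinite : unbounded_entries -> ~ finite_mutation_type Q.
Proof.
move=> unb [n [L isoL]].
pose B := \max_(i : 'I_n) \max_(x : vert (L i)) \max_(y : vert (L i)) `|adj x y|%N.
have [b [x [y [sb fx fy bxy]]]] := unb B.+1.
have [i [f _ fP]] := isoL b sb.
have := fP (Sub x fx : vert (mutable_part b)) (Sub y fy : vert (mutable_part b)).
rewrite /adj /= => bE.
suff : (`|b x y| <= B)%N by lia.
rewrite -bE (leq_trans _ (leq_bigmax i)) // (leq_trans _ (leq_bigmax (f (Sub x fx)))) //.
by rewrite (leq_trans _ (leq_bigmax (f (Sub y fy)))).
Qed.

(** Let m, p, q be the weights of x -> y, y -> z, z -> x. Mutation at y reverses the first two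
    arrows and replaces the third by x -> z of weight m p - q. This is a triangle of the same kind
    with x and y exchanged and (p, q) replaced by (m p - q, p), because m >= 2 and p > q give m p -
    q >= 2 p - q > p. Since p grows at each step while m is kept, the process can be iterated. *)
Lemma growing_triangle b x y z :
  antisym (@adj Q) -> seed_quiver b ->
  x \notin frozen Q -> y \notin frozen Q -> z \notin frozen Q ->
  (2 <= b x y)%R -> (0 < b z x)%R -> (b z x < b y z)%R -> unbounded_entries.
Proof.
move=> QA; move=> sb fx fy fz bxy bzx byz n.
suff [b' [x' [y' [sb' fx' fy' b'2 [b'0 b'lt b'n]]]]] : exists b' x' y',
  [/\ seed_quiver b', x' \notin frozen Q, y' \notin frozen Q, (2 <= b' x' y')%R &
   [/\ (0 < b' z x')%R, (b' z x' < b' y' z)%R & (n%:Z <= b' y' z)%R]].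
  by exists b', y', z.
elim: n => [|n [b' [u [v [sb' fu fv buv [bzu bvz bn]]]]]].
  by exists b, x, y; split=> //; split=> //; lia.
have bA := antisym_seed QA sb'.
have neq w1 w2 : (0 < b' w1 w2)%R -> (w1 == w2) = false.
  by move=> h; apply/eqP=> e; move: h; rewrite e (_ : b' w2 w2 = 0%R) //; move: (bA w2 w2); lia.
exists (mutate b' v), v, u; split=> //; first exact: seed_mutate.
  by rewrite /mutate eqxx /=; move: (bA u v); lia.
have uv : (u == v) = false by apply: neq; lia.
have zu := neq z u bzu.
have zv : (z == v) = false by rewrite eq_sym; apply: neq; lia.
rewrite /mutate eqxx uv zv /= (bA z v) (bA v u) (bA u z).
move: bzu bvz bn buv; move: (b' v z) (b' z u) (b' u v) => p q m.
move=> q0 qp np m2.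
have : (2 * p <= m * p)%R by rewrite ler_pM2r; lia.
have -> : Num.max 0%R p = p by lia.
have -> : Num.max 0%R m = m by lia.
have -> : Num.max 0%R (- m)%R = 0%R by lia.
have -> : Num.max 0%R (- p)%R = 0%R by lia.
rewrite (mulrC m) mulr0 => mp.
by split; lia.
Qed.

End MutationType.

(** Matrices are nested lists, so that mutation sequences evaluate by [vm_compute]. *)
Definition mx_entry (M : seq (seq int)) (i j : nat) : int :=
  nth 0%R (nth [::] M i) j.

Definition mx_build (n : nat) (F : nat -> nat -> int) : seq (seq int) :=
  mkseq (fun i => mkseq (F i) n) n.

Definition mx_mutate (n : nat) (M : seq (seq int)) (z : nat) : seq (seq int) :=
  mx_build n (fun x y =>
    let e := mx_entry M in
    if (x == z) || (y == z) then - e x y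
    else e x y + Num.max 0 (e x z) * Num.max 0 (e z y)
               - Num.max 0 (e y z) * Num.max 0 (e z x))%R.

Lemma mx_buildE n F i j : i < n -> j < n -> mx_entry (mx_build n F) i j = F i j.
Proof. by move=> iN jN; rewrite /mx_entry /mx_build !nth_mkseq. Qed.

Section Restriction.
Variables (Q : ice_quiver) (n : nat) (phi : nat -> vert Q).
Hypothesis phiF : forall i, i < n -> phi i \notin frozen Q.
Hypothesis phiI : forall i j, i < n -> j < n -> phi i = phi j -> i = j.

Definition represents (b : vert Q -> vert Q -> int) M :=
  forall i j, i < n -> j < n -> b (phi i) (phi j) = mx_entry M i j.

(** The new entry at (x, y) involves only x, y and the mutated vertex, so restriction to a full
    subquiver commutes with mutation at its vertices. Injectivity of [phi] makes the test for the
    mutated vertex agree on both sides. *)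
Lemma represents_mutate b M z : z < n -> represents b M ->
  represents (mutate b (phi z)) (mx_mutate n M z).
Proof.
move=> zn bM i j iN jN; rewrite mx_buildE // /mutate !bM //.
have phiE l : l < n -> (phi l == phi z) = (l == z).
  by move=> ln; apply/eqP/eqP => [/phiI->|->].
by rewrite !phiE.
Qed.

(** After the mutations [ms], the triple [g] gives the vertices x, y, z of [growing_triangle]. *)
Definition infinite_cert (M : seq (seq int)) (ms : seq nat) (g : nat * nat * nat) :=
  let N := foldl (mx_mutate n) M ms in
  let: (x, y, z) := g in
  [&& all (gtn n) ms, x < n, y < n, z < n, (2 <= mx_entry N x y)%R,
      (0 < mx_entry N z x)%R & (mx_entry N z x < mx_entry N y z)%R].

Lemma infinite_certP M ms g : antisym (@adj Q) ->
  represents (@adj Q) M -> infinite_cert M ms g -> ~ finite_mutation_type Q.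
Proof.
move=> QA QM; case: g => [[x y] z] /and5P[msn xn yn zn /and3P[h1 h2 h3]].
apply: unbounded_infinite.
have [b sb bN] : exists2 b, seed_quiver b & represents b (foldl (mx_mutate n) M ms).
  have : exists2 b, seed_quiver b & represents b M by exists (@adj Q) => //; constructor.
  elim: ms M {QM h1 h2 h3} msn => [|z' ms IH] M //= /andP[z'n msn] [b sb bM].
  apply: IH => //; exists (mutate b (phi z')).
    by apply: seed_mutate => //; apply: phiF.
  exact: represents_mutate.
apply: (growing_triangle (z := phi z) QA sb (phiF xn) (phiF yn) (phiF zn)); rewrite ?bN //.
Qed.

End Restriction.

Section FiniteClass.
Variable n : nat.

Definition same_up_to (p : seq nat) (A B : seq (seq int)) :=
  perm_eq p (iota 0 n) &&
  all (fun i => all (fun j => mx_entry A i j == mx_entry B (nth 0 p i) (nth 0 p j))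
    (iota 0 n)) (iota 0 n).

(* Each matrix of the list comes with, for each mutation, the index of the
   resulting matrix and the relabelling that identifies them. *)
Definition finite_cert (reps : seq (seq (seq int) * seq (nat * seq nat)))
    (M : seq (seq int)) (start : nat * seq nat) :=
  let leads A (t : nat * seq nat) :=
    (t.1 < size reps) && same_up_to t.2 A (nth [::] (unzip1 reps) t.1) in
  leads M start &&
  all (fun r => all (fun z => leads (mx_mutate n r.1 z) (nth (0, [::]) r.2 z)) (iota 0 n))
      reps.

Variables (Q : ice_quiver).

Definition labels_mutable (phi : nat -> vert Q) :=
  [/\ forall i, i < n -> phi i \notin frozen Q,
      forall i j, i < n -> j < n -> phi i = phi j -> i = j
    & forall v, v \notin frozen Q -> exists2 i, i < n & phi i = v].

(** The permutation [p] sends an index of [A] to the matching index of [B]; the vertex with new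
    label j is therefore the one formerly labelled [index j p]. *)
Lemma relabel phi b A B p : labels_mutable phi -> represents n phi b A ->
  same_up_to p A B -> exists2 psi, labels_mutable psi & represents n psi b B.
Proof.
move=> [phiF phiI phiS] bA /andP[pP /allP AB].
have sp : size p = n by rewrite (perm_size pP) size_iota.
have memp i : (i \in p) = (i < n) by rewrite (perm_mem pP) mem_iota.
have idx i : i < n -> index i p < n by move=> iN; rewrite -[X in _ < X]sp index_mem memp.
exists (fun j => phi (index j p)).
  split=> [i iN|i j iN jN /phiI e|v /phiS[i iN <-]]; first exact/phiF/idx.
    by rewrite -(nth_index 0 (_ : i \in p)) ?memp // e ?idx // nth_index ?memp.
  exists (nth 0 p i); first by rewrite -memp mem_nth ?sp.
  by rewrite index_uniq ?sp // (perm_uniq pP) iota_uniq.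
move=> i j iN jN; rewrite bA ?idx //.
have /AB/allP/(_ (index j p)) : index i p \in iota 0 n by rewrite mem_iota idx.
by rewrite mem_iota idx // => /(_ isT)/eqP->; rewrite !nth_index ?memp.
Qed.

(** A mutation at a mutable vertex acts on the mutable part alone, and every mutable vertex has an
    index, so closure of the list under the mutations at all indices covers all seeds. *)
Lemma finite_certP phi reps M start : labels_mutable phi ->
  represents n phi (@adj Q) M -> finite_cert reps M start -> finite_mutation_type Q.
Proof.
move=> phiP QM /andP[/andP[r0 s0] /allP closed].
pose mat r := nth [::] (unzip1 reps) r.
exists (size reps), (fun r => @Quiver 'I_n (fun x y => mx_entry (mat r) x y)) => b sb.
(* This is the invariant along the mutations; the labelling [psi] changes with the seed. It then
   provides the isomorphism with the listed quiver. *)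
suff [r [psi [psiF psiI psiS] bpsi]] : exists (r : 'I_(size reps)), exists2 psi,
    labels_mutable psi & represents n psi b (mat r).
  exists r.
  have psiX (x : {x : vert Q | x \notin frozen Q}) : exists i : 'I_n, psi i == val x.
    by have [i iN <-] := psiS _ (valP x); exists (Ordinal iN).
  pose f x := xchoose (psiX x).
  have fK x : psi (f x) = val x by exact/eqP/(xchooseP (psiX x)).
  exists f => [|x y]; last by rewrite /adj /= -bpsi ?ltn_ord // !fK.
  exists (fun i : 'I_n => exist _ (psi i) (psiF _ (ltn_ord i))) => [x|i].
    by apply: val_inj; rewrite /= fK.
  by apply: val_inj; apply: psiI; rewrite ?ltn_ord // fK.
elim: {b} sb => [|b z _ [r [psi psiP bpsi]] fz].
  have [psi psiP Qpsi] := relabel phiP QM s0.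
  by exists (Ordinal r0), psi.
have [psiF psiI psiS] := psiP; have [i iN zE] := psiS _ fz; rewrite -{}zE {fz}.
have /closed/allP/(_ i) : nth ([::], [::]) reps r \in reps by rewrite mem_nth.
rewrite mem_iota iN => /(_ isT)/andP[r' sim].
have := represents_mutate psiI iN bpsi.
rewrite /mat (nth_map ([::], [::])) // => bpsi'.
have [psi' psi'P bpsi''] := relabel psiP bpsi' sim.
by exists (Ordinal r'), psi'.
Qed.

End FiniteClass.

(** * Partial gluings of triangles *)

(* A pattern lists the sides of some triangles, three per triangle, with what is
   known of each: 0 (nothing), 1 (a boundary interval), 2 (an arc), or q + 3 (an
   arc, glued to the side q of the pattern). *)
Definition pattern := seq nat.

Definition succ_side (q : nat) := 3 * (q %/ 3) + q.+1 %% 3.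

Definition unglued (st : pattern) q := nth 0 st q \in [:: 0; 2].

Definition glue_sides (st : pattern) q r : pattern :=
  set_nth 0 (set_nth 0 st q r.+3) r q.+3.

Inductive walk_result := Meets of nat | MeetsBoundary | Closes.

(* Turns around the start of the side 0, which is to be a puncture. *)
Fixpoint walk (fuel : nat) (st : pattern) (q : nat) : walk_result :=
  match nth 0 st q with
  | 1 => MeetsBoundary
  | r.+3 => if fuel is f.+1 then
              if succ_side r == 0 then Closes else walk f st (succ_side r)
            else Closes
  | _ => Meets q
  end.

(* The flag selects A': triangulations are then taut, and the boundary intervals
   of each triangle of a pattern are known, as its local quiver depends on them. *)
Definition new_triangles (prime : bool) : seq pattern :=
  if prime then [:: [:: 2; 2; 2]; [:: 1; 2; 2]; [:: 2; 1; 2]] else [:: [:: 0; 0; 0]].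

(** Gluings inside a triangle are left out because triangulations are regular. A new triangle is
    attached by its side 2, so that its side 0 starts where q starts: the triangles added while
    turning around a point all have their corner 0 there. *)
Definition refine_side (prime : bool) (st : pattern) q (arc : bool) : seq pattern :=
  (if arc then [::] else [:: set_nth 0 st q 1]) ++
  [seq glue_sides st q r | r <- iota 0 (size st) & unglued st r && (r %/ 3 != q %/ 3)] ++
  [seq glue_sides (st ++ t) q (size st).+2 | t <- new_triangles prime].

(** A side met while turning around the puncture has to be an arc, and meeting a boundary interval
    there is contradictory. Once the turn is complete, the first unglued side is treated. A pattern
    with nothing left to refine is returned unchanged. *)
Definition refine (prime : bool) (st : pattern) : seq pattern :=
  match walk (size st) st 0 with
  | MeetsBoundary => [::]
  | Meets q => if q < size st then refine_side prime st q true else [:: st]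
  | Closes => let q := find (unglued st) (iota 0 (size st)) in
              if q < size st then refine_side prime st q (nth 0 st q == 2) else [:: st]
  end.

(** Sides 0 and 2 meet at the puncture, so only side 1 can be a boundary interval. *)
Definition root_patterns (prime : bool) : seq pattern :=
  if prime then [:: [:: 2; 2; 2]; [:: 2; 1; 2]] else [:: [:: 0; 0; 0]].

(* The certificate closes the first pattern to do by a leaf, or refines it. *)
Fixpoint explores (prime : bool) (L : Type) (closes : pattern -> L -> bool)
    (todo : seq pattern) (cert : seq (option L)) : bool :=
  match todo, cert with
  | [::], [::] => true
  | st :: todo', Some l :: cert' => closes st l && explores prime closes todo' cert'
  | st :: todo', None :: cert' => explores prime closes (refine prime st ++ todo') cert'
  | _, _ => false
  end.

Section Sides.
Variable T : triangulation.
Implicit Types s : side T.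

Lemma ordSSS (i : 'I_3) : ordS (ordS (ordS i)) = i.
Proof. by apply: val_inj; case: i => [[|[|[|]]]]. Qed.

Lemma next3 s : next_side (next_side (next_side s)) = s.
Proof. by case: s => t i; rewrite /next_side /= ordSSS. Qed.

Lemma next_side_inj : injective (@next_side T).
Proof. by apply: (can_inj (g := fun s => next_side (next_side s))) => s; rewrite next3. Qed.

Lemma same_triangle s s' : s.1 = s'.1 ->
  exists2 j, j < 3 & s' = iter j (@next_side T) s.
Proof.
case: s s' => t i [t' i'] /= <-.
have [-> | [-> | ->]] : i' = i \/ i' = ordS i \/ i' = ordS (ordS i).
  by case: i i' => [[|[|[|]]] // ?] [[|[|[|]]] // ?]; (do ?[by left; apply: val_inj|right]);
    apply: val_inj.
- by exists 0.
- by exists 1.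
by exists 2.
Qed.

Lemma iter_next_inj s j j' : j < 3 -> j' < 3 ->
  iter j (@next_side T) s = iter j' (@next_side T) s -> j = j'.
Proof.
case: s => t i; case: j => [|[|[|]]] // _; case: j' => [|[|[|]]] // _
  => /(congr1 (fun s : side T => val s.2)); by case: i => [[|[|[|]]]].
Qed.

Lemma iter_next_triangle s j : (iter j (@next_side T) s).1 = s.1.
Proof. by elim: j => //= j ->. Qed.

(** For an arc s this is the next side starting at the same marked point. A boundary interval is
    glued to itself, so it is sent to the next side of its triangle; this makes [turn] a permutation
    of all sides. *)
Definition turn s := next_side (glue s).

Lemma turn_inj : injective turn.
Proof. by move=> s s' /next_side_inj/(inv_inj (@glueK T)). Qed.

Lemma bd_glue s : bd_interval (glue s) = bd_interval s.
Proof. by rewrite /bd_interval glueK eq_sym. Qed.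

(** The n-th entry of [ss] is the side of T playing the role of side 0 in the n-th triangle of the
    pattern. The side [s0] is a default value, and in the exploration also the first entry of
    [ss]. *)
Definition pside (ss : seq (side T)) (s0 : side T) q :=
  iter (q %% 3) (@next_side T) (nth s0 ss (q %/ 3)).

Lemma pside_succ ss s0 q : pside ss s0 (succ_side q) = next_side (pside ss s0 q).
Proof.
have /orP[/eqP h|/orP[/eqP h|/eqP h]] : [|| q %% 3 == 0, q %% 3 == 1 | q %% 3 == 2] by lia.
- have e1 : succ_side q %% 3 = 1 by rewrite /succ_side; lia.
  have e2 : succ_side q %/ 3 = q %/ 3 by rewrite /succ_side; lia.
  by rewrite /pside e1 e2 h.
- have e1 : succ_side q %% 3 = 2 by rewrite /succ_side; lia.
  have e2 : succ_side q %/ 3 = q %/ 3 by rewrite /succ_side; lia.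
  by rewrite /pside e1 e2 h.
have e1 : succ_side q %% 3 = 0 by rewrite /succ_side; lia.
have e2 : succ_side q %/ 3 = q %/ 3 by rewrite /succ_side; lia.
by rewrite /pside e1 e2 h /= next3.
Qed.

(** Distinct triangles of the pattern go to distinct triangles of T, which makes [pside] injective.
    Sides that are unglued in the pattern may well be glued to each other in T. *)
Record embeds (st : pattern) (ss : seq (side T)) (s0 : side T) : Prop := Embeds {
  emb_size : size st = 3 * size ss;
  emb_uniq : uniq [seq s.1 | s <- ss];
  emb_bd : forall q, q < size st -> nth 0 st q = 1 -> bd_interval (pside ss s0 q);
  emb_arc : forall q, q < size st -> nth 0 st q = 2 -> ~~ bd_interval (pside ss s0 q);
  emb_glue : forall q r, q < size st -> nth 0 st q = r.+3 ->
    [/\ r < size st, nth 0 st r = q.+3, q != r & glue (pside ss s0 q) = pside ss s0 r] }.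

Lemma pside_inj ss s0 q r : uniq [seq s.1 | s <- ss] ->
  q < 3 * size ss -> r < 3 * size ss -> pside ss s0 q = pside ss s0 r -> q = r.
Proof.
move=> us qs rs e; have q3 : q %/ 3 < size ss by lia. have r3 : r %/ 3 < size ss by lia.
have : (pside ss s0 q).1 = (pside ss s0 r).1 by rewrite e.
rewrite /pside !iter_next_triangle -!(nth_map s0 s0.1 (fun s : side T => s.1)) // => /eqP.
rewrite nth_uniq ?size_map // => /eqP h; move: e; rewrite /pside h => /iter_next_inj.
by rewrite !ltn_mod => /(_ isT isT); lia.
Qed.

Lemma pside_surj ss s0 s : s.1 \in [seq s'.1 | s' <- ss] ->
  exists2 q, q < 3 * size ss & s = pside ss s0 q.
Proof.
case/(nthP s0.1) => n; rewrite size_map => nss; rewrite (nth_map s0) // => /same_triangle[j j3 ->].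
exists (3 * n + j); first by lia.
have e1 : (3 * n + j) %% 3 = j by lia.
have e2 : (3 * n + j) %/ 3 = n by lia.
by rewrite /pside e1 e2.
Qed.

Lemma emb_arcN st ss s0 q : embeds st ss s0 -> q < size st -> 1 < nth 0 st q ->
  ~~ bd_interval (pside ss s0 q).
Proof.
move=> emb qs; case E: (nth 0 st q) => [|[|[|r]]] // _; first exact: emb_arc E.
have [rs _ neq e] := emb_glue emb qs E; rewrite /bd_interval e.
apply/eqP => h; case/eqP: neq; apply/esym/(pside_inj (emb_uniq emb) _ _ h).
  by rewrite -(emb_size emb).
by rewrite -(emb_size emb).
Qed.

(** Since gluing is an involution, a side r already known to be on the boundary or glued elsewhere
    would have a mate in T other than q. *)
Lemma emb_unbound st ss s0 q r : embeds st ss s0 -> q < size st -> r < size st ->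
  unglued st q -> glue (pside ss s0 q) = pside ss s0 r -> q != r -> unglued st r.
Proof.
move=> emb qs rs; rewrite /unglued !inE => uq e neq; case E: (nth 0 st r) => [|[|[|u]]] //.
  have e' : glue (pside ss s0 r) = pside ss s0 q by rewrite -e glueK.
  have := emb_bd emb rs E; rewrite /bd_interval e' => /eqP h.
  case/eqP: neq; apply: (pside_inj (emb_uniq emb) _ _ h); by rewrite -(emb_size emb).
have [us nu _ e'] := emb_glue emb rs E.
have h : pside ss s0 q = pside ss s0 u by rewrite -e' -e glueK.
have qu : q = u by apply: (pside_inj (emb_uniq emb) _ _ h); rewrite -(emb_size emb).
by move: uq; rewrite qu nu.
Qed.

Lemma embeds_glue_sides st ss s0 q r : embeds st ss s0 -> q < size st -> r < size st ->
  unglued st q -> unglued st r -> q != r -> glue (pside ss s0 q) = pside ss s0 r ->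
  embeds (glue_sides st q r) ss s0.
Proof.
move=> emb qs rs uq ur neq e.
have sz : size (glue_sides st q r) = size st by rewrite /glue_sides !size_set_nth; lia.
have nE u : nth 0 (glue_sides st q r) u =
    if u == r then q.+3 else if u == q then r.+3 else nth 0 st u.
  by rewrite /glue_sides !nth_set_nth /= nth_set_nth.
split; first by rewrite sz (emb_size emb).
- exact: emb_uniq emb.
- by move=> u; rewrite sz nE; case: eqP => // _; case: eqP => // _; exact: emb_bd.
- by move=> u; rewrite sz nE; case: eqP => // _; case: eqP => // _; exact: emb_arc.
move=> u v; rewrite sz !nE; case: eqP => [-> _ [<-]|ur'].
  by rewrite eqxx (negPf neq) eq_sym; split=> //; rewrite -e glueK.
case: eqP => [-> _ [<-]|uq' us uv].
  by rewrite eqxx; split.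
have [vs vu nuv e'] := emb_glue emb us uv; split=> //.
have vr : v != r by apply/eqP=> h; move: ur vu; rewrite /unglued h !inE => /orP[]/eqP->.
have vq : v != q by apply/eqP=> h; move: uq vu; rewrite /unglued h !inE => /orP[]/eqP->.
by rewrite (negPf vr) (negPf vq).
Qed.

Variable prime : bool.
Hypothesis regT : regular T.
Hypothesis tautT : prime -> forall (t : triangle T) (i j : 'I_3),
  bd_interval (t, i) -> bd_interval (t, j) -> i = j.

Lemma taut_next s j : 0 < j < 3 -> prime -> bd_interval s ->
  ~~ bd_interval (iter j (@next_side T) s).
Proof.
move=> j3 pr bs; apply/negP; case: s bs => t i bs.
by case: j j3 => [|[|[|j]]] //= _ /(tautT pr bs) /(congr1 val); case: i {bs} => [[|[|[|]]]].
Qed.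

(** Taking [next_side s] as side 0 makes s the side 2 of the new triangle. As s is an arc, tautness
    leaves the three shapes of [new_triangles]. *)
Lemma embeds_new st ss s0 s : embeds st ss s0 -> ~~ bd_interval s ->
  s.1 \notin [seq s'.1 | s' <- ss] ->
  exists2 t, t \in new_triangles prime & embeds (st ++ t) (rcons ss (next_side s)) s0.
Proof.
move=> emb bs sN.
have pold q : q < size st -> pside (rcons ss (next_side s)) s0 q = pside ss s0 q.
  by rewrite (emb_size emb) => qs; rewrite /pside nth_rcons ifT //; lia.
have pnew j : j < 3 -> pside (rcons ss (next_side s)) s0 (size st + j) =
    iter j (@next_side T) (next_side s).
  move=> j3; rewrite /pside (emb_size emb).
  have e1 : (3 * size ss + j) %% 3 = j by lia.
  have e2 : (3 * size ss + j) %/ 3 = size ss by lia.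
  by rewrite e1 e2 nth_rcons ltnn eqxx.
suff [t tN [t3 tP]] : exists2 t, t \in new_triangles prime & size t = 3 /\
    forall j, j < 3 -> match nth 0 t j with
      | 0 => True
      | 1 => bd_interval (iter j (@next_side T) (next_side s))
      | 2 => ~~ bd_interval (iter j (@next_side T) (next_side s))
      | _ => False end.
  have case_q q : q < size (st ++ t) -> q < size st \/ exists2 j, j < 3 & q = size st + j.
    rewrite size_cat t3 => qs; case: (ltnP q (size st)) => h; first by left.
    by right; exists (q - size st); lia.
  have nnew j : nth 0 (st ++ t) (size st + j) = nth 0 t j.
    by rewrite nth_cat ltnNge leq_addr /= addnC addnK.
  have nold q : q < size st -> nth 0 (st ++ t) q = nth 0 st q by rewrite nth_cat => ->.
  exists t => //; split.
  - by rewrite size_cat t3 size_rcons (emb_size emb); lia.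
  - by rewrite map_rcons rcons_uniq sN (emb_uniq emb).
  - move=> q /case_q[qs|[j j3 ->]]; first by rewrite nold // pold //; exact: emb_bd.
    by rewrite nnew pnew // => h; have := tP j j3; rewrite h.
  - move=> q /case_q[qs|[j j3 ->]]; first by rewrite nold // pold //; exact: emb_arc.
    by rewrite nnew pnew // => h; have := tP j j3; rewrite h.
  move=> q r /case_q[qs|[j j3 ->]]; last by rewrite nnew => h; have := tP j j3; rewrite h.
  rewrite nold // => h; have [rs rq neq e] := emb_glue emb qs h.
  by rewrite size_cat !pold // nold // ltn_addr.
rewrite /new_triangles; case pr: prime; last by exists [:: 0; 0; 0] => //; split=> // [[|[|[|]]]].
have nn : bd_interval (next_side s) -> bd_interval (next_side (next_side s)) -> False.
  by move=> b1 b2; have := taut_next (j := 1) isT pr b1; rewrite /= b2.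
case b1: (bd_interval (next_side s)); last case b2: (bd_interval (next_side (next_side s))).
- exists [:: 1; 2; 2]; rewrite ?inE //; split=> // [[|[|[|]]]] //= _; last by rewrite next3.
  by apply/negP; apply: nn.
- by exists [:: 2; 1; 2]; rewrite ?inE //; split=> // [[|[|[|]]]] //= _; rewrite ?next3 ?b1.
by exists [:: 2; 2; 2]; rewrite ?inE //; split=> // [[|[|[|]]]] //= _; rewrite ?next3 ?b1 ?b2.
Qed.

(** The mate of the side q in T selects the refinement: the side itself, a side of a triangle
    already in the pattern, or a side of another triangle. *)
Lemma refine_sideP st ss s0 q (arc : bool) : embeds st ss s0 -> q < size st -> unglued st q ->
  (arc -> ~~ bd_interval (pside ss s0 q)) ->
  exists2 st', st' \in refine_side prime st q arc &
    exists2 ss', embeds st' ss' s0 & prefix ss ss'.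
Proof.
move=> emb qs uq arcP; case bq: (bd_interval (pside ss s0 q)).
  case: arc arcP => [/(_ isT)|_]; first by rewrite bq.
  exists (set_nth 0 st q 1); first by rewrite /refine_side inE eqxx.
  exists ss; last exact: prefix_refl.
  have sz : size (set_nth 0 st q 1) = size st by rewrite size_set_nth; lia.
  split; first by rewrite sz (emb_size emb).
  - exact: emb_uniq emb.
  - move=> u; rewrite sz nth_set_nth /=; case: eqP => [-> //|_]; exact: emb_bd.
  - move=> u; rewrite sz nth_set_nth /=; case: eqP => // _; exact: emb_arc.
  move=> u v; rewrite sz !nth_set_nth /=; case: eqP => // uq' us uv.
  have [vs vu nuv e'] := emb_glue emb us uv; split=> //.
  by case: eqP => // h; move: uq vu; rewrite /unglued h !inE => /orP[]/eqP->.
have [gin|gout] := boolP ((glue (pside ss s0 q)).1 \in [seq s'.1 | s' <- ss]).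
  have [r rs e] := pside_surj s0 gin; rewrite -(emb_size emb) in rs.
  have neq : q != r by apply/eqP => h; move: bq; rewrite /bd_interval e h eqxx.
  have ur := emb_unbound emb qs rs uq e neq.
  exists (glue_sides st q r).
    rewrite /refine_side !mem_cat; apply/orP; right; apply/orP; left.
    apply: map_f; rewrite mem_filter ur mem_iota rs /= andbT; apply/eqP => h.
    (* If the mate lay in the same triangle, regularity would make it the side itself, which would
       then be a boundary interval. *)
    have t12 : (pside ss s0 q).1 = (pside ss s0 r).1.
      by rewrite /pside !iter_next_triangle h.
    move: (bq) (e); rewrite /bd_interval; move: t12; case: (pside ss s0 q) => t i.
    case: (pside ss s0 r) => t' j /= <- bq' e'; move: bq'.
    by rewrite e' (regT e') eqxx.
  exists ss; last exact: prefix_refl.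
  exact: embeds_glue_sides.
have [|t tN emb'] := embeds_new emb _ gout; first by rewrite bd_glue bq.
have t3 : size t = 3.
  by have := emb_size emb'; rewrite size_cat size_rcons (emb_size emb) mulnS [RHS]addnC => /addnI.
exists (glue_sides (st ++ t) q (size st).+2).
  by rewrite /refine_side !mem_cat; apply/orP; right; apply/orP; right; apply: map_f.
exists (rcons ss (next_side (glue (pside ss s0 q)))); last exact: prefix_rcons.
have sE := emb_size emb.
apply: embeds_glue_sides => //; rewrite ?size_cat ?t3.
- by lia.
- by lia.
- by rewrite /unglued nth_cat qs.
- rewrite /unglued nth_cat ltnNge -addn2 leq_addr /= addnC addnK.
  by move: tN; rewrite /new_triangles; case: ifP => _; rewrite !inE; do ?[move/orP; case]; move=> /eqP->.
- by lia.
have e1 : (size st).+2 %% 3 = 2 by lia.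
have e2 : (size st).+2 %/ 3 = size ss by lia.
have q3 : q %/ 3 < size ss by rewrite ltn_divLR // mulnC -sE.
by rewrite /pside e1 e2 !nth_rcons ltnn eqxx q3 /= next3.
Qed.

Definition around_puncture s0 := forall j, ~~ bd_interval (iter j turn s0).

(** All sides visited are iterates of [turn] at [s0], hence arcs. The answer [Closes] is also given
    when the fuel runs out, so nothing is claimed in that case. *)
Lemma walkP st ss s0 fuel q :
  embeds st ss s0 -> around_puncture s0 -> 0 < size ss -> q < size st ->
  (exists j, pside ss s0 q = iter j turn s0) ->
  match walk fuel st q with
  | Meets r => r < size st -> unglued st r /\ ~~ bd_interval (pside ss s0 r)
  | MeetsBoundary => False
  | Closes => True
  end.
Proof.
move=> emb pt ss0; elim: fuel q => [|f IH] q qs [j qj] /=; case E: (nth 0 st q) => [|[|[|r]]] //.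
- by rewrite /unglued E qj.
- by have := emb_bd emb qs E; rewrite qj (negPf (pt j)).
- by rewrite /unglued E qj.
- by rewrite /unglued E qj.
- by have := emb_bd emb qs E; rewrite qj (negPf (pt j)).
- by rewrite /unglued E qj.
case: eqP => // _; have [rs _ _ e] := emb_glue emb qs E; apply: IH.
  by move: rs; rewrite (emb_size emb) /succ_side; lia.
by exists j.+1; rewrite pside_succ -e qj.
Qed.

Lemma refineP st ss s0 : embeds st ss s0 -> around_puncture s0 -> nth s0 ss 0 = s0 ->
  0 < size ss ->
  exists2 st', st' \in refine prime st & exists2 ss', embeds st' ss' s0 & prefix ss ss'.
Proof.
move=> emb pt n0 ss0; rewrite /refine.
have here : exists2 st', st' \in [:: st] & exists2 ss', embeds st' ss' s0 & prefix ss ss'.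
  by exists st; rewrite ?inE //; exists ss => //; apply: prefix_refl.
have st0 : 0 < size st by rewrite (emb_size emb) muln_gt0.
have j0 : exists j, pside ss s0 0 = iter j turn s0 by exists 0; rewrite /pside n0.
have := walkP (size st) emb pt ss0 st0 j0.
case: (walk _ _ _) => [q|[]|_].
  by case: ifP => // qs [//|uq bq]; apply: refine_sideP.
case: ifP => // qs; apply: refine_sideP => //.
  have /(nth_find 0) : has (unglued st) (iota 0 (size st)).
    by rewrite has_find size_iota.
  by rewrite nth_iota.
by move/eqP; apply: (emb_arc emb).
Qed.

(** Some pattern of the list always embeds with [s0] as its side 0: a refinement step replaces a
    pattern that embeds by patterns one of which embeds. When the list is exhausted, such a pattern
    has been closed by a leaf. *)
Lemma exploresP (L : Type) (closes : pattern -> L -> bool) todo cert (G : Prop) s0 :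
  around_puncture s0 ->
  (forall st l ss, closes st l -> embeds st ss s0 -> G) ->
  explores prime closes todo cert ->
  (exists2 st, st \in todo & exists ss, [/\ embeds st ss s0, nth s0 ss 0 = s0 & 0 < size ss]) ->
  G.
Proof.
move=> pt closesP; elim: cert todo => [|[l|] cert IH] [|st todo] //=.
- by move=> _ [].
- by case/andP=> cl /IH IHt [st']; rewrite inE => /orP[/eqP->[ss [emb _ _]]|st'in h];
    [exact: closesP cl emb | apply: IHt; exists st'].
move=> /IH IHt [st']; rewrite inE => /orP[/eqP->|st'in] [ss [emb n0 ss0]]; apply: IHt.
  have [st1 st1in [ss' emb' /prefixP[ss2 ss'E]]] := refineP emb pt n0 ss0.
  exists st1; first by rewrite mem_cat st1in.
  exists ss'; split=> //; rewrite ss'E ?nth_cat ?ss0 //.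
  by rewrite size_cat addn_gt0 ss0.
by exists st'; [rewrite mem_cat st'in orbT | exists ss].
Qed.

Lemma root_embeds s0 : around_puncture s0 ->
  exists2 st, st \in root_patterns prime & embeds st [:: s0] s0.
Proof.
move=> pt; have b0 : ~~ bd_interval s0 by exact: (pt 0).
have b2 : ~~ bd_interval (next_side (next_side s0)).
  (* The last side before the turn returns to [s0] is glued to the side preceding [s0] in its
     triangle; being around the puncture, it is an arc, and so is its mate. *)
  have := pt (order turn s0).-1; have := iter_order turn_inj s0.
  rewrite -[order turn s0]prednK ?order_gt0 //= -/turn; set s := iter _ _ _ => <-.
  by rewrite next3 bd_glue.
suff [st stR [s3 stP]] : exists2 st, st \in root_patterns prime & size st = 3 /\
    forall j, j < 3 -> match nth 0 st j with
      | 0 => True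
      | 1 => bd_interval (iter j (@next_side T) s0)
      | 2 => ~~ bd_interval (iter j (@next_side T) s0)
      | _ => False end.
  have pE q : q < 3 -> pside [:: s0] s0 q = iter q (@next_side T) s0.
    by move=> q3; rewrite /pside modn_small // divn_small.
  exists st => //; split=> //.
  - by move=> q; rewrite s3 => q3 h; have := stP q q3; rewrite h pE.
  - by move=> q; rewrite s3 => q3 h; have := stP q q3; rewrite h pE.
  by move=> q r; rewrite s3 => q3 h; have := stP q q3; rewrite h.
rewrite /root_patterns; case pr: prime; last by exists [:: 0; 0; 0] => //; split=> // [[|[|[|]]]].
case b1: (bd_interval (next_side s0)).
  by exists [:: 2; 1; 2]; rewrite ?inE //; split=> // [[|[|[|]]]].
by exists [:: 2; 2; 2]; rewrite ?inE //; split=> // [[|[|[|]]]] //= _; rewrite b1.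
Qed.

End Sides.

(** * Vertices of the quivers over a partial gluing *)

(* The lattice point of the n-th triangle of a pattern with weights k - x - y,
   x, y at the starts of its sides 0, 1, 2. *)
Definition code := (nat * (nat * nat))%type.

Section Codes.
Variables (prime : bool) (k : nat) (st : pattern).
Implicit Types u v : code.

Definition weight (x y i : nat) : nat :=
  match i with 0 => k - x - y | 1 => x | _ => y end.

(* The side carrying a point, and the weight at the start of this side. *)
Definition on_side (x y : nat) : option (nat * nat) :=
  if y == 0 then Some (0, k - x) else if x == 0 then Some (2, y)
  else if x + y == k then Some (1, x) else None.

Definition side_point (i m : nat) : nat * nat :=
  match i with 0 => (k - m, 0) | 1 => (m, k - m) | _ => (0, m) end.

(** Gluing reverses directions, so a weight m at the start of a side becomes k - m at the start of
    its mate. A point with no known mate is its own partner. *)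
Definition partner v : code :=
  if on_side v.2.1 v.2.2 is Some (i, m) then
    if nth 0 st (3 * v.1 + i) is r.+3 then (r %/ 3, side_point (r %% 3) (k - m)) else v
  else v.

Definition pattern_bottom (n : nat) : option nat :=
  if prime then
    if nth 0 st (3 * n) == 1 then Some 0 else
    if nth 0 st (3 * n + 1) == 1 then Some 1 else
    if nth 0 st (3 * n + 2) == 1 then Some 2 else None
  else None.

(** Each of the three directions of arrows keeps one weight, which must be positive: no arrow runs
    along a side. *)
Definition Qk_code_arrow (x y x' y' : nat) : bool :=
  [|| [&& x + y < k, x == x'.+1 & y' == y.+1],
      [&& 0 < x, x' == x & y == y'.+1] |
      [&& 0 < y, y' == y & x' == x.+1]].

Definition Qk1_code_arrow (e x y x' y' : nat) : bool :=
  let onL x y := weight x y e == 0 in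
  let onR x y := weight x y (e.+1 %% 3) == 0 in
  let top x y := weight x y (e.+2 %% 3) in
  [|| [&& onR x y, onL x' y' & top x y == top x' y'],
      [&& onL x y, onR x' y' & top x y == (top x' y').+1] |
      [&& onR x y, onR x' y' & top x' y' == (top x y).+1]].

(** The vertex M of Q_k^1 receives no code; it is frozen, and codes serve for mutable vertices. *)
Definition code_vertex v : bool :=
  let: (n, (x, y)) := v in
  [&& n < size st %/ 3, x < k, y < k, 0 < x + y, x + y <= k &
      if pattern_bottom n is Some e then
        (0 < weight x y (e.+2 %% 3)) &&
        ((weight x y e == 0) || (weight x y (e.+1 %% 3) == 0))
      else true].

Definition code_mutable v : bool :=
  if on_side v.2.1 v.2.2 is Some (i, _) then 2 < nth 0 st (3 * v.1 + i) else true.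

Definition code_arrow u v : bool :=
  (u.1 == v.1) &&
  if pattern_bottom u.1 is Some e then Qk1_code_arrow e u.2.1 u.2.2 v.2.1 v.2.2
  else Qk_code_arrow u.2.1 u.2.2 v.2.1 v.2.2.

Definition code_class v : seq code := if partner v == v then [:: v] else [:: v; partner v].

Definition code_adj u v : int :=
  foldr (fun u' a => foldr (fun v' b =>
    ((code_arrow u' v')%:Z - (code_arrow v' u')%:Z + b)%R) a (code_class v)) 0%R (code_class u).

Definition code_mx (vs : seq code) : seq (seq int) :=
  mx_build (size vs) (fun i j => code_adj (nth (0, (0, 0)) vs i) (nth (0, (0, 0)) vs j)).

(** For A', the local quiver of a triangle is determined only when the nature of its three sides is
    known. *)
Definition typed (n : nat) : bool := prime ==> all (fun i => nth 0 st (3 * n + i) != 0) [:: 0; 1; 2].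

(** These are the codes of mutable vertices whose entire class is visible in the pattern, so that no
    arrow at the vertex between listed vertices can be missed. *)
Definition good_code v : bool :=
  let v' := partner v in
  [&& code_vertex v, code_mutable v, typed v.1 & partner v' == v] &&
  [&& code_vertex v', code_mutable v' & typed v'.1].

Definition good_codes (vs : seq code) : bool :=
  all good_code vs && pairwise (fun u v => (u != v) && (u != partner v)) vs.

End Codes.

(** * Lattice points and local arrows in coordinates based at an arbitrary corner *)

Section LatticePoints.
Variable k : nat.
Implicit Types (u v : lattice k) (c e i : 'I_3).

Lemma ord3P c i : [\/ i = c, i = ordS c | i = ordS (ordS c)].
Proof.
case: i c => [[|[|[|]]] // ?] [[|[|[|]]] // ?];
  by [apply: Or31; apply: val_inj | apply: Or32; apply: val_inj | apply: Or33; apply: val_inj].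
Qed.

Definition lattice_vertex v : bool := (\sum_i wt v i == k) && [forall i, wt v i != k].

Lemma sum_ord3 (F : 'I_3 -> nat) c : \sum_i F i = F c + F (ordS c) + F (ordS (ordS c)).
Proof.
rewrite (bigD1 c) //= (bigD1 (ordS c)) /=; last first.
  by case: c => [[|[|[|]]]].
rewrite (bigD1 (ordS (ordS c))) /=; last by case: c => [[|[|[|]]]].
rewrite big1 ?addn0 ?addnA // => i; by case: (ord3P c i) => ->; rewrite eqxx ?andbF.
Qed.

Lemma lattice_vertexP c v : lattice_vertex v ->
  [/\ wt v c + wt v (ordS c) + wt v (ordS (ordS c)) = k,
      wt v c < k, wt v (ordS c) < k & wt v (ordS (ordS c)) < k].
Proof.
case/andP=> /eqP; rewrite (sum_ord3 _ c) => e /forallP h.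
by have := h c; have := h (ordS c); have := h (ordS (ordS c)); split; lia.
Qed.

Lemma lattice_vertexI v c : wt v c + wt v (ordS c) + wt v (ordS (ordS c)) = k ->
  wt v c < k -> wt v (ordS c) < k -> wt v (ordS (ordS c)) < k -> lattice_vertex v.
Proof.
move=> e h0 h1 h2; rewrite /lattice_vertex (sum_ord3 _ c) e eqxx /=; apply/forallP=> i.
by case: (ord3P c i) => ->; rewrite neq_ltn ?h0 ?h1 ?h2.
Qed.

Lemma lattice_eq u v c : wt u c = wt v c -> wt u (ordS c) = wt v (ordS c) ->
  wt u (ordS (ordS c)) = wt v (ordS (ordS c)) -> u = v.
Proof.
move=> h0 h1 h2; apply: eq_from_tnth => i; apply: val_inj.
by case: (ord3P c i) => ->.
Qed.

(** This form of the arrows is cyclically symmetric in the corners, so that it can be read in a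
    triangle whose corners are numbered from any of the three. *)
Lemma Qk_arrowP u v : lattice_vertex u -> lattice_vertex v ->
  @Qk_arrow k (Some u) (Some v) =
  [exists i, [&& wt u i == wt v i, 0 < wt u i, wt u (ordS i) == (wt v (ordS i)).+1 &
                 wt v (ordS (ordS i)) == (wt u (ordS (ordS i))).+1]].
Proof.
move=> /(lattice_vertexP ord0)[su _ _ _] /(lattice_vertexP ord0)[sv _ _ _].
have o1 : ordS (ord0 : 'I_3) = Ordinal (isT : 1 < 3) by exact: val_inj.
have o2 : ordS (ordS (ord0 : 'I_3)) = Ordinal (isT : 2 < 3) by exact: val_inj.
have atE (w : lattice k) p q r : ([seq val n | n <- w] == [:: p; q; r]) =
    [&& wt w ord0 == p, wt w (ordS ord0) == q & wt w (ordS (ordS ord0)) == r].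
  rewrite o2 o1; case: w => [[|w0 [|w1 [|w2 [|w3 s]]]] // Hw].
  by rewrite /wt !(tnth_nth w0) /= !eqseq_cons andbT.
have o3 : ordS (ordS (ordS (ord0 : 'I_3))) = ord0 by exact: val_inj.
have ex3 (P : pred 'I_3) : [exists i, P i] =
    [|| P ord0, P (ordS ord0) | P (ordS (ordS ord0))].
  apply/existsP/idP => [[i]|/or3P[] h]; last by eexists; exact: h.
  - by case: (ord3P ord0 i) => ->->; rewrite ?orbT.
  - by eexists; exact: h.
  by eexists; exact: h.
rewrite ex3 o3; apply/existsP/idP => [[i /existsP[j /existsP[l]]]|].
  by rewrite /= !atE; case/andP=> _; case/or3P => /andP[/and3P[/eqP-> /eqP-> /eqP->]
    /and3P[/eqP-> /eqP-> /eqP->]]; rewrite !eqxx ?orbT.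
move: su sv (atE u) (atE v); clear atE o1 o2 o3 ex3.
move: (wt u ord0) (wt u (ordS ord0)) (wt u (ordS (ordS ord0))) (wt v ord0)
  (wt v (ordS ord0)) (wt v (ordS (ordS ord0))) => a b d a' b' d' su sv atu atv.
have wit (i j l : nat) : i < k -> j < k -> l < k ->
    (i + j + l + 2 == k) &&
    [|| [&& a == i.+1, b == j.+1 & d == l] && [&& a' == i.+1, b' == j & d' == l.+1],
        [&& a == i.+1, b == j & d == l.+1] && [&& a' == i, b' == j.+1 & d' == l.+1] |
        [&& a == i, b == j.+1 & d == l.+1] && [&& a' == i.+1, b' == j.+1 & d' == l]] ->
    exists x : 'I_k, [exists y : 'I_k, exists z : 'I_k,
      let p := [:: x.+1; y.+1; z : nat] in
      let q := [:: x.+1; y : nat; z.+1] in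
      let r := [:: x : nat; y.+1; z.+1] in
      let at_ v s := [seq val n | n <- v] == s in
      (x + y + z + 2 == k) &&
      [|| at_ u p && at_ v q, at_ u q && at_ v r | at_ u r && at_ v p]].
  move=> ik jk lk h; exists (Ordinal ik); apply/existsP; exists (Ordinal jk).
  by apply/existsP; exists (Ordinal lk); rewrite /= !atu !atv.
(* To find (i, j, l), lower by one the weight kept by the arrow, and take the smaller of the two
   values for the other weights. *)
clear atu atv; case/or3P => /and4P[/eqP h1 h2 /eqP h3 /eqP h4].
- by apply: (wit a.-1 b' d); lia.
- by apply: (wit a b.-1 d'); lia.
by apply: (wit a' b d.-1); lia.
Qed.

End LatticePoints.

Section CornerCoordinates.
Variable k : nat.
Implicit Types (u v : lattice k) (c e i : 'I_3).

(** The corner c starts the side chosen as side 0; it absorbs the rotation between the corners of a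
    triangle of T and the numbering of the pattern. *)
Definition corner_point c (x y : nat) : lattice k :=
  [tuple inord (weight k x y ((i + 3 - c) %% 3)) | i < 3].

Lemma wt_corner_point c x y j : x + y <= k -> j < 3 ->
  wt (corner_point c x y) (iter j (@ordS 3) c) = weight k x y j.
Proof.
move=> xyk j3; rewrite /wt tnth_mktuple.
have -> : (iter j (@ordS 3) c + 3 - c) %% 3 = j.
  by case: c j j3 => [[|[|[|]]] // ?] [|[|[|]]].
rewrite inordK //; case: j j3 => [|[|[|]]] //= _; lia.
Qed.

Lemma corner_point_wt c v : lattice_vertex v ->
  v = corner_point c (wt v (ordS c)) (wt v (ordS (ordS c))).
Proof.
move=> /(lattice_vertexP c)[e h0 h1 h2].
have le : wt v (ordS c) + wt v (ordS (ordS c)) <= k by lia.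
apply: (@lattice_eq k _ _ c).
- by rewrite (wt_corner_point c le (j := 0)) //=; lia.
- by rewrite (wt_corner_point c le (j := 1)).
by rewrite (wt_corner_point c le (j := 2)).
Qed.

Definition inner_coords x y := [&& x < k, y < k, 0 < x + y & x + y <= k].

Lemma corner_point_vertex c x y : inner_coords x y -> lattice_vertex (corner_point c x y).
Proof.
case/and4P=> xk yk xy0 xyk.
have h0 := wt_corner_point c xyk (isT : 0 < 3).
have h1 := wt_corner_point c xyk (isT : 1 < 3).
have h2 := wt_corner_point c xyk (isT : 2 < 3).
by rewrite /= in h0 h1 h2; apply: (@lattice_vertexI k _ c); lia.
Qed.

Lemma corner_point_inj c x y x' y' : x + y <= k -> x' + y' <= k ->
  corner_point c x y = corner_point c x' y' -> x = x' /\ y = y'.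
Proof.
move=> h h' e; have h1 := wt_corner_point c h (isT : 1 < 3).
have h2 := wt_corner_point c h (isT : 2 < 3).
rewrite e (wt_corner_point c h' (isT : 1 < 3)) in h1.
by rewrite e (wt_corner_point c h' (isT : 2 < 3)) in h2.
Qed.

Lemma exists_ord3 c (P : pred 'I_3) :
  [exists i, P i] = [|| P c, P (ordS c) | P (ordS (ordS c))].
Proof.
apply/existsP/idP => [[i]|/or3P[] h]; last by eexists; exact: h.
- by case: (ord3P c i) => ->->; rewrite ?orbT.
- by eexists; exact: h.
by eexists; exact: h.
Qed.

Lemma Qk_code_arrowP c x y x' y' : inner_coords x y -> inner_coords x' y' ->
  @Qk_arrow k (Some (corner_point c x y)) (Some (corner_point c x' y')) =
  Qk_code_arrow k x y x' y'.
Proof.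
move=> xyP x'y'P; rewrite Qk_arrowP ?corner_point_vertex // (exists_ord3 c) ordSSS.
case/and4P: xyP => xk yk xy0 xyk; case/and4P: x'y'P => x'k y'k xy'0 xy'k.
have := wt_corner_point c xyk (isT : 0 < 3); have := wt_corner_point c xyk (isT : 1 < 3).
have := wt_corner_point c xyk (isT : 2 < 3); have := wt_corner_point c xy'k (isT : 0 < 3).
have := wt_corner_point c xy'k (isT : 1 < 3); have := wt_corner_point c xy'k (isT : 2 < 3).
move=> /= -> -> -> -> -> ->; rewrite /Qk_code_arrow; lia.
Qed.

Lemma Qk1_vertexE e u : @Qk1_vertex k e (Some u) =
  [&& lattice_vertex u, 0 < wt u (ordS (ordS e)) & (wt u e == 0) || (wt u (ordS e) == 0)].
Proof.
rewrite /Qk1_vertex /isL /isR; apply/existsP/and3P => [[a /andP[a0 h]]|[]].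
  have ak := ltn_ord a; move: (nat_of_ord a) ak a0 h => {}a ak a0 h.
  by split; [apply: (@lattice_vertexI k _ e); lia | lia | lia].
move=> /(lattice_vertexP e)[s h0 h1 h2] t0 h; exists (Ordinal h2); rewrite /=; lia.
Qed.

(** The index a of L_a and R_a is the top weight, so the arrows can be tested on weights without a
    search for a. *)
Lemma Qk1_arrowE e u v : @Qk1_vertex k e (Some u) -> @Qk1_vertex k e (Some v) ->
  @Qk1_arrow k e (Some u) (Some v) =
  [|| [&& wt u (ordS e) == 0, wt v e == 0 & wt u (ordS (ordS e)) == wt v (ordS (ordS e))],
      [&& wt u e == 0, wt v (ordS e) == 0 &
          wt u (ordS (ordS e)) == (wt v (ordS (ordS e))).+1] |
      [&& wt u (ordS e) == 0, wt v (ordS e) == 0 &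
          wt v (ordS (ordS e)) == (wt u (ordS (ordS e))).+1]].
Proof.
rewrite !Qk1_vertexE => /and3P[/(lattice_vertexP e)[su u0 u1 u2] ut uLR].
move=> /and3P[/(lattice_vertexP e)[sv v0 v1 v2] vt vLR].
rewrite /Qk1_arrow /isL /isR; apply/existsP/idP => [[a h]|h].
  have ak := ltn_ord a; move: (nat_of_ord a) ak h => {}a ak h; lia.
case/or3P: h => /and3P[/eqP h1 /eqP h2 /eqP h3].
- exists (Ordinal u2); apply/orP; left; rewrite /=; clear uLR vLR.
  by apply/andP; split=> //; apply/andP; split; apply/and3P; split; lia.
- exists (Ordinal u2); apply/orP; right; rewrite /=; clear uLR vLR.
  apply/andP; split; first by lia.
  by apply/orP; left; apply/andP; split; apply/and3P; split; lia.
exists (Ordinal v2); apply/orP; right; rewrite /=; clear uLR vLR.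
apply/andP; split; first by lia.
by apply/orP; right; apply/andP; split; apply/and3P; split; lia.
Qed.

Lemma Qk1_code_vertexP c (e x y : nat) : e < 3 -> inner_coords x y ->
  @Qk1_vertex k (iter e (@ordS 3) c) (Some (corner_point c x y)) =
  (0 < weight k x y (e.+2 %% 3)) &&
  ((weight k x y e == 0) || (weight k x y (e.+1 %% 3) == 0)).
Proof.
move=> e3 xyP; rewrite Qk1_vertexE corner_point_vertex //=; case/and4P: xyP => _ _ _ xyk.
have := wt_corner_point c xyk (isT : 0 < 3); have := wt_corner_point c xyk (isT : 1 < 3).
have := wt_corner_point c xyk (isT : 2 < 3).
by case: e e3 => [|[|[|]]] // _ h2 h1 h0; rewrite /= ?ordSSS ?h0 ?h1 ?h2.
Qed.

Lemma Qk1_code_arrowP c (e x y x' y' : nat) : e < 3 -> inner_coords x y -> inner_coords x' y' ->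
  @Qk1_vertex k (iter e (@ordS 3) c) (Some (corner_point c x y)) ->
  @Qk1_vertex k (iter e (@ordS 3) c) (Some (corner_point c x' y')) ->
  @Qk1_arrow k (iter e (@ordS 3) c) (Some (corner_point c x y)) (Some (corner_point c x' y')) =
  Qk1_code_arrow k e x y x' y'.
Proof.
move=> e3 xyP x'y'P uP vP; rewrite (Qk1_arrowE uP vP).
case/and4P: xyP => _ _ _ xyk; case/and4P: x'y'P => _ _ _ xy'k.
have := wt_corner_point c xyk (isT : 0 < 3); have := wt_corner_point c xyk (isT : 1 < 3).
have := wt_corner_point c xyk (isT : 2 < 3); have := wt_corner_point c xy'k (isT : 0 < 3).
have := wt_corner_point c xy'k (isT : 1 < 3); have := wt_corner_point c xy'k (isT : 2 < 3).
move=> /= q2 q1 q0 p2 p1 p0.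
by case: e e3 {uP vP} => [|[|[|]]] // _; rewrite /= ?ordSSS ?q2 ?q1 ?q0 ?p2 ?p1 ?p0.
Qed.

(** A point on two sides would be a corner, and corners are excluded. *)
Lemma at_side_uniq u i i' m m' : lattice_vertex u -> at_side i m u -> at_side i' m' u ->
  i = i' /\ m = m'.
Proof.
move=> /(lattice_vertexP i)[s h0 h1 h2] /and3P[/eqP e0 /eqP e1 /eqP e2].
case: (ord3P i i') => ->; rewrite /at_side ?ordSSS => /and3P[/eqP f0 /eqP f1 /eqP f2].
- by split=> //; rewrite -e0 -f0.
- by exfalso; lia.
by exfalso; lia.
Qed.

Lemma at_side_eq u v i m : at_side i m u -> at_side i m v -> u = v.
Proof.
move=> /and3P[/eqP a0 /eqP a1 /eqP a2] /and3P[/eqP b0 /eqP b1 /eqP b2].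
by apply: (@lattice_eq k _ _ i); rewrite ?a0 ?a1 ?a2 ?b0 ?b1 ?b2.
Qed.

Lemma on_side_at c x y (i m : nat) : inner_coords x y -> on_side k x y = Some (i, m) ->
  [/\ i < 3, m <= k & at_side (iter i (@ordS 3) c) m (corner_point c x y)].
Proof.
case/and4P=> xk yk xy0 xyk; have := wt_corner_point c xyk (isT : 0 < 3).
have := wt_corner_point c xyk (isT : 1 < 3); have := wt_corner_point c xyk (isT : 2 < 3).
move=> /= h2 h1 h0; rewrite /on_side.
case: eqP => [e [<- <-]|_].
  by rewrite /at_side /= h0 h1 h2; split; lia.
case: eqP => [e [<- <-]|_].
  by rewrite /at_side /= ordSSS h0 h1 h2; split; lia.
case: eqP => // e [<- <-].
by rewrite /at_side /= ordSSS h0 h1 h2; split; lia.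
Qed.

Lemma off_side_at c x y i m : inner_coords x y -> on_side k x y = None ->
  ~~ at_side i m (corner_point c x y).
Proof.
case/and4P=> xk yk xy0 xyk; have := wt_corner_point c xyk (isT : 0 < 3).
have := wt_corner_point c xyk (isT : 1 < 3); have := wt_corner_point c xyk (isT : 2 < 3).
move=> /= h2 h1 h0; rewrite /on_side; do 3![case: eqP => // ?] => _.
by case: (ord3P c i) => ->; rewrite /at_side ?ordSSS ?h0 ?h1 ?h2; lia.
Qed.

Lemma side_point_at c (i m : nat) : i < 3 -> m <= k ->
  at_side (iter i (@ordS 3) c) m (corner_point c (side_point k i m).1 (side_point k i m).2).
Proof.
move=> i3 mk; have le : (side_point k i m).1 + (side_point k i m).2 <= k.
  by case: i i3 => [|[|[|]]] //= _; lia.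
have := wt_corner_point c le (isT : 0 < 3); have := wt_corner_point c le (isT : 1 < 3).
have := wt_corner_point c le (isT : 2 < 3); rewrite /at_side.
by case: i i3 {le} => [|[|[|]]] //= _; rewrite ?ordSSS => -> -> ->; lia.
Qed.

End CornerCoordinates.

(** * Full subquivers of the glued quivers *)

Lemma connect_pair (X : finType) (r : rel X) (a b : X) :
  (forall x y, r x y -> x \in [set a; b] -> y \in [set a; b]) ->
  forall y, connect r a y -> y \in [set a; b].
Proof.
move=> rP y /connectP[p ap ->].
suff gen x : x \in [set a; b] -> path r x p -> last x p \in [set a; b].
  by apply: gen ap; rewrite !inE eqxx.
elim: p x {ap} => [|z p IH] x xab //= /andP[xz]; exact/IH/(rP _ _ xz xab).
Qed.

Lemma big_set2 (I : finType) (a b : I) (F : I -> int) :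
  (\sum_(i in [set a; b]) F i = F a + if b == a then 0 else F b)%R.
Proof.
case: eqP => [->|/eqP neq]; first by rewrite setUid big_set1 addr0.
by rewrite big_setU1 ?big_set1 // inE eq_sym.
Qed.

Section Amalgam.
Variables (T : triangulation) (k : nat) (bot : triangle T -> option 'I_3).

(** This covers both algebras: the constant [None] for [bot] gives [quiver_A], and [bottom] gives
    [quiver_A']. *)
Definition local_has (t : triangle T) : pred (local_vertex k) :=
  if bot t is Some e then @Qk1_vertex k e else @Qk_vertex k.
Definition local_arrow (t : triangle T) : rel (local_vertex k) :=
  if bot t is Some e then @Qk1_arrow k e else @Qk_arrow k.

Notation piece := (piece_vertex local_has).
Notation Q := (amalgam local_has local_arrow).
Implicit Types x y : piece.

Lemma piece_lattice x t u : val x = (t, Some u) -> lattice_vertex u.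
Proof.
move=> xE; have := valP x; rewrite xE /local_has /=.
by case: (bot t) => [e|] //; rewrite -/(Qk1_vertex e (Some u)) Qk1_vertexE => /and3P[].
Qed.

Lemma identified_sym x y : identified x y -> identified y x.
Proof.
rewrite /identified; case: (val x) => t [u|//]; case: (val y) => t' [v|//].
case/existsP=> i /existsP[j /existsP[m /and4P[bi /eqP g si sj]]].
have mk : k - m < k.+1 by lia.
apply/existsP; exists j; apply/existsP; exists i; apply/existsP; exists (Ordinal mk).
rewrite -g bd_glue bi glueK eqxx /= sj /= subKn //.
by rewrite -ltnS ltn_ord.
Qed.

(** A lattice vertex lies on at most one side, this side has one mate, and the weights fix the point
    there. With symmetry, this bounds the classes of glued vertices by two elements. *)
Lemma identified_fun x y y' : identified x y -> identified x y' -> y = y'.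
Proof.
case xE : (val x) => [t u0]; rewrite /identified xE; case: u0 xE => [u|//] xE.
case yE : (val y) => [t1 v0]; case: v0 yE => [v|//] yE.
case yE' : (val y') => [t2 v0]; case: v0 yE' => [v'|//] yE'.
case/existsP=> i /existsP[j /existsP[m /and4P[bi /eqP g si sj]]].
case/existsP=> i' /existsP[j' /existsP[m' /and4P[bi' /eqP g' si' sj']]].
have [ei em] := at_side_uniq (piece_lattice xE) si si'; subst i'.
move: g'; rewrite g => -[et ej]; subst t2 j'.
by apply: val_inj; rewrite yE yE'; congr (_, Some _); apply: at_side_eq sj _; rewrite em.
Qed.

Definition class_of x : glued_vertex local_has :=
  exist _ [set y in [set: piece] | eqv_closure (@identified T k local_has) x y]
    (imset_f _ (in_setT x)).

Lemma val_class_of x x' : identified x x' \/ (x' = x /\ forall y, ~~ identified x y) ->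
  val (class_of x) = [set x; x'].
Proof.
move=> xx'; rewrite /class_of /=; apply/setP=> y; rewrite in_set in_setT /=.
apply/idP/idP; last first.
  rewrite !inE => /orP[/eqP->|/eqP->]; first exact: connect0.
  by case: xx' => [h|[-> _]]; [apply: connect1; rewrite /= h | apply: connect0].
apply: connect_pair => {y} z y /=.
move=> zy; have {}zy : identified z y by case/orP: zy => // /identified_sym.
rewrite !inE; case/orP => /eqP zE; subst z.
  by case: xx' => [h|[_ /(_ y)]]; [rewrite (identified_fun zy h) eqxx orbT | rewrite zy].
case: xx' => [h|[e /(_ y)]]; last by rewrite -e zy.
by rewrite (identified_fun zy (identified_sym h)) eqxx.
Qed.

Variable prime : bool.
Variables (st : pattern) (ss : seq (side T)) (s0 : side T).
Hypothesis emb : embeds st ss s0.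
Hypothesis botP : forall n, n < size ss -> typed prime st n ->
  bot (nth s0 ss n).1 = omap (fun e => iter e (@ordS 3) (nth s0 ss n).2)
                             (pattern_bottom prime st n).
Implicit Types u v : code.

Definition raw_piece v : triangle T * local_vertex k :=
  ((nth s0 ss v.1).1, Some (corner_point k (nth s0 ss v.1).2 v.2.1 v.2.2)).

Lemma pattern_bottom3 n e : pattern_bottom prime st n = Some e -> e < 3.
Proof. by rewrite /pattern_bottom; do ?case: ifP => // _; case=> <-. Qed.

Lemma size_div3 : size st %/ 3 = size ss.
Proof. by rewrite (emb_size emb) mulKn. Qed.

Lemma code_vertex_inner v : code_vertex prime k st v ->
  v.1 < size ss /\ inner_coords k v.2.1 v.2.2.
Proof.
by case: v => n [x y] /and5P[h0 h1 h2 h3 /andP[h4 _]]; rewrite -size_div3 /inner_coords h1 h2 h3.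
Qed.

Lemma code_local_has v : code_vertex prime k st v -> typed prime st v.1 ->
  local_has (raw_piece v).1 (raw_piece v).2.
Proof.
move=> vP; have [ns xyP] := code_vertex_inner vP; case: v vP ns xyP => n [x y] /= vP ns xyP ty.
rewrite /local_has botP //; move: vP => /and5P[_ _ _ _ /andP[_ ]].
case E: (pattern_bottom _ _ _) => [e|] /= h; last exact: corner_point_vertex.
by rewrite -/(Qk1_vertex _ (Some _)) Qk1_code_vertexP // (pattern_bottom3 E).
Qed.

Lemma raw_piece_inj u v : code_vertex prime k st u -> code_vertex prime k st v ->
  raw_piece u = raw_piece v -> u = v.
Proof.
move=> /code_vertex_inner[nu] + /code_vertex_inner[nv].
case: u v nu nv => n [x y] [n' [x' y']] /= nu nv /and4P[_ _ _ xy] /and4P[_ _ _ xy'] e.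
have /Some_inj := congr1 snd e; have /eqP := congr1 fst e.
rewrite /= -!(nth_map s0 s0.1 (fun s : side T => s.1)) //.
rewrite nth_uniq ?size_map ?(emb_uniq emb) // => /eqP <- e'.
by have [-> ->] := corner_point_inj xy xy' e'.
Qed.

Lemma raw_piece_arrow u v :
  code_vertex prime k st u -> code_vertex prime k st v -> typed prime st u.1 ->
  typed prime st v.1 ->
  ((raw_piece u).1 == (raw_piece v).1) &&
    local_arrow (raw_piece u).1 (raw_piece u).2 (raw_piece v).2 = code_arrow prime k st u v.
Proof.
move=> uP vP ut vt; have [nu xyu] := code_vertex_inner uP; have [nv xyv] := code_vertex_inner vP.
have := code_local_has uP ut; have := code_local_has vP vt.
rewrite /raw_piece /code_arrow /= -!(nth_map s0 s0.1 (fun s : side T => s.1)) //.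
rewrite nth_uniq ?size_map ?(emb_uniq emb) //; case: eqP => //= e; rewrite !(nth_map s0) //.
move: nv xyv vt {vP}; rewrite -e => nv xyv vt; rewrite /local_has /local_arrow botP //.
case E: (pattern_bottom _ _ _) => [b|] /= hv hu; last by rewrite Qk_code_arrowP.
by apply: Qk1_code_arrowP => //; exact: pattern_bottom3 E.
Qed.

Lemma pside_pair n i : i < 3 ->
  pside ss s0 (3 * n + i) = ((nth s0 ss n).1, iter i (@ordS 3) (nth s0 ss n).2).
Proof.
move=> i3; have e1 : (3 * n + i) %% 3 = i by lia.
have e2 : (3 * n + i) %/ 3 = n by lia.
rewrite /pside e1 e2; case: (nth s0 ss n) => t c /=.
by elim: i {i3 e1 e2} => //= i ->.
Qed.

Lemma pside_divmod r :
  pside ss s0 r = ((nth s0 ss (r %/ 3)).1, iter (r %% 3) (@ordS 3) (nth s0 ss (r %/ 3)).2).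
Proof. by rewrite -pside_pair ?ltn_mod //; congr pside; lia. Qed.

Variable x0 : piece.

(** The default [x0] is not reached on vertices of typed triangles, by [val_piece_of]. *)
Definition piece_of v : piece := insubd x0 (raw_piece v).

Lemma val_piece_of v : code_vertex prime k st v -> typed prime st v.1 ->
  val (piece_of v) = raw_piece v.
Proof. by move=> vP ty; rewrite insubdK // unfold_in code_local_has. Qed.

Lemma mutable_side v : good_code prime k st v ->
  match on_side k v.2.1 v.2.2 with
  | None => True
  | Some (i, m) => exists r, [/\ i < 3, m <= k, 3 * v.1 + i < size st, nth 0 st (3 * v.1 + i) = r.+3 &
      partner k st v = (r %/ 3, side_point k (r %% 3) (k - m))]
  end.
Proof.
case/andP=> /and4P[vP vm vt _] /and3P[pP pm pt]; have [nv xyv] := code_vertex_inner vP.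
move: vm; rewrite /code_mutable /partner; case E: (on_side _ _ _) => [[i m]|] //.
have [i3 mk _] := on_side_at ord0 xyv E.
case F: (nth _ _ _) => [|[|[|r]]] // _; exists r; split=> //.
by rewrite (emb_size emb); lia.
Qed.

Lemma val_class_code v : good_code prime k st v ->
  val (class_of (piece_of v)) = [set piece_of v; piece_of (partner k st v)].
Proof.
move=> gv; have := mutable_side gv; case/andP: (gv) => /and4P[vP vm vt /eqP pK] /and3P[pP pm pt].
have [nv xyv] := code_vertex_inner vP.
case E: (on_side _ _ _) => [[i m]|] => [[r [i3 mk qs F pE]]|_]; apply: val_class_of; [left|right].
  have [_ _ sv] := on_side_at (nth s0 ss v.1).2 xyv E.
  rewrite /identified !val_piece_of // pE /raw_piece /=.
  have m1 : m < k.+1 by [].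
  have [_ _ _ g] := emb_glue emb qs F.
  have b : ~~ bd_interval (pside ss s0 (3 * v.1 + i)) by apply: (emb_arcN emb qs); rewrite F.
  rewrite pside_pair // in g b; rewrite pside_divmod in g.
  apply/existsP; exists (iter i (@ordS 3) (nth s0 ss v.1).2).
  apply/existsP; exists (iter (r %% 3) (@ordS 3) (nth s0 ss (r %/ 3)).2).
  apply/existsP; exists (Ordinal m1); apply/and4P; split=> //; first by rewrite g.
  by apply: side_point_at; rewrite ?ltn_mod ?leq_subr.
split; first by rewrite /partner E.
move=> y; rewrite /identified val_piece_of // /raw_piece.
case: (val y) => t' [w|//]; apply/existsP=> -[i /existsP[j /existsP[m /and4P[_ _ si _]]]].
by move: si; rewrite (negPf (off_side_at _ _ _ xyv E)).
Qed.


Lemma piece_of_mutable v : good_code prime k st v -> ~~ frozen_piece (piece_of v).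
Proof.
move=> gv; have := mutable_side gv; case/andP: (gv) => /and4P[vP vm vt /eqP pK] /and3P[pP pm pt].
have [nv xyv] := code_vertex_inner vP; rewrite /frozen_piece val_piece_of // /raw_piece.
move=> h; apply/existsP=> -[i' /existsP[m' /andP[bi si]]]; move: h.
case E: (on_side _ _ _) => [[i m]|]; last first.
  by move: si; rewrite (negPf (off_side_at _ _ _ xyv E)).
case=> r [i3 mk qs F pE].
have [_ _ sv] := on_side_at (nth s0 ss v.1).2 xyv E.
have [ei em] := at_side_uniq (corner_point_vertex _ xyv) si sv.
have : ~~ bd_interval (pside ss s0 (3 * v.1 + i)) by apply: (emb_arcN emb qs); rewrite F.
by rewrite pside_pair // -ei bi.
Qed.

Lemma good_partner v : good_code prime k st v -> good_code prime k st (partner k st v).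
Proof.
by case/andP=> /and4P[vP vm vt /eqP pK] /and3P[pP pm pt]; rewrite /good_code pK vP vm vt pP pm pt eqxx.
Qed.

Lemma class_mutable v : good_code prime k st v ->
  class_of (piece_of v) \notin frozen Q.
Proof.
move=> gv; rewrite inE; apply/existsP=> -[x]; rewrite val_class_code // !inE.
case/andP=> /orP[]/eqP->; first by rewrite (negPf (piece_of_mutable gv)).
by rewrite (negPf (piece_of_mutable (good_partner gv))).
Qed.

Lemma piece_of_inj u v : good_code prime k st u -> good_code prime k st v ->
  piece_of u = piece_of v -> u = v.
Proof.
case/andP=> /and4P[uP _ ut _] _ /andP[/and4P[vP _ vt _] _] /(congr1 val).
by rewrite !val_piece_of //; apply: raw_piece_inj.
Qed.

Lemma class_of_inj u v : good_code prime k st u -> good_code prime k st v ->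
  class_of (piece_of u) = class_of (piece_of v) -> u = v \/ u = partner k st v.
Proof.
move=> gu gv e; have : piece_of u \in val (class_of (piece_of u)).
  by rewrite val_class_code // !inE eqxx.
rewrite e val_class_code // !inE => /orP[]/eqP h; [left|right].
  exact: piece_of_inj h.
by apply: piece_of_inj h; last exact: good_partner.
Qed.

Lemma piece_arrow_code u v : good_code prime k st u -> good_code prime k st v ->
  piece_arrow local_arrow (piece_of u) (piece_of v) = code_arrow prime k st u v.
Proof.
case/andP=> /and4P[uP _ ut _] _ /andP[/and4P[vP _ vt _] _].
by rewrite /piece_arrow !val_piece_of // raw_piece_arrow.
Qed.

Lemma adj_class u v : good_code prime k st u -> good_code prime k st v ->
  @adj Q (class_of (piece_of u)) (class_of (piece_of v)) = code_adj prime k st u v.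
Proof.
move=> gu gv; rewrite /adj /= /glued_adj !val_class_code // !big_set2.
have gu' := good_partner gu; have gv' := good_partner gv.
rewrite !piece_arrow_code //.
have eqP_of w : good_code prime k st w ->
    (piece_of (partner k st w) == piece_of w) = (partner k st w == w).
  by move=> gw; apply/eqP/eqP => [/piece_of_inj|->] //; apply=> //; apply: good_partner.
rewrite !eqP_of // /code_adj /code_class.
by case: eqP => _; case: eqP => _; rewrite /= ?addr0 ?addrA.
Qed.

End Amalgam.

Lemma antisym_amalgam T k bot : antisym (@adj (amalgam (@local_has T k bot) (@local_arrow T k bot))).
Proof.
move=> C D; rewrite /adj /= /glued_adj exchange_big /= -sumrN; apply: eq_bigr => y _.
by rewrite -sumrN; apply: eq_bigr => x _; lia.
Qed.

(** * Mutation-infinite partial gluings *)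

Inductive leaf :=
  | Inf of seq code & seq nat & nat * nat * nat
  | Star of nat.

(* The star of a puncture of valency n, whose outer sides are on the boundary. *)
Definition star_pattern (n : nat) : pattern :=
  flatten [seq [:: (3 * (i.+1 %% n) + 2).+3; 1; (3 * ((i + n.-1) %% n)).+3] | i <- iota 0 n].

(* When all gluings preserve the distance to the start of side 0, points at
   distance at most 6 from it span the same quiver for all k >= 7. *)
Definition cornered (st : pattern) : bool :=
  all (fun q => match q %% 3, nth 0 st q with
                | 1, _ => true
                | _, 1 => false
                | 0, r.+3 => r %% 3 == 2
                | _, r.+3 => r %% 3 == 0
                | _, _ => true end) (iota 0 (size st)).

Definition near (v : code) : bool := v.2.1 + v.2.2 <= 6.

Definition closing (prime : bool) (K : nat) (stars : seq nat) (st : pattern) (l : leaf) : bool :=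
  match l with
  | Inf vs ms g =>
      [&& good_codes prime K st vs, infinite_cert (size vs) (code_mx prime K st vs) ms g &
          (K < 7) || cornered st && all near vs]
  | Star n => (n \in stars) && (st == star_pattern n)
  end.


Section Stability.
Variables (prime : bool) (k : nat) (st : pattern).
Hypotheses (k7 : 7 <= k) (stC : cornered st).
Implicit Types u v : code.

Lemma cornered_side n r : nth 0 st (3 * n) = r.+3 -> r %% 3 = 2.
Proof.
case: (ltnP (3 * n) (size st)) => [ns|ns]; last by rewrite nth_default.
have /(allP stC) : 3 * n \in iota 0 (size st) by rewrite mem_iota.
by rewrite (_ : 3 * n %% 3 = 0); [move=> h e; move: h; rewrite e => /eqP | lia].
Qed.

Lemma cornered_side2 n r : nth 0 st (3 * n + 2) = r.+3 -> r %% 3 = 0.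
Proof.
case: (ltnP (3 * n + 2) (size st)) => [ns|ns]; last by rewrite nth_default.
have /(allP stC) : 3 * n + 2 \in iota 0 (size st) by rewrite mem_iota.
by rewrite (_ : (3 * n + 2) %% 3 = 2); [move=> h e; move: h; rewrite e => /eqP | lia].
Qed.

Lemma cornered_bottom n e : pattern_bottom prime st n = Some e -> e = 1.
Proof.
have st0 q : q %% 3 != 1 -> nth 0 st q != 1.
  case: (ltnP q (size st)) => [qs|qs]; last by rewrite nth_default.
  have /(allP stC) : q \in iota 0 (size st) by rewrite mem_iota.
  have : q %% 3 < 3 by rewrite ltn_mod.
  by case: (q %% 3) => [|[|[|]]] //= _; case: (nth 0 st q) => [|[|]].
rewrite /pattern_bottom; case: prime => //.
rewrite (negPf (st0 (3 * n) _)); last by lia.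
rewrite (negPf (st0 (3 * n + 2) _)); last by lia.
by case: ifP => // _ [].
Qed.

(** A cornered gluing pairs sides 0 with sides 2, and k - (k - x) = x, so the partner is at the same
    distance from its corner 0. Side 1 is out of reach, as x + y <= 6 < k. *)
Lemma partner_near v : near v ->
  near (partner 7 st v) /\ partner k st v = partner 7 st v.
Proof.
case: v => n [x y]; rewrite /near /partner /on_side [(_, _).1]/= [(_, _).2]/= => xy'.
have {xy'} xy : x + y <= 6 := xy'.
case: eqP => [y0|_].
  case E: (nth _ _ _) => [|[|[|r]]]; try by split; [rewrite /= | ].
  move: E; rewrite addn0 => /cornered_side ->.
  rewrite /side_point /=; have -> : k - (k - x) = x by lia.
  have -> : 7 - (7 - x) = x by lia.
  by split=> //; lia.
case: eqP => [x0|_].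
  case E: (nth _ _ _) => [|[|[|r]]]; try by split; [rewrite /= | ].
  rewrite (cornered_side2 E) /side_point /=; have -> : k - (k - y) = y by lia.
  have -> : 7 - (7 - y) = y by lia.
  by split=> //; lia.
have -> : (x + y == k) = false by lia.
by have -> : (x + y == 7) = false by lia.
Qed.

Lemma code_vertex_near v : near v -> code_vertex prime k st v = code_vertex prime 7 st v.
Proof.
case: v => n [x y]; rewrite /near /= => xy.
case E: (pattern_bottom _ _ _) => [e|]; last by lia.
by rewrite (cornered_bottom E) /=; lia.
Qed.

Lemma code_mutable_near v : near v -> code_mutable k st v = code_mutable 7 st v.
Proof.
case: v => n [x y]; rewrite /near /code_mutable /on_side /= => xy.
case: eqP => // _; case: eqP => // _.
have -> : (x + y == k) = false by lia.
by have -> : (x + y == 7) = false by lia.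
Qed.

Lemma code_arrow_near u v : near u -> near v ->
  code_arrow prime k st u v = code_arrow prime 7 st u v.
Proof.
case: u v => n [x y] [n' [x' y']]; rewrite /near /code_arrow /= => xy xy'.
case: eqP => //= _; case E: (pattern_bottom _ _ _) => [e|]; last by rewrite /Qk_code_arrow; lia.
rewrite (cornered_bottom E) /Qk1_code_arrow /=.
have -> : (k - x - y == k - x' - y') = (7 - x - y == 7 - x' - y') by lia.
have -> : (k - x - y == (k - x' - y').+1) = (7 - x - y == (7 - x' - y').+1) by lia.
by have -> : (k - x' - y' == (k - x - y).+1) = (7 - x' - y' == (7 - x - y).+1) by lia.
Qed.

Lemma good_codes_near vs : all near vs -> good_codes prime k st vs = good_codes prime 7 st vs.
Proof.
move=> nvs; rewrite /good_codes; congr andb.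
  apply: eq_in_all => v /(allP nvs) nv; have [np pE] := partner_near nv.
  have [npp ppE] := partner_near np.
  by rewrite /good_code pE ppE !code_vertex_near // !code_mutable_near.
elim: vs nvs => //= u vs IH /andP[nu nvs]; rewrite IH //; congr andb.
by apply: eq_in_all => v /(allP nvs) nv; rewrite (partner_near nv).2.
Qed.

Lemma code_adj_near u v : near u -> near v -> code_adj prime k st u v = code_adj prime 7 st u v.
Proof.
move=> nu nv; have [npu puE] := partner_near nu; have [npv pvE] := partner_near nv.
rewrite /code_adj /code_class puE pvE.
by case: ifP => _; case: ifP => _ /=; rewrite !code_arrow_near.
Qed.

Lemma code_mx_near vs : all near vs -> code_mx prime k st vs = code_mx prime 7 st vs.
Proof.
move=> nvs; rewrite /code_mx /mx_build /mkseq.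
apply/eq_in_map => i; rewrite mem_iota => ivs; apply/eq_in_map => j; rewrite mem_iota => jvs.
by apply: code_adj_near; apply: (allP nvs); apply: mem_nth.
Qed.

End Stability.

Section InfiniteLeaf.
Variables (T : triangulation) (k : nat) (bot : triangle T -> option 'I_3) (prime : bool).
Hypothesis botP : forall st ss s0 n, embeds st ss s0 -> n < size ss -> typed prime st n ->
  bot (nth s0 ss n).1 = omap (fun e => iter e (@ordS 3) (nth s0 ss n).2)
                             (pattern_bottom prime st n).

Notation Q := (amalgam (@local_has T k bot) (@local_arrow T k bot)).

Lemma good_codes_vertices st ss s0 vs : embeds st ss s0 -> good_codes prime k st vs ->
  0 < size vs -> exists phi : nat -> vert Q,
  [/\ forall i, i < size vs -> phi i \notin frozen Q,
      forall i j, i < size vs -> j < size vs -> phi i = phi j -> i = j,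
      represents (size vs) phi (@adj Q) (code_mx prime k st vs) &
      exists x0 : piece_vertex (@local_has T k bot), forall i, i < size vs ->
        phi i = class_of (piece_of ss s0 x0 (nth (0, (0, 0)) vs i))].
Proof.
move=> emb /andP[/allP gvs vsP] vs0; have bP := fun n => @botP st ss s0 n emb.
have gc i : i < size vs -> good_code prime k st (nth (0, (0, 0)) vs i).
  by move=> ivs; apply: gvs; apply: mem_nth.
have /andP[/and4P[v0P _ v0t _] _] := gc 0 vs0.
pose x0 : piece_vertex (@local_has T k bot) :=
  exist _ (raw_piece k ss s0 (nth (0, (0, 0)) vs 0)) (code_local_has emb bP v0P v0t).
exists (fun i => class_of (piece_of ss s0 x0 (nth (0, (0, 0)) vs i))); split.
- by move=> i ivs; apply: (class_mutable emb bP) => //; apply: gc.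
- suff lt i j : i < size vs -> j < size vs -> i < j ->
      class_of (piece_of ss s0 x0 (nth (0, (0, 0)) vs i)) <>
      class_of (piece_of ss s0 x0 (nth (0, (0, 0)) vs j)).
    move=> i j ivs jvs e; case: (ltngtP i j) => // ij.
      by case: (lt i j ivs jvs ij e).
    by case: (lt j i jvs ivs ij (esym e)).
  move=> ivs jvs ij /(class_of_inj emb bP (gc i ivs) (gc j jvs)) h.
  have /(pairwiseP (0, (0, 0)))/(_ i j) := vsP; rewrite !inE => /(_ ivs jvs ij)/andP[/eqP n1 /eqP n2].
  by case: h.
- move=> i j ivs jvs; rewrite mx_buildE //.
  by apply: (adj_class emb bP); apply: gc.
by exists x0.
Qed.

Lemma infinite_leaf st (ss : seq (side T)) (s0 : side T) vs ms g :
  embeds st ss s0 -> good_codes prime k st vs ->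
  infinite_cert (size vs) (code_mx prime k st vs) ms g -> ~ finite_mutation_type Q.
Proof.
move=> emb gvs cert; have vs0 : 0 < size vs.
  by case: g cert => [[x y] z] /and5P[_ h _ _ _]; apply: leq_ltn_trans h.
have [phi [phiF phiI phiM _]] := good_codes_vertices emb gvs vs0.
have QA := @antisym_amalgam T k bot.
exact: (infinite_certP phiF phiI QA phiM cert).
Qed.

End InfiniteLeaf.

(** * Marked points and punctures of a triangulation *)

Section Points.
Variable T : triangulation.
Implicit Types s : side T.

Lemma eqv_closure_equiv (X : finType) (e : rel X) : equivalence_rel (eqv_closure e).
Proof.
apply/equivalence_relP; split; first by move=> x; apply: connect0.
move=> x y xy z; rewrite /eqv_closure; apply: same_connect => //.
by apply: sym_connect_sym => a b /=; rewrite orbC.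
Qed.

Lemma same_point_turn s : ~~ bd_interval s -> same_point s (turn s).
Proof. by move=> b; apply: connect1; rewrite /= b eqxx. Qed.

Lemma same_point_refl s : same_point s s.
Proof. exact: connect0. Qed.

Definition point_of s : {set side T} := [set s' in [set: side T] | same_point s s'].

Lemma mem_point_of s s' : (s' \in point_of s) = same_point s s'.
Proof. by rewrite !inE. Qed.

Lemma point_of_marked s : point_of s \in marked_points T.
Proof. exact/imset_f/in_setT. Qed.

Lemma marked_pointP P : reflect (exists s, P = point_of s) (P \in marked_points T).
Proof.
by apply: (iffP imsetP) => [[s _ ->]|[s ->]]; exists s.
Qed.

Lemma same_pointE s s' : same_point s s' -> point_of s = point_of s'.
Proof.
move=> ss'; apply/setP=> z; rewrite !mem_point_of.
have /equivalence_relP[_ h] := @eqv_closure_equiv (side T)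
  [rel c d : side T | ~~ bd_interval c && (d == next_side (glue c))].
by rewrite /same_point (h _ _ ss').
Qed.

Lemma puncture_around s : is_puncture (point_of s) -> around_puncture s.
Proof.
move=> /forallP pP j; have : iter j (@turn T) s \in point_of s /\ ~~ bd_interval (iter j (@turn T) s).
  elim: j => [|j [IH nb]] /=.
    have sP : s \in point_of s by rewrite mem_point_of; exact: same_point_refl.
    by split=> //; apply/negP=> b; have := pP s; rewrite b sP.
  have inP : turn (iter j (@turn T) s) \in point_of s.
    rewrite mem_point_of; rewrite mem_point_of in IH.
    exact: connect_trans IH (same_point_turn nb).
  by split=> //; apply/negP=> b; have := pP (turn (iter j (@turn T) s)); rewrite b inP.
by case.
Qed.

Lemma exists_puncture S : triangulates T S -> 0 < punctures S ->
  exists s, around_puncture s.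
Proof.
case=> <- _ _ /card_gt0P[P]; rewrite inE => /andP[/marked_pointP[s ->] pP].
by exists s; apply: puncture_around.
Qed.

End Points.

Section Exploration.
Variables (T : triangulation) (k : nat) (bot : triangle T -> option 'I_3) (prime : bool).
Hypothesis botP : forall st ss s0 n, embeds st ss s0 -> n < size ss -> typed prime st n ->
  bot (nth s0 ss n).1 = omap (fun e => iter e (@ordS 3) (nth s0 ss n).2)
                             (pattern_bottom prime st n).
Hypothesis regT : regular T.
Hypothesis tautT : prime -> forall (t : triangle T) (i j : 'I_3),
  bd_interval (t, i) -> bd_interval (t, j) -> i = j.

Definition star_of n := exists (ss : seq (side T)) (s0 : side T), embeds (star_pattern n) ss s0.

Lemma infinite_or_star S K stars cert :
  triangulates T S -> 0 < punctures S -> (K = k \/ (K == 7) && (7 <= k)) ->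
  explores prime (closing prime K stars) (root_patterns prime) cert ->
  ~ finite_mutation_type (amalgam (@local_has T k bot) (@local_arrow T k bot)) \/
  exists2 n, n \in stars & star_of n.
Proof.
move=> TS pS Kk ex; have [s0 pt] := exists_puncture TS pS.
have [st stR emb] := root_embeds prime pt.
apply: (exploresP regT tautT pt _ ex); last by exists st => //; exists [:: s0].
move=> {stR emb}st [vs ms g|n] ss /=; last first.
  by case/andP=> nst /eqP-> emb; right; exists n => //; exists ss, s0.
case/and3P=> gvs cert' nr emb; left.
have [{}Kk | /andP[/eqP K7 k7]] := Kk.
  rewrite Kk in gvs cert'; exact (infinite_leaf botP emb gvs cert').
move: gvs cert' nr; rewrite K7 /= => gvs cert' /andP[cst nvs].
rewrite -(good_codes_near _ k7) // in gvs; rewrite -(code_mx_near _ k7) // in cert'.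
exact (infinite_leaf botP emb gvs cert').
Qed.

End Exploration.

Section Bottoms.
Variable T : triangulation.

Lemma bottomP st (ss : seq (side T)) (s0 : side T) n :
  taut T -> embeds st ss s0 -> n < size ss -> typed true st n ->
  bottom (nth s0 ss n).1 = omap (fun e => iter e (@ordS 3) (nth s0 ss n).2)
                             (pattern_bottom true st n).
Proof.
move=> [_ ttT] emb ns /= ty.
have q3 i : i < 3 -> 3 * n + i < size st by rewrite (emb_size emb); lia.
have side i : i < 3 -> nth 0 st (3 * n + i) != 0 ->
    bd_interval ((nth s0 ss n).1, iter i (@ordS 3) (nth s0 ss n).2) = (nth 0 st (3 * n + i) == 1).
  move=> i3 n0; rewrite -pside_pair //; case: eqP => [h|/eqP h]; first exact: (emb_bd emb (q3 i i3) h).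
  apply: negbTE; apply: (emb_arcN emb (q3 i i3)); by case: (nth _ _ _) n0 h => [|[|]].
have uniq_bot i : bd_interval ((nth s0 ss n).1, i) -> bottom (nth s0 ss n).1 = Some i.
  by move=> bi; rewrite /bottom; case: pickP => [j bj|/(_ i)]; rewrite ?bi // (ttT _ _ _ bi bj).
case/and4P: ty => t0 t1 t2 _; rewrite /pattern_bottom.
case: eqP => [h|n0]; first by apply: uniq_bot; rewrite (side 0) // addn0 h.
case: eqP => [h|n1]; first by apply: uniq_bot; rewrite (side 1) // h.
case: eqP => [h|n2]; first by apply: uniq_bot; rewrite (side 2) // h.
rewrite /bottom; case: pickP => //= i; case: (ord3P (nth s0 ss n).2 i) => ->.
- by have -> := side 0 isT t0; rewrite addn0 => /eqP.
- by have -> := side 1 isT t1 => /eqP.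
by have -> := side 2 isT t2 => /eqP.
Qed.

End Bottoms.

(** * Counting triangles *)

Lemma ltn_side m n i : i < 3 -> m < n -> 3 * m + i < 3 * n. Proof. lia. Qed.

Definition complete (st : pattern) : bool := all (fun r => (r == 1) || (2 < r)) st.

(** With no unknown side left, gluing never leaves the triangles of the pattern, and T is
    connected. *)
Lemma complete_triangles T st (ss : seq (side T)) (s0 : side T) :
  complete st -> embeds st ss s0 -> 0 < size ss ->
  forall t, t \in [seq s.1 | s <- ss].
Proof.
move=> /all_nthP cst emb ss0 t.
have t0 : (nth s0 ss 0).1 \in [seq s.1 | s <- ss] by apply/map_f/mem_nth.
have /connectP[p + ->] := triangle_connected (nth s0 ss 0).1 t.
elim: p ((nth s0 ss 0).1) t0 => //= v p IH u uin /andP[/existsP[i /existsP[j /eqP g]] vp].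
apply: IH vp; have [q qs e] := pside_surj s0 (uin : ((u, i) : side T).1 \in _).
rewrite -(emb_size emb) in qs; have := cst 0 q qs.
case E: (nth 0 st q) => [|[|[|r]]] //= _.
  by have := emb_bd emb qs E; rewrite -e /bd_interval g => /eqP[->].
have [rs _ _ ge] := emb_glue emb qs E; rewrite -e g in ge.
rewrite (_ : v = (pside ss s0 r).1) -?ge // ge /pside iter_next_triangle.
by apply/map_f/mem_nth; rewrite ltn_divLR // mulnC -(emb_size emb).
Qed.

Lemma complete_card T st (ss : seq (side T)) (s0 : side T) :
  complete st -> embeds st ss s0 -> 0 < size ss -> #|triangle T| = size ss.
Proof.
move=> cst emb ss0; rewrite -(size_map (fun s : side T => s.1)) -(card_uniqP (emb_uniq emb)).
by apply: eq_card => t; rewrite (complete_triangles cst emb ss0).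
Qed.

Section Counting.
Variable T : triangulation.
Implicit Types s : side T.

Definition bd_sides : {set side T} := [set s | bd_interval s].

Lemma card_edges : 2 * #|edges T| = 3 * #|triangle T| + #|bd_sides|.
Proof.
(* With weight 2 on boundary intervals and 1 on the other sides, every edge has total weight 2. *)
pose w s := (bd_interval s).+1.
have e1 : #|bd_sides| = \sum_(s : side T) bd_interval s.
  by rewrite -sum1_card big_mkcond; apply: eq_bigr => s _; rewrite inE; case: ifP.
have e2 : 3 * #|triangle T| = \sum_(s : side T) 1.
  by rewrite sum1_card card_prod card_ord mulnC.
have -> : 3 * #|triangle T| + #|bd_sides| = \sum_(s : side T) w s.
  by rewrite e1 e2 -big_split.
rewrite (partition_big (fun s => [set s; glue s]) (fun E => E \in edges T)) /=; last first.
  by move=> s _; apply/imsetP; exists s.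
rewrite mulnC -sum_nat_const; apply: eq_bigr => _ /imsetP[s _ ->].
have eqE s' : ([set s'; glue s'] == [set s; glue s]) = (s' \in [set s; glue s]).
  apply/eqP/idP => [<-|]; first by rewrite !inE eqxx.
  by rewrite !inE => /orP[]/eqP-> //; rewrite glueK setUC.
rewrite (eq_bigl _ _ eqE) /w; case b: (bd_interval s).
  by move/eqP: (b) => ->; rewrite setUid big_set1 b.
rewrite big_setU1 ?big_set1 ?bd_glue ?b // inE eq_sym.
by move: b; rewrite /bd_interval => ->.
Qed.

Lemma card_bd_sides S : triangulates T S -> #|bd_sides| = sumn (boundary S).
Proof.
case=> _ /perm_sumn <- _; rewrite sumnE big_map big_enum /=.
apply: card_partition; apply: equivalence_partitionP => x y z _ _ _.
exact: eqv_closure_equiv.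
Qed.

(** A marked point that is not a puncture is the start or the end of a boundary interval. In the
    second case, turning around it leads to a boundary interval that starts there. *)
Lemma not_puncture s : ~~ is_puncture (point_of s) ->
  exists2 s', bd_interval s' & point_of s = point_of s'.
Proof.
rewrite negb_forall => /existsP[s']; rewrite negb_imply negb_and !negbK !mem_point_of.
case/andP=> b /orP[h|h]; first by exists s' => //; apply: same_pointE.
have tE : turn s' = next_side s' by rewrite /turn; move/eqP: (b) => ->.
(* The permutation [turn] sends s' to [next_side s'], so the orbit comes back to s', a boundary
   interval. Up to the first one met, only arcs are crossed, and the point does not change. *)
have ex : exists j, bd_interval (iter j (@turn T) (next_side s')).
  exists (order (@turn T) s').-1; rewrite -tE -iterSr prednK ?order_gt0 //.
  by rewrite (iter_order (@turn_inj T)).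
have [j bj min] := ex_minnP ex.
exists (iter j (@turn T) (next_side s')) => //; apply: same_pointE; apply: connect_trans h _.
elim: j {bj} min => [|j IH] min; first exact: connect0.
apply: connect_trans (IH _) (same_point_turn _); first by move=> i /min; apply: ltnW.
by apply/negP => /min; rewrite ltnn.
Qed.

(** By [not_puncture], the points other than punctures are among the starts of boundary
    intervals. *)
Lemma card_marked_points S : triangulates T S ->
  #|marked_points T| <= punctures S + #|bd_sides|.
Proof.
case=> <- _ _; rewrite -(cardsID [set P | is_puncture P] (marked_points T)) leq_add //.
  by apply/subset_leq_card/subsetP => P; rewrite !inE.
apply: leq_trans (leq_imset_card (@point_of T) bd_sides).
apply/subset_leq_card/subsetP => P; rewrite !inE => /andP[np /marked_pointP[s E]].
rewrite E in np *; have [s' b ->] := not_puncture np.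
by apply/imsetP; exists s'; rewrite ?inE.
Qed.

(* The pattern does not embed in a triangulation with F triangles and B boundary
   intervals. *)
Definition misfit (F B : nat) (st : pattern) : bool :=
  [|| 3 * F < size st, 3 * F - B < count (ltn 1) st, B < count (pred1 1) st |
      [&& complete st, 0 < size st & size st != 3 * F]].

(** The injectivity of [pside] turns the count of entries into a count of sides. *)
Lemma emb_count (st : pattern) (ss : seq (side T)) (s0 : side T) (p : pred nat) (A : {set side T}) :
  embeds st ss s0 ->
  (forall q, q < size st -> p (nth 0 st q) -> pside ss s0 q \in A) -> count p st <= #|A|.
Proof.
move=> emb pA; pose qs := [seq q <- iota 0 (size st) | p (nth 0 st q)].
have qsz q : q \in qs -> q < size st by rewrite mem_filter mem_iota => /andP[].
have -> : count p st = size [seq pside ss s0 q | q <- qs].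
  rewrite size_map size_filter -{1}(mkseq_nth 0 st) /mkseq count_map.
  exact: eq_count.
rewrite -(card_uniqP _); last first.
  rewrite map_inj_in_uniq ?filter_uniq ?iota_uniq // => q r /qsz qs' /qsz rs.
  by apply: pside_inj; rewrite -?(emb_size emb) ?(emb_uniq emb).
apply/subset_leq_card/subsetP => _ /mapP[q qin ->]; apply: pA (qsz q qin) _.
by move: qin; rewrite mem_filter => /andP[].
Qed.

Lemma misfitP (st : pattern) (ss : seq (side T)) (s0 : side T) : embeds st ss s0 ->
  ~~ misfit #|triangle T| #|bd_sides| st.
Proof.
move=> emb; rewrite !negb_or -!leqNgt; apply/and4P; split.
- have -> : size st = count predT st by rewrite count_predT.
  have /(emb_count emb) h : forall q, q < size st -> predT (nth 0 st q) ->
      pside ss s0 q \in [set: side T] by move=> q _ _; rewrite in_setT.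
  by apply: leq_trans h _; rewrite cardsT card_prod card_ord mulnC.
- have cs : #|~: bd_sides| = 3 * #|triangle T| - #|bd_sides|.
    by rewrite cardsCs setCK card_prod card_ord mulnC.
  rewrite -cs; apply: (emb_count emb) => q qs h; rewrite !inE.
  exact: emb_arcN emb qs h.
- apply: (emb_count emb) => q qs /eqP h; rewrite inE.
  exact: (emb_bd emb qs h).
apply/and3P=> -[cst st0 /eqP]; have sE := emb_size emb.
have ss0 : 0 < size ss by move: st0; rewrite sE muln_gt0.
by rewrite sE (complete_card cst emb ss0).
Qed.

Definition star_closing (F B n : nat) (st : pattern) (l : bool) : bool :=
  if l then st == star_pattern n else misfit F B st.

Lemma counted_star S (prime : bool) F n cert :
  triangulates T S -> 0 < punctures S -> regular T -> 
  (prime -> forall (t : triangle T) (i j : 'I_3),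
     bd_interval (t, i) -> bd_interval (t, j) -> i = j) ->
  #|triangle T| = F -> #|bd_sides| = n ->
  explores prime (star_closing F n n) (root_patterns prime) cert -> star_of T n.
Proof.
move=> TS pS regT tautT FE BE ex; have [s0 pt] := exists_puncture TS pS.
have [st stR emb] := root_embeds prime pt.
apply: (exploresP regT tautT pt _ ex); last by exists st => //; exists [:: s0].
move=> {stR emb}st [] ss /= + emb; first by move=> /eqP e; exists ss, s0; rewrite -e.
by rewrite -FE -BE (negPf (misfitP emb)).
Qed.

(** Eliminating E from V + F + 1 = E + 2 and 2 E = 3 F + n gives the equation. With V <= n + 1, it
    forces F <= n and F of the same parity as n. *)
Lemma card_triangles S n : triangulates T S -> S = once_punctured_polygon n ->
  #|bd_sides| = n /\ exists2 V, V <= n.+1 & #|triangle T| + n + 2 = V.*2.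
Proof.
move=> TS SE; have nB := card_bd_sides TS; have Vn := card_marked_points TS.
case: TS => _ _ euler; rewrite SE /= ?addn0 in nB Vn euler.
split=> //; exists #|marked_points T|; first by rewrite nB in Vn.
have arith V F E : V + F + 1 = E + 2 -> 2 * E = 3 * F + n -> F + n + 2 = V.*2 by lia.
by apply: arith euler _; rewrite card_edges nB.
Qed.

End Counting.

(** * Stars of punctures *)

(** Completeness excludes triangles outside the pattern; the search over x and y then shows that
    [vs] meets the class of every mutable vertex. *)
Definition covers (prime : bool) (k : nat) (st : pattern) (vs : seq code) : bool :=
  [&& complete st, good_codes prime k st vs, all (typed prime st) (iota 0 (size st %/ 3)) &
  all (fun n => all (fun x => all (fun y => let v := (n, (x, y)) in
    code_vertex prime k st v ==> code_mutable k st v ==>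
    good_code prime k st v && ((v \in vs) || (partner k st v \in vs)))
    (iota 0 k)) (iota 0 k)) (iota 0 (size st %/ 3))].

Section FiniteStar.
Variables (T : triangulation) (k : nat) (bot : triangle T -> option 'I_3) (prime : bool).
Hypothesis botP : forall st ss s0 n, embeds st ss s0 -> n < size ss -> typed prime st n ->
  bot (nth s0 ss n).1 = omap (fun e => iter e (@ordS 3) (nth s0 ss n).2)
                             (pattern_bottom prime st n).
Notation Q := (amalgam (@local_has T k bot) (@local_arrow T k bot)).
Notation piece := (piece_vertex (@local_has T k bot)).

Lemma class_of_surj (C : vert Q) : exists x : piece, C = class_of x.
Proof.
have /imsetP[x _ e] := valP C; exists x; exact: val_inj.
Qed.

(** A mutable piece is not M, so it is a lattice point; its triangle belongs to the complete
    pattern, and its weights read from the corner 0 of that triangle give the code. *)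
Lemma mutable_class_code st ss s0 vs (x : piece) : embeds st ss s0 -> covers prime k st vs ->
  0 < size ss -> class_of x \notin frozen Q ->
  exists2 v, val x = raw_piece k ss s0 v &
    good_code prime k st v && ((v \in vs) || (partner k st v \in vs)).
Proof.
move=> emb /and4P[cst gvs /allP tst /allP cov] ss0 nf.
have sz : size st %/ 3 = size ss := size_div3 emb.
have bP := fun n => @botP st ss s0 n emb.
have fx : ~~ frozen_piece x.
  apply: contra nf => fx; rewrite inE; apply/existsP; exists x; rewrite fx andbT.
  by rewrite !inE; apply: connect0.
case xE: (val x) => [t [u|]]; last by move: fx; rewrite /frozen_piece xE.
have lu := piece_lattice xE; have hx := valP x; rewrite xE /= in hx.
have := complete_triangles cst emb ss0 t; case/(nthP s0.1) => m; rewrite size_map => ms.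
rewrite (nth_map s0) // => tE; set c := (nth s0 ss m).2.
pose v : code := (m, (wt u (ordS c), wt u (ordS (ordS c)))).
have uE := corner_point_wt c lu; rewrite -/c in uE.
have xv : val x = raw_piece k ss s0 v by rewrite xE /raw_piece /= tE -uE.
have min : m \in iota 0 (size st %/ 3) by rewrite mem_iota sz.
have inn : inner_coords k v.2.1 v.2.2.
  by have [] := lattice_vertexP c lu; rewrite /inner_coords /=; lia.
have cv : code_vertex prime k st v.
  rewrite /code_vertex /v sz ms; case/and4P: (inn) => -> -> -> -> /=.
  case E: (pattern_bottom _ _ _) => [e|] //.
  have : Qk1_vertex (iter e (@ordS 3) c) (Some u).
    by move: hx; rewrite /local_has -tE bP ?tst // E.
  by rewrite {1}uE (Qk1_code_vertexP c (pattern_bottom3 E) inn).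
have cm : code_mutable k st v.
  rewrite /code_mutable; case E: (on_side _ _ _) => [[i w]|] //.
  have [i3 wk sv] := on_side_at c inn E.
  have qs : 3 * v.1 + i < size st by rewrite (emb_size emb); apply: ltn_side.
  have /(all_nthP 0)/(_ _ qs)/orP[/eqP h|//] := cst.
  have := emb_bd emb qs h; rewrite pside_pair // => b.
  have wk1 : w < k.+1 by [].
  case/negP: fx; rewrite /frozen_piece xv /raw_piece.
  by apply/existsP; exists (iter i (@ordS 3) c); apply/existsP; exists (Ordinal wk1); rewrite b sv.
exists v; first by rewrite -xE.
case/and4P: inn => xk yk _ _.
have /allP/(_ (wt u (ordS c))) := cov m min; rewrite mem_iota => /(_ xk).
move=> /allP/(_ (wt u (ordS (ordS c)))); rewrite mem_iota => /(_ yk).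
by move=> /implyP/(_ cv)/implyP/(_ cm).
Qed.

Lemma finite_star st (ss : seq (side T)) (s0 : side T) vs reps start :
  embeds st ss s0 -> 0 < size vs -> covers prime k st vs ->
  finite_cert (size vs) reps (code_mx prime k st vs) start -> finite_mutation_type Q.
Proof.
move=> emb vs0 cov cert; have bP := fun n => @botP st ss s0 n emb.
have [_ gvs _ _] := and4P cov.
have [phi [phiF phiI phiM [x0 phiE]]] := good_codes_vertices botP emb gvs vs0.
have gv0 : good_code prime k st (nth (0, (0, 0)) vs 0).
  by case/andP: gvs => /allP h _; apply: h; apply: mem_nth.
have ss0 : 0 < size ss.
  by case/andP: gv0 => /and4P[/(code_vertex_inner emb)[h _] _ _ _] _; apply: leq_ltn_trans h.
apply: finite_certP phiM cert; split=> // C fC.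
have [x xC] := class_of_surj C; rewrite xC in fC.
have [v xv /andP[gv vin]] := mutable_class_code emb cov ss0 fC.
have xE : x = piece_of ss s0 x0 v.
  by case/andP: gv => /and4P[vP _ vt _] _; apply: val_inj; rewrite (val_piece_of emb bP).
have [i ivs e] : exists2 i, i < size vs &
    class_of (piece_of ss s0 x0 (nth (0, (0, 0)) vs i)) = class_of x.
  case/orP: vin => /(nthP (0, (0, 0)))[i ivs e]; exists i => //; rewrite e xE //.
  apply: val_inj; rewrite !(val_class_code emb bP) ?(good_partner gv) //.
  by case/andP: (gv) => /and4P[_ _ _ /eqP->] _; rewrite setUC.
by exists i => //; rewrite phiE // e.
Qed.

End FiniteStar.

(** * The surface triangulated by a star *)

Section StarSurface.
Variables (T : triangulation) (n : nat).
Hypothesis n23 : (n == 2) || (n == 3).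
Variables (ss : seq (side T)) (s0 : side T).
Hypothesis emb : embeds (star_pattern n) ss s0.
Notation P := (pside ss s0).

Lemma star_size : size ss = n.
Proof.
have := emb_size emb; suff -> : size (star_pattern n) = 3 * n by lia.
by case/orP: n23 => /eqP->.
Qed.

Lemma star_sides s : exists2 q, q < 3 * n & s = P q.
Proof.
have cst : complete (star_pattern n) by case/orP: n23 => /eqP->.
have ss0 : 0 < size ss by rewrite star_size; lia.
have [q qs e] := pside_surj s0 (complete_triangles cst emb ss0 s.1 : s.1 \in _).
by exists q; rewrite // -star_size.
Qed.

Lemma star_card_triangles : #|triangle T| = n.
Proof.
have cst : complete (star_pattern n) by case/orP: n23 => /eqP->.
by rewrite (complete_card cst emb) star_size //; lia.
Qed.

Lemma star_bd i : i < n -> bd_interval (P (3 * i + 1)).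
Proof.
move=> iN; apply: (emb_bd emb).
  by rewrite (emb_size emb) star_size; lia.
by case/orP: n23 iN => /eqP->; case: i => [|[|[|]]].
Qed.

Lemma star_glue i : i < n -> glue (P (3 * i)) = P (3 * (i.+1 %% n) + 2).
Proof.
move=> iN; have qs : 3 * i < size (star_pattern n) by rewrite (emb_size emb) star_size; lia.
have E : nth 0 (star_pattern n) (3 * i) = (3 * (i.+1 %% n) + 2).+3.
  by case/orP: n23 iN => /eqP->; case: i {qs} => [|[|[|]]].
by have [] := emb_glue emb qs E.
Qed.

Lemma star_arc i : i < n -> ~~ bd_interval (P (3 * i)).
Proof.
move=> iN; have qs : 3 * i < size (star_pattern n) by rewrite (emb_size emb) star_size; lia.
apply: (emb_arcN emb qs).
by case/orP: n23 iN => /eqP->; case: i {qs} => [|[|[|]]].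
Qed.

Lemma star_turn i : i < n -> turn (P (3 * i)) = P (3 * (i.+1 %% n)).
Proof.
move=> iN; rewrite /turn star_glue // -pside_succ; congr pside.
by rewrite /succ_side; lia.
Qed.

Lemma star_turn2 i : i < n ->
  ~~ bd_interval (P (3 * (i.+1 %% n) + 2)) /\ turn (P (3 * (i.+1 %% n) + 2)) = P (3 * i + 1).
Proof.
move=> iN; rewrite -star_glue // bd_glue star_arc // /turn glueK -pside_succ; split=> //.
by congr pside; rewrite /succ_side; lia.
Qed.

(* The points of the star, as a function of the sides starting at them. *)
Definition star_point (q : nat) : nat :=
  match q %% 3 with 0 => 0 | 1 => (q %/ 3).+1 | _ => ((q %/ 3 + n.-1) %% n).+1 end.

Variant star_side_spec q : Prop :=
  | StarBoundary of nth 0 (star_pattern n) q = 1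
  | StarArc r of nth 0 (star_pattern n) q = r.+3 & star_point q = star_point (succ_side r).

Lemma star_step q : q < 3 * n -> star_side_spec q.
Proof.
have chk : all (fun q => let r := nth 0 (star_pattern n) q in
    (r == 1) || (2 < r) && (star_point q == star_point (succ_side r.-1.-2))) (iota 0 (3 * n)).
  by rewrite /star_point; case/orP: n23 => /eqP->; vm_compute.
move=> qs; have /(allP chk)/orP[/eqP|/andP[r3 /eqP]] : q \in iota 0 (3 * n) by rewrite mem_iota.
  exact: StarBoundary.
by apply: StarArc; move: r3; case: (nth _ _ _) => [|[|[|]]].
Qed.

(** The label [star_point] is unchanged by each step from an arc to its image under [turn], so
    different labels separate marked points. *)
Lemma star_same_point q r : q < 3 * n -> r < 3 * n -> same_point (P q) (P r) ->
  star_point q = star_point r.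
Proof.
have sP : size (star_pattern n) = 3 * n by rewrite (emb_size emb) star_size.
have [f fP] : exists f : side T -> nat, forall u, u < 3 * n -> f (P u) = star_point u.
  have uP : uniq [seq P u | u <- iota 0 (3 * n)].
    rewrite map_inj_in_uniq ?iota_uniq // => u v; rewrite !mem_iota => us vs.
    by apply: (pside_inj (emb_uniq emb)); rewrite star_size.
  exists (fun s => star_point (index s [seq P u | u <- iota 0 (3 * n)])) => u us.
  have {1}-> : P u = nth s0 [seq P u | u <- iota 0 (3 * n)] u.
    by rewrite (nth_map 0) ?size_iota // nth_iota.
  by rewrite index_uniq // size_map size_iota.
move=> qs rs qr; rewrite -fP // -(fP r) //.
have step s s' : ~~ bd_interval s && (s' == next_side (glue s)) -> f s = f s'.
  case/andP=> b /eqP->; have [u us e] := star_sides s; rewrite e in b *.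
  have usz : u < size (star_pattern n) by rewrite sP.
  have [E|v E sE] := star_step us; first by have := emb_bd emb usz E; rewrite (negPf b).
  have [vs _ _ g] := emb_glue emb usz E; rewrite sP in vs.
  have ss' : succ_side v < 3 * n by rewrite /succ_side; clear - vs; lia.
  by rewrite g -pside_succ !fP.
have /connectP[p + e] := qr; rewrite e.
elim: p (P q) {e qr} => //= x p IH s /andP[/orP[]/step h pp]; by [rewrite h IH | rewrite -h IH].
Qed.

Lemma star_gt0 : 0 < n. Proof. by case/orP: n23 => /eqP->. Qed.

Lemma star_side_cases s : exists2 i, i < n &
  [\/ s = P (3 * i), s = P (3 * i + 1) |
      ~~ bd_interval s /\ turn s = P (3 * i + 1)].
Proof.
have [q qs ->] := star_sides s; have q3 : q %/ 3 < n by lia.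
have [h|[h|h]] : q %% 3 = 0 \/ q %% 3 = 1 \/ q %% 3 = 2 by lia.
- by exists (q %/ 3) => //; constructor 1; congr pside; lia.
- by exists (q %/ 3) => //; constructor 2; congr pside; lia.
have jn : (q %/ 3 + n.-1) %% n < n by rewrite ltn_mod star_gt0.
exists ((q %/ 3 + n.-1) %% n) => //; constructor 3.
have := star_turn2 jn; have -> : ((q %/ 3 + n.-1) %% n).+1 %% n = q %/ 3.
  by move: q3; case/orP: n23 => /eqP->; case: (q %/ 3) => [|[|[|]]].
by have -> : 3 * (q %/ 3) + 2 = q by lia.
Qed.

Lemma star_bd_sides s : bd_interval s -> exists2 i, i < n & s = P (3 * i + 1).
Proof.
have [i iN [->|->|[b _]]] := star_side_cases s; rewrite ?(negPf b) //; last by exists i.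
by rewrite (negPf (star_arc iN)).
Qed.

(** Sides 1 are on the boundary and sides 2 turn into them, so a puncture is the start of a side 0;
    these turn into one another around the centre. *)
Lemma star_puncture s : is_puncture (point_of s) -> point_of s = point_of (P 0).
Proof.
move=> /puncture_around pt; have [i iN [e|e|[b e]]] := star_side_cases s.
- rewrite e; elim: i iN {e} => [|i IH] iN; first by rewrite muln0.
  rewrite -IH; last exact: ltnW.
  apply: esym; apply: same_pointE; have := same_point_turn (star_arc (ltnW iN)).
  by rewrite star_turn ?(ltnW iN) // modn_small.
- by have := pt 0; rewrite /= e star_bd.
by have := pt 1; rewrite /= e star_bd.
Qed.

Lemma star_card_bd : #|bd_sides T| = n.
Proof.
apply/eqP; rewrite eqn_leq; apply/andP; split.
  have := leq_imset_card (fun i : 'I_n => P (3 * i + 1)) predT.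
  rewrite card_ord; apply: leq_trans; apply/subset_leq_card/subsetP => s; rewrite inE.
  by case/star_bd_sides => i iN ->; apply/imsetP; exists (Ordinal iN).
have : count (pred1 1) (star_pattern n) <= #|bd_sides T|.
  by apply: (emb_count emb) => q qs /eqP h; rewrite inE; exact: (emb_bd emb qs h).
by case/orP: n23 => /eqP->.
Qed.

(** The outer side of triangle i + 1 ends where that of triangle i starts, so the outer sides form
    one chain. *)
Lemma star_bd_components : #|bd_components T| <= 1.
Proof.
pose R := eqv_closure [rel s s' : side T | [&& bd_interval s, bd_interval s' &
                                        same_point (next_side s) s']].
have /equivalence_relP[Rr Rl] : equivalence_rel R by exact: eqv_closure_equiv.
have R1 i : i < n -> R (P (3 * i + 1)) (P 1).
  elim: i => [|i IH] iN; first exact: Rr.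
  apply: connect_trans (connect1 _) (IH (ltnW iN)); rewrite /= !star_bd ?(ltnW iN) //=.
  apply/orP; left; rewrite -pside_succ; have := star_turn2 (ltnW iN).
  rewrite modn_small // => -[b <-]; rewrite (_ : succ_side _ = 3 * i.+1 + 2); last first.
    by rewrite /succ_side; lia.
  exact: same_point_turn.
have sub : bd_components T \subset [set bd_sides T].
  apply/subsetP => C /imsetP[s]; rewrite inE => /star_bd_sides[i iN ->] ->; rewrite inE.
  apply/eqP/setP => s'; rewrite !inE; case b: (bd_interval s') => //=.
  have [j jN ->] := star_bd_sides b; rewrite -/R (Rl _ _ (R1 i iN)).
  by have := Rl _ _ (R1 j jN) (P (3 * j + 1)); rewrite Rr.
by apply: leq_trans (subset_leq_card sub) _; rewrite cards1.
Qed.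

(** The centre and the starts of the n outer sides have different labels. *)
Lemma star_card_points : n < #|marked_points T|.
Proof.
pose qs := 0 :: [seq 3 * i + 1 | i <- iota 0 n].
have qsz q : q \in qs -> q < 3 * n.
  rewrite inE => /orP[/eqP->|/mapP[i]]; first by have := star_gt0; lia.
  by rewrite mem_iota => iN ->; lia.
have spE : [seq star_point q | q <- qs] = iota 0 n.+1.
  rewrite /= -map_comp (iotaDl 1 0 n) /=; congr cons; apply: eq_map => i /=.
  have e1 : (3 * i + 1) %% 3 = 1 by lia.
  have e2 : (3 * i + 1) %/ 3 = i by lia.
  by rewrite /star_point e1 e2.
have u : uniq [seq point_of (P q) | q <- qs].
  rewrite map_inj_in_uniq => [|q r qin rin e].
    by apply: (@map_uniq _ _ star_point); rewrite spE iota_uniq.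
  have : star_point q = star_point r.
    apply: star_same_point; rewrite ?qsz // -mem_point_of e mem_point_of.
    exact: same_point_refl.
  have us : uniq [seq star_point q | q <- qs] by rewrite spE iota_uniq.
  move=> e'; rewrite -(nth_index 0 qin) -(nth_index 0 rin); congr nth.
  apply/eqP; rewrite -(nth_uniq 0 _ _ us) ?size_map ?index_mem //.
  by rewrite !(nth_map 0) ?index_mem // !nth_index // e'.
have <- : size [seq point_of (P q) | q <- qs] = n.+1 by rewrite size_map /= size_map size_iota.
rewrite -(card_uniqP u); apply/subset_leq_card/subsetP => _ /mapP[q _ ->].
exact: point_of_marked.
Qed.

Lemma star_polygon S : triangulates T S -> 0 < punctures S -> S = once_punctured_polygon n.
Proof.
move=> TS pS; have nB := card_bd_sides TS; have E2 := card_edges T.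
rewrite star_card_bd star_card_triangles in nB E2.
case: S TS pS nB => g b p [/= pE bE eul] p0 nB.
have p1 : p = 1.
  apply/eqP; rewrite eqn_leq p0 andbT -pE /= -(cards1 (point_of (P 0))).
  apply/subset_leq_card/subsetP => X; rewrite !inE => /andP[/marked_pointP[s ->] h].
  by rewrite star_puncture.
have b1 : b = [:: n].
  have := perm_size bE; rewrite size_map -cardE => sb; have := star_bd_components.
  rewrite sb /= in nB *; case: b nB {bE eul sb} => [|x [|y b]] //=; last by rewrite addn0 => ->.
  by move=> n0; have := star_gt0; rewrite n0.
(* Here F = n and E = 2 n, so Euler's formula reads V + 2 g = n + 1; as V > n, the genus g
   vanishes. *)
have := star_card_points; rewrite p1 b1 in eul *; rewrite star_card_triangles /= in eul.
move: eul E2; move: #|marked_points T| #|edges T| => V E eul E2 Vn.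
by have -> : g = 0 by lia.
Qed.

End StarSurface.

(** * Certificates *)

(* Found by a computer search. The certificate for 7 serves for all k >= 7. *)
Definition cert_A_3 : seq (option leaf) := [::
  None; None; Some (Inf [:: (0,(1,2)); (0,(2,1)); (0,(1,1)); (0,(1,0)); (1,(1,1))] [:: 3; 0;
    1] (3,2,4));
  None; None; Some (Star 2);
  Some (Inf [:: (0,(1,1)); (0,(2,0)); (0,(0,1)); (1,(2,1)); (1,(1,1))] [:: 3; 2; 1; 4] (3,0,4));
  Some (Inf [:: (0,(2,1)); (0,(0,2)); (0,(1,1)); (0,(1,0)); (1,(1,1))] [:: 1; 3; 0; 2] (0,4,2));
  Some (Inf [:: (0,(1,2)); (0,(0,2)); (0,(1,1)); (0,(2,0)); (0,(0,1)); (1,(1,1))] [:: 4; 0; 3;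
    5] (1,2,5));
  None; Some (Inf [:: (0,(1,2)); (0,(1,1)); (0,(2,0)); (0,(1,0)); (1,(1,0))] [:: 1; 2; 4;
    0] (1,3,0));
  Some (Inf [:: (0,(0,2)); (0,(1,1)); (0,(1,0)); (1,(2,0)); (1,(1,0)); (2,(1,1))] [:: 2; 4; 1; 0;
    5] (5,2,3));
  Some (Inf [:: (1,(1,2)); (1,(2,1)); (1,(1,1)); (1,(1,0)); (2,(1,1))] [:: 3; 0; 1] (3,2,4)); None;
  Some (Inf [:: (0,(1,2)); (0,(2,1)); (0,(1,1)); (0,(1,0)); (1,(1,0)); (2,(1,0))] [:: 2; 5; 1; 4;
    3] (3,0,2));
  Some (Inf [:: (0,(0,1)); (0,(1,0)); (1,(1,1)); (1,(2,0)); (2,(1,1)); (2,(2,0)); (2,(1,0))] [:: 3;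
    2; 4; 2; 5; 0; 1; 6] (6,4,2));
  Some (Inf [:: (1,(1,2)); (1,(2,1)); (1,(1,1)); (1,(1,0)); (2,(1,0))] [:: 2; 4; 3; 0] (0,3,1));
  Some (Inf [:: (2,(1,2)); (2,(2,1)); (2,(1,1)); (2,(2,0)); (3,(1,1))] [:: 3; 0; 1] (3,4,2));
  Some (Inf [:: (0,(1,1)); (0,(2,0)); (0,(1,0)); (1,(1,1)); (1,(2,0)); (1,(1,0)); (2,(1,1));
    (2,(2,0)); (2,(1,0)); (3,(1,0))] [:: 9; 8; 4; 3; 2; 8; 3; 0; 3; 8; 5; 6; 7; 1; 9; 8;
    5] (3,7,5))].

Definition cert_A_4 : seq (option leaf) := [::
  None; None;
  Some (Inf [:: (0,(2,2)); (0,(3,1)); (0,(2,1)); (0,(3,0)); (1,(1,2)); (1,(2,1))] [:: 4; 0; 3;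
    1] (3,5,2));
  Some (Inf [:: (0,(2,1)); (0,(0,2)); (0,(1,1)); (0,(1,0)); (1,(1,1))] [:: 1; 0; 3; 2] (0,4,2));
  Some (Inf [:: (0,(2,0)); (1,(2,1)); (1,(3,0)); (1,(1,1)); (1,(2,0)); (1,(1,0)); (2,(1,2));
    (2,(2,1)); (2,(1,1))] [:: 3; 1; 8; 5; 6; 2; 8; 7; 0] (4,3,8))].

Definition cert_A_5 : seq (option leaf) := [::
  None;
  Some (Inf [:: (0,(2,2)); (0,(3,1)); (0,(1,2)); (0,(3,0)); (0,(1,1)); (0,(2,0)); (1,(1,2));
    (1,(2,1))] [:: 4; 2; 5; 0; 7; 6; 4; 6; 7; 1; 3] (3,0,4))].

Definition cert_A_6 : seq (option leaf) := [::
  None;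
  Some (Inf [:: (0,(4,0)); (0,(2,0)); (1,(2,3)); (1,(3,2)); (1,(1,3)); (1,(2,2)); (1,(1,2));
    (1,(2,1)); (1,(1,1))] [:: 4; 7; 2; 6; 8; 0; 1; 5; 3; 6] (7,4,6))].

(** One triangle suffices: the nine vertices are all interior to it. *)
Definition cert_A_7 : seq (option leaf) := [::

  Some (Inf [:: (0,(1,5)); (0,(2,4)); (0,(1,4)); (0,(2,3)); (0,(3,2)); (0,(2,2)); (0,(3,1));
    (0,(1,2)); (0,(2,1))] [:: 6; 2; 3; 2; 5; 8; 7; 4; 5; 3; 0; 1; 0] (1,4,2))].

Definition cert_A'_3 : seq (option leaf) := [::
  None; None; Some (Inf [:: (0,(1,2)); (0,(2,1)); (0,(1,1)); (0,(1,0)); (1,(1,1))] [:: 3; 0;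
    1] (3,2,4));
  None; Some (Inf [:: (0,(2,1)); (0,(0,2)); (0,(1,1)); (0,(1,0)); (1,(1,1))] [:: 1; 0; 4;
    2] (2,4,3));
  Some (Inf [:: (0,(1,2)); (0,(0,2)); (0,(1,1)); (0,(2,0)); (0,(0,1)); (1,(1,1))] [:: 3; 4; 0;
    5] (1,2,5));
  Some (Inf [:: (0,(2,1)); (0,(0,2)); (0,(1,1)); (0,(2,0)); (0,(1,0)); (1,(1,1))] [:: 1; 4; 0;
    5] (5,2,3));
  Some (Inf [:: (0,(2,1)); (0,(0,2)); (0,(1,1)); (0,(1,0)); (1,(1,1))] [:: 3; 0; 1; 2] (0,4,2));
    None;
  Some (Inf [:: (0,(1,2)); (0,(1,1)); (0,(2,0)); (0,(1,0)); (1,(1,0))] [:: 4; 1; 2; 0] (1,3,0));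
  Some (Inf [:: (0,(0,2)); (0,(0,1)); (0,(1,0)); (1,(1,1)); (1,(2,0)); (2,(1,1))] [:: 4; 2; 3; 1;
    5] (0,2,5));
  Some (Inf [:: (1,(1,2)); (1,(2,1)); (1,(1,1)); (1,(1,0)); (2,(1,1))] [:: 1; 3; 2] (0,4,2)); None;
  Some (Inf [:: (0,(1,2)); (0,(2,1)); (0,(1,1)); (0,(1,0)); (1,(1,0)); (2,(1,1)); (2,(1,0))] [:: 5;
    6; 2; 3; 0; 5; 1; 3] (1,4,3));
  Some (Inf [:: (0,(0,2)); (0,(1,1)); (0,(2,0)); (0,(0,1)); (0,(1,0)); (1,(1,1)); (1,(1,0));
    (2,(1,0))] [:: 1; 0; 2; 0; 5; 7; 6; 3; 5; 4] (4,2,0));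
  Some (Inf [:: (1,(1,2)); (1,(2,1)); (1,(1,1)); (1,(1,0)); (2,(1,0)); (3,(1,1))] [:: 1; 4; 5; 3;
    0] (3,2,4));
  Some (Inf [:: (2,(1,2)); (2,(1,1)); (2,(2,0)); (2,(1,0))] [:: 0; 3; 1] (2,0,1));
  Some (Inf [:: (0,(1,1)); (0,(2,0)); (0,(1,0)); (1,(1,1)); (1,(2,0)); (1,(1,0)); (2,(1,1));
    (2,(2,0)); (2,(1,0)); (3,(1,0))] [:: 9; 8; 4; 3; 2; 8; 3; 0; 3; 8; 5; 6; 7; 1; 9; 8;
    5] (3,7,5));
  Some (Inf [:: (0,(2,0)); (0,(1,0)); (1,(1,1)); (1,(2,0)); (1,(1,0)); (2,(1,1)); (2,(2,0));
    (2,(1,0)); (3,(1,0))] [:: 3; 7; 2; 7; 3; 5; 6; 1; 5; 0; 5; 7; 8; 5; 6; 8; 5; 8; 5; 3; 4;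
    5] (5,2,4));
  Some (Inf [:: (0,(1,0)); (1,(2,0)); (1,(1,0)); (2,(1,1)); (2,(2,0)); (2,(1,0)); (3,(1,1));
    (3,(2,0)); (3,(1,0))] [:: 4; 2; 1; 6; 4; 8; 6; 7; 3; 0; 1; 6; 5; 7; 4; 8; 4; 8; 4; 0; 3; 5;
    4] (5,2,3));
  None; None;
  Some (Inf [:: (0,(1,2)); (0,(1,1)); (0,(2,0)); (0,(1,0)); (1,(1,0)); (2,(1,0))] [:: 5; 4; 1; 2;
    0] (1,3,0));
  Some (Inf [:: (0,(0,2)); (0,(1,1)); (0,(2,0)); (0,(1,0)); (1,(1,0)); (2,(1,0))] [:: 0; 1; 5; 4;
    0; 2] (1,3,0));
  Some (Inf [:: (1,(2,1)); (1,(2,0)); (1,(1,0)); (2,(1,1)); (2,(2,0))] [:: 4; 0; 1; 3] (2,0,3));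
  Some (Inf [:: (2,(2,1)); (2,(1,1)); (2,(2,0)); (2,(1,0))] [:: 3] (1,0,2));
  Some (Inf [:: (0,(1,1)); (0,(2,0)); (0,(1,0)); (1,(1,1)); (1,(1,0)); (2,(2,0)); (2,(1,0));
    (3,(2,0)); (3,(1,0)); (4,(1,1))] [:: 9; 0; 4; 6; 7; 3; 6; 1; 0; 4; 9; 4; 1; 8; 1; 0; 3; 5; 9;
    1; 2; 1; 5] (4,8,2));
  Some (Inf [:: (0,(1,1)); (0,(2,0)); (0,(1,0)); (1,(1,1)); (1,(1,0)); (2,(1,1)); (2,(2,0));
    (2,(1,0)); (3,(2,0)); (3,(1,0))] [:: 4; 1; 7; 2; 9; 0; 8; 2; 7; 3; 2; 6; 5] (5,0,3));
  Some (Inf [:: (0,(2,0)); (0,(1,0)); (1,(1,1)); (1,(2,0)); (1,(1,0)); (2,(1,1)); (2,(2,0));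
    (2,(1,0)); (3,(2,0)); (3,(1,0))] [:: 7; 9; 2; 9; 2; 8; 2; 5; 8; 1; 4; 3; 7; 9; 6; 8; 4; 1; 7;
    0; 6; 1; 9; 8; 4] (4,6,8));
  None; None; Some (Inf [:: (0,(1,2)); (0,(2,1)); (0,(2,0)); (1,(1,1)); (1,(2,0))] [:: 3; 4; 0;
    1] (0,2,1));
  Some (Inf [:: (0,(1,1)); (0,(2,0)); (0,(0,1)); (1,(1,1)); (1,(2,0)); (1,(1,0))] [:: 2; 0; 5; 1;
    3] (4,2,3));
  Some (Inf [:: (1,(2,1)); (1,(2,0)); (1,(1,0))] [:: 0] (2,1,0)); None;
  Some (Inf [:: (0,(1,2)); (0,(1,1)); (0,(2,0)); (0,(1,0)); (1,(1,0)); (2,(1,0))] [:: 5; 4; 5; 1;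
    0; 2] (1,3,0));
  Some (Inf [:: (0,(0,1)); (0,(1,0)); (1,(2,0)); (1,(1,0)); (2,(2,0)); (3,(1,1))] [:: 4; 1; 3; 2;
    5; 3] (4,0,5));
  Some (Inf [:: (1,(2,1)); (1,(2,0)); (1,(1,0)); (2,(2,0)); (3,(1,1))] [:: 4; 0; 1; 3] (2,0,3));
  Some (Inf [:: (0,(1,0)); (1,(2,0)); (1,(1,0)); (2,(2,0)); (3,(1,1)); (3,(2,0)); (3,(1,0));
    (4,(1,1))] [:: 4; 6; 2; 3; 1; 4; 2; 4; 7; 4; 5; 0] (2,3,5));
  Some (Inf [:: (0,(1,1)); (0,(2,0)); (0,(1,0)); (1,(1,1)); (1,(2,0)); (1,(1,0)); (2,(2,0));
    (2,(1,0)); (3,(1,1)); (3,(2,0))] [:: 1; 8; 5; 0; 6; 5; 3; 7; 8; 4; 8; 2; 9; 5] (6,7,5));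
  Some (Inf [:: (0,(1,0)); (1,(2,0)); (1,(1,0)); (2,(2,0)); (3,(1,1)); (3,(2,0)); (3,(1,0))] [:: 2;
    0; 2; 3; 4; 0; 6; 2; 1; 4; 2] (4,5,1));
  None; None;
  Some (Inf [:: (0,(2,1)); (0,(1,1)); (0,(2,0)); (0,(1,0)); (1,(1,1)); (1,(2,0)); (2,(2,0))] [:: 2;
    0; 5; 6; 2; 3] (1,4,2));
  Some (Inf [:: (0,(0,2)); (0,(1,1)); (0,(1,0)); (1,(1,0)); (2,(2,0)); (2,(1,0))] [:: 0; 1; 4; 2;
    3] (5,1,3));
  Some (Inf [:: (1,(2,1)); (1,(1,1)); (1,(2,0)); (1,(1,0)); (2,(2,0))] [:: 4; 0; 3] (1,2,0));
  Some (Inf [:: (0,(1,1)); (0,(1,0)); (1,(1,1)); (1,(2,0)); (1,(1,0)); (2,(2,0)); (2,(1,0));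
    (3,(2,0)); (3,(1,0)); (4,(1,1))] [:: 8; 7; 4; 5; 1; 9; 3; 7; 3; 0; 8; 2; 3; 9; 6; 8; 5;
    1] (8,4,6));
  Some (Inf [:: (0,(1,1)); (0,(2,0)); (0,(1,0)); (1,(1,1)); (1,(2,0)); (1,(1,0)); (2,(1,0));
    (3,(2,0)); (3,(1,0))] [:: 6; 5; 7; 0; 1; 0; 8; 6; 3; 6; 2; 4; 8] (1,4,8));
  None;
  Some (Inf [:: (0,(1,2)); (0,(1,1)); (0,(2,0)); (0,(1,0)); (1,(1,0)); (2,(1,0)); (3,(1,0))] [:: 5;
    2; 6; 4; 3; 0; 1] (1,3,2));
  Some (Inf [:: (0,(0,2)); (0,(1,1)); (0,(1,0)); (1,(1,0)); (2,(2,0)); (2,(1,0)); (3,(2,0))] [:: 6;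
    0; 5; 2; 1; 3; 5; 2] (5,4,2));
  Some (Inf [:: (1,(1,2)); (1,(2,1)); (1,(1,1)); (1,(2,0)); (2,(2,0)); (3,(2,0))] [:: 4; 5; 3;
    0] (3,1,2));
  Some (Inf [:: (0,(1,0)); (1,(2,0)); (1,(1,0)); (2,(2,0)); (2,(1,0)); (3,(2,0)); (3,(1,0));
    (4,(2,0)); (5,(1,1))] [:: 0; 5; 3; 0; 2; 6; 0; 3; 8; 2; 6; 4; 7; 1; 3; 2; 0; 7; 6; 1] (2,8,0));
  Some (Inf [:: (0,(1,1)); (0,(2,0)); (0,(1,0)); (1,(1,1)); (1,(1,0)); (2,(2,0)); (2,(1,0));
    (3,(2,0)); (3,(1,0)); (4,(2,0))] [:: 9; 6; 4; 6; 8; 3; 5; 7; 1; 8; 0; 4; 7; 6; 4; 6; 7; 5; 9;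
    6; 8; 9] (6,2,8));
  Some (Inf [:: (0,(1,0)); (1,(2,0)); (1,(1,0)); (2,(2,0)); (2,(1,0)); (3,(2,0)); (3,(1,0));
    (4,(2,0)); (4,(1,0))] [:: 5; 0; 6; 8; 0; 3; 0; 2; 8; 7; 5; 1; 4; 3; 8; 1; 0; 7] (7,5,1));
  None; None; Some (Inf [:: (0,(2,1)); (0,(1,1)); (0,(2,0)); (0,(1,0))] [:: 3] (1,0,2)); None;
  Some (Inf [:: (0,(2,1)); (0,(0,2)); (0,(1,1)); (0,(2,0)); (0,(1,0))] [:: 0; 4; 1] (1,2,3));
  Some (Inf [:: (0,(1,2)); (0,(2,1)); (0,(0,2)); (0,(1,1)); (0,(1,0))] [:: 1; 4; 2] (2,3,0));
  Some (Inf [:: (0,(2,1)); (0,(0,2)); (0,(1,1)); (0,(1,0))] [:: 0; 3; 2] (0,1,2)); None;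
  Some (Inf [:: (0,(2,1)); (0,(1,1)); (0,(2,0)); (0,(1,0)); (1,(2,0)); (2,(1,1))] [:: 0; 3; 5;
    4] (4,1,2));
  Some (Inf [:: (0,(2,0)); (0,(0,1)); (0,(1,0)); (1,(2,0)); (2,(1,1))] [:: 1; 2; 4; 3] (3,1,0));
    None;
  Some (Inf [:: (0,(1,2)); (0,(2,1)); (0,(1,1)); (0,(1,0)); (1,(1,0)); (2,(1,0)); (3,(1,1))] [:: 1;
    6; 5; 1; 4; 2; 6] (0,3,6));
  Some (Inf [:: (0,(2,0)); (0,(0,1)); (0,(1,0)); (1,(2,0)); (2,(1,1)); (2,(2,0)); (3,(1,1))] [:: 2;
    1; 3; 4; 0; 5; 2] (2,6,4));
  Some (Inf [:: (2,(2,1)); (2,(1,1)); (2,(2,0)); (2,(1,0)); (3,(1,1))] [:: 3; 4; 1] (4,0,2));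
  Some (Inf [:: (0,(1,1)); (0,(2,0)); (0,(1,0)); (1,(2,0)); (2,(1,1)); (2,(2,0)); (2,(1,0));
    (3,(1,1)); (3,(1,0))] [:: 0; 3; 4; 5; 8; 1; 2; 7; 1; 0; 2; 6; 3] (4,1,3));
  Some (Inf [:: (0,(2,0)); (0,(1,0)); (1,(2,0)); (1,(1,0)); (2,(1,1)); (2,(1,0)); (3,(1,1));
    (3,(2,0)); (3,(1,0))] [:: 7; 5; 8; 0; 2; 3; 0; 8; 4; 1; 6] (6,8,0));
  Some (Inf [:: (0,(1,1)); (0,(2,0)); (0,(1,0)); (1,(2,0)); (2,(1,1)); (2,(2,0)); (2,(1,0));
    (3,(1,1)); (3,(1,0))] [:: 3; 6; 2; 4; 0; 3; 6; 5; 7; 8; 1] (1,4,6));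
  None; None;
  Some (Inf [:: (0,(2,1)); (0,(2,0)); (0,(1,0)); (1,(2,0)); (2,(1,1)); (2,(1,0))] [:: 5; 3; 0; 4;
    1] (2,4,1));
  Some (Inf [:: (0,(0,1)); (0,(1,0)); (1,(2,0)); (2,(1,1)); (2,(2,0)); (2,(1,0))] [:: 3; 2; 0; 1;
    4; 5] (5,2,3));
  Some (Inf [:: (2,(2,1)); (2,(1,1)); (2,(2,0)); (2,(1,0))] [:: 3] (1,0,2));
  Some (Inf [:: (0,(2,0)); (0,(1,0)); (1,(2,0)); (1,(1,0)); (2,(1,1)); (2,(2,0)); (2,(1,0));
    (3,(1,0)); (4,(1,1))] [:: 2; 8; 6; 7; 4; 3; 5; 1; 2; 0; 3; 2] (0,6,3));
  Some (Inf [:: (0,(1,1)); (0,(2,0)); (0,(1,0)); (1,(2,0)); (2,(1,1)); (2,(2,0)); (2,(1,0));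
    (3,(1,0))] [:: 2; 3; 0; 4; 6; 1; 3; 2; 5; 7] (6,4,5));
  Some (Inf [:: (0,(1,1)); (0,(2,0)); (0,(1,0)); (1,(2,0)); (1,(1,0)); (2,(1,1)); (2,(2,0));
    (2,(1,0)); (3,(1,0))] [:: 3; 7; 4; 1; 5; 4; 8; 4; 0; 5; 6; 2; 0; 4; 6; 8; 1; 7] (7,4,3));
  None; None; Some (Inf [:: (0,(1,2)); (0,(2,1)); (0,(1,1)); (0,(2,0)); (1,(2,0))] [:: 4; 0;
    3] (3,1,2));
  Some (Inf [:: (0,(0,2)); (0,(1,1)); (0,(0,1)); (0,(1,0)); (1,(2,0))] [:: 3; 4; 1; 0] (0,4,2));
    None;
  Some (Inf [:: (0,(1,2)); (0,(2,1)); (0,(1,1)); (0,(2,0)); (1,(2,0)); (2,(2,0)); (3,(1,1))] [:: 0;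
    4; 3; 5; 6] (1,2,6));
  Some (Inf [:: (0,(2,0)); (0,(0,1)); (0,(1,0)); (1,(2,0)); (2,(2,0)); (3,(1,1))] [:: 1; 5; 4; 2;
    3] (3,1,0));
  Some (Inf [:: (0,(1,1)); (0,(1,0)); (1,(2,0)); (1,(1,0)); (2,(2,0)); (2,(1,0)); (3,(1,1));
    (3,(2,0)); (3,(1,0)); (4,(1,1))] [:: 4; 3; 8; 6; 1; 9; 5; 7; 3; 2; 1; 8; 7; 1; 5; 6] (7,0,2));
  None;
  Some (Inf [:: (0,(1,1)); (0,(2,0)); (0,(1,0)); (1,(2,0)); (2,(2,0)); (2,(1,0)); (3,(1,1));
    (3,(2,0)); (3,(1,0))] [:: 1; 6; 4; 1; 3; 1; 6; 0; 2; 0; 7; 8; 5; 7; 1] (5,4,1));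
  None; None;
  Some (Inf [:: (0,(1,2)); (0,(2,1)); (0,(1,1)); (0,(2,0)); (1,(2,0)); (2,(2,0))] [:: 5; 4; 0;
    3] (3,1,2));
  Some (Inf [:: (0,(0,2)); (0,(1,1)); (0,(1,0)); (1,(2,0)); (1,(1,0)); (2,(2,0))] [:: 0; 5; 1; 4;
    3] (5,2,1));
  None;
  Some (Inf [:: (0,(1,2)); (0,(2,1)); (0,(1,1)); (0,(2,0)); (1,(2,0)); (2,(2,0)); (3,(2,0));
    (4,(1,1))] [:: 3; 4; 0; 6; 5; 7] (1,2,7));
  Some (Inf [:: (0,(0,2)); (0,(0,1)); (0,(1,0)); (1,(2,0)); (2,(2,0)); (3,(2,0)); (4,(1,1))] [:: 4;
    6; 5; 1; 6; 0; 3; 6] (3,2,5));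
  Some (Inf [:: (0,(1,1)); (0,(2,0)); (0,(1,0)); (1,(2,0)); (1,(1,0)); (2,(2,0)); (2,(1,0));
    (3,(2,0)); (3,(1,0)); (4,(1,0))] [:: 6; 2; 0; 5; 2; 3; 5; 0; 7; 5; 2; 6; 1; 6; 3; 8; 6; 0; 4;
    7; 5; 9] (7,8,1));
  Some (Inf [:: (0,(1,1)); (0,(2,0)); (0,(1,0)); (1,(2,0)); (2,(2,0)); (2,(1,0)); (3,(2,0));
    (3,(1,0)); (4,(1,1)); (4,(1,0))] [:: 8; 4; 7; 5; 1; 0; 3; 8; 6; 2; 0; 4; 7; 1; 8; 4; 0; 3; 0;
    2; 9; 3; 5; 0; 2] (1,4,3));
  Some (Inf [:: (0,(1,1)); (0,(1,0)); (1,(2,0)); (1,(1,0)); (2,(2,0)); (3,(2,0)); (4,(1,1));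
    (4,(2,0)); (4,(1,0))] [:: 8; 1; 5; 6; 8; 4; 2; 3; 0; 7; 2] (0,8,2));
  None; None;
  Some (Inf [:: (0,(2,1)); (0,(1,1)); (0,(2,0)); (0,(1,0)); (1,(2,0)); (2,(2,0)); (3,(2,0))] [:: 4;
    5; 6; 0; 3] (1,2,0));
  Some (Inf [:: (0,(0,2)); (0,(1,1)); (0,(1,0)); (1,(2,0)); (1,(1,0)); (2,(2,0)); (3,(2,0))] [:: 2;
    1; 4; 6; 0; 3; 1] (2,5,0));
  Some (Inf [:: (0,(2,0)); (1,(2,0)); (1,(1,0)); (2,(2,0)); (2,(1,0)); (3,(2,0)); (3,(1,0));
    (4,(2,0)); (4,(1,0)); (5,(1,1))] [:: 9; 6; 3; 5; 1; 4; 5; 0; 8; 4; 3; 5; 1; 2; 3; 5; 8; 9; 0;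
    6; 3; 9; 4; 7; 6; 1; 5] (1,8,0));
  Some (Inf [:: (0,(2,0)); (0,(1,0)); (1,(2,0)); (1,(1,0)); (2,(2,0)); (2,(1,0)); (3,(2,0));
    (3,(1,0)); (4,(2,0)); (4,(1,0))] [:: 7; 8; 9; 5; 2; 6; 7; 9; 7; 6; 3; 8; 4; 9; 1; 0; 7;
    3] (8,9,3));
  Some (Inf [:: (0,(2,0)); (0,(1,0)); (1,(2,0)); (1,(1,0)); (2,(2,0)); (2,(1,0)); (3,(2,0));
    (3,(1,0)); (4,(2,0)); (4,(1,0))] [:: 0; 5; 2; 0; 4; 5; 7; 2; 9; 1; 4; 5; 8; 0; 3; 6;
    7] (3,2,7));
  None; None; None;
  Some (Inf [:: (0,(0,2)); (0,(2,0)); (0,(0,1)); (1,(2,1)); (1,(1,1))] [:: 3; 2; 1] (1,4,0));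
  Some (Inf [:: (0,(2,0)); (0,(0,1)); (1,(2,1)); (1,(1,1))] [:: 1; 0; 3] (3,0,2));
  Some (Inf [:: (0,(0,2)); (0,(2,0)); (0,(0,1)); (1,(2,1)); (1,(1,1))] [:: 2; 1; 3] (1,4,0)); None;
  Some (Inf [:: (0,(0,2)); (0,(2,0)); (0,(0,1)); (1,(1,1)); (1,(1,0))] [:: 4; 2; 3; 1] (1,4,0));
  Some (Inf [:: (1,(2,1)); (1,(1,1)); (1,(2,0)); (1,(1,0)); (2,(1,1))] [:: 4; 3; 0] (1,2,0)); None;
  Some (Inf [:: (0,(0,1)); (0,(1,0)); (1,(2,0)); (1,(1,0)); (2,(1,1)); (2,(2,0)); (3,(1,1))] [:: 1;
    0; 6; 5; 3; 4] (4,0,2));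
  Some (Inf [:: (1,(1,2)); (1,(1,1)); (1,(2,0)); (1,(1,0)); (2,(1,0))] [:: 4; 1; 0; 3] (2,0,3));
  Some (Inf [:: (2,(1,2)); (2,(1,1)); (2,(2,0)); (2,(1,0))] [:: 1; 2; 3] (3,0,2));
  Some (Inf [:: (0,(2,0)); (0,(1,0)); (1,(1,1)); (1,(2,0)); (1,(1,0)); (2,(1,1)); (2,(2,0));
    (2,(1,0)); (3,(1,1)); (3,(2,0))] [:: 9; 0; 2; 4; 8; 7; 6; 9; 7; 3; 7; 4; 1; 2; 6; 0; 2; 6; 2;
    4; 1; 5; 1; 5; 7] (3,0,7));
  Some (Inf [:: (0,(2,0)); (1,(1,1)); (1,(2,0)); (1,(1,0)); (2,(1,1)); (2,(2,0)); (2,(1,0));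
    (3,(1,1)); (3,(2,0)); (3,(1,0))] [:: 6; 5; 3; 9; 5; 4; 1; 7; 4; 2; 7; 5; 3; 4; 6; 8; 2; 4; 3;
    2; 1] (4,0,8));
  Some (Inf [:: (0,(2,0)); (0,(1,0)); (1,(1,1)); (1,(1,0)); (2,(1,1)); (2,(2,0)); (2,(1,0));
    (3,(1,1)); (3,(2,0)); (3,(1,0))] [:: 8; 0; 7; 3; 4; 5; 4; 6; 9; 7; 9; 8; 2; 9; 0; 1] (1,5,6));
  None; None;
  Some (Inf [:: (0,(0,2)); (0,(2,0)); (1,(1,1)); (1,(1,0)); (2,(1,1)); (2,(2,0)); (2,(1,0))] [:: 5;
    3; 1; 0; 2; 6] (0,4,2));
  Some (Inf [:: (1,(1,2)); (1,(2,1)); (1,(1,1)); (1,(1,0)); (2,(1,0))] [:: 2; 1; 4; 3] (3,0,2));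
  Some (Inf [:: (2,(2,1)); (2,(1,1)); (2,(2,0)); (2,(1,0))] [:: 3] (1,0,2));
  Some (Inf [:: (0,(2,0)); (0,(1,0)); (1,(1,1)); (1,(2,0)); (1,(1,0)); (2,(1,1)); (2,(1,0));
    (3,(2,0)); (3,(1,0)); (4,(1,1))] [:: 7; 2; 3; 0; 4; 8; 5; 6; 7; 9; 8; 7; 1; 6; 3; 8; 0; 7; 2;
    6; 8; 5; 9; 4] (3,7,4));
  Some (Inf [:: (0,(2,0)); (0,(1,0)); (1,(1,1)); (1,(2,0)); (1,(1,0)); (2,(1,1)); (2,(1,0));
    (3,(2,0)); (3,(1,0))] [:: 4; 6; 3; 2; 0; 5; 7; 8; 4; 1; 7] (7,1,5));
  None;
  Some (Inf [:: (0,(0,2)); (0,(2,0)); (0,(1,0)); (1,(1,1)); (1,(2,0)); (1,(1,0)); (2,(1,0));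
    (3,(1,0))] [:: 1; 6; 5; 0; 3; 4; 2; 0] (2,7,1));
  Some (Inf [:: (1,(1,2)); (1,(2,1)); (1,(2,0)); (2,(1,1)); (2,(2,0)); (3,(2,0))] [:: 0; 3; 5; 4;
    1] (0,2,1));
  Some (Inf [:: (2,(2,1)); (2,(2,0)); (2,(1,0)); (3,(2,0))] [:: 0; 1; 3] (2,0,3));
  Some (Inf [:: (0,(2,0)); (0,(1,0)); (1,(1,1)); (1,(2,0)); (1,(1,0)); (2,(1,0)); (3,(2,0));
    (3,(1,0)); (4,(2,0))] [:: 8; 5; 4; 6; 2; 7; 0; 6; 8; 1; 6; 0; 8; 0; 6; 5; 6; 0; 2; 7] (7,3,5));
  Some (Inf [:: (1,(1,1)); (1,(2,0)); (1,(1,0)); (2,(1,1)); (2,(1,0)); (3,(2,0)); (3,(1,0));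
    (4,(2,0)); (4,(1,0))] [:: 6; 0; 7; 1; 2; 4; 6; 5; 0; 3; 8; 5; 3; 7; 4; 3; 1; 5] (5,2,1));
  Some (Inf [:: (0,(2,0)); (1,(1,1)); (1,(2,0)); (1,(1,0)); (2,(1,1)); (2,(2,0)); (2,(1,0));
    (3,(2,0)); (3,(1,0)); (4,(2,0))] [:: 2; 6; 4; 1; 2; 9; 3; 8; 4; 9; 8; 5; 1; 0; 7; 3; 1; 5; 2;
    9; 6; 9; 0] (2,8,0));
  None; None; Some (Inf [:: (0,(0,2)); (0,(2,0)); (0,(1,0)); (1,(1,1)); (1,(1,0))] [:: 4; 2; 0;
    3] (0,1,4));
  Some (Inf [:: (1,(2,1)); (1,(2,0)); (1,(1,0))] [:: 0] (2,1,0)); None;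
  Some (Inf [:: (0,(0,1)); (0,(1,0)); (1,(2,0)); (1,(1,0)); (2,(2,0)); (3,(1,1))] [:: 1; 4; 5; 3;
    2; 4] (2,0,4));
  Some (Inf [:: (1,(1,2)); (1,(2,1)); (1,(1,1)); (1,(2,0)); (2,(2,0)); (3,(1,1))] [:: 5; 4; 0;
    3] (3,1,2));
  Some (Inf [:: (0,(2,0)); (0,(1,0)); (1,(1,1)); (1,(2,0)); (1,(1,0)); (2,(2,0)); (3,(1,1));
    (3,(2,0)); (3,(1,0))] [:: 6; 0; 5; 8; 0; 4; 0; 6; 3; 1; 2; 5; 7] (1,4,7));
  Some (Inf [:: (0,(2,0)); (0,(1,0)); (1,(1,1)); (1,(1,0)); (2,(2,0)); (2,(1,0)); (3,(1,1));
    (3,(2,0))] [:: 6; 4; 3; 0; 7; 5; 4; 1; 3; 7; 1] (7,2,1));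
  Some (Inf [:: (0,(2,0)); (0,(1,0)); (1,(2,0)); (1,(1,0)); (2,(2,0)); (2,(1,0)); (3,(1,1));
    (3,(2,0))] [:: 3; 1; 6; 0; 4; 2; 6; 1; 5; 6; 7; 1; 2] (1,3,2));
  None; None;
  Some (Inf [:: (0,(0,2)); (0,(2,0)); (1,(1,1)); (1,(1,0)); (2,(2,0)); (2,(1,0))] [:: 1; 3; 2; 5;
    0] (0,3,4));
  Some (Inf [:: (1,(2,1)); (1,(1,1)); (1,(2,0)); (1,(1,0)); (2,(2,0))] [:: 4; 3; 0] (1,2,0));
  Some (Inf [:: (0,(2,0)); (0,(1,0)); (1,(1,1)); (1,(2,0)); (1,(1,0)); (2,(1,0)); (3,(2,0));
    (3,(1,0)); (4,(1,1))] [:: 2; 5; 0; 4; 6; 8; 0; 7; 2; 7; 5; 4; 0; 1; 4; 3] (1,2,3));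
  Some (Inf [:: (0,(2,0)); (0,(1,0)); (1,(1,1)); (1,(1,0)); (2,(2,0)); (2,(1,0)); (3,(2,0));
    (3,(1,0))] [:: 3; 7; 6; 5; 4; 0; 2; 1; 4; 7; 3] (1,5,3));
  None;
  Some (Inf [:: (0,(0,2)); (0,(0,1)); (0,(1,0)); (1,(1,0)); (2,(2,0)); (3,(2,0)); (3,(1,0))] [:: 4;
    5; 2; 4; 3; 0; 4; 6] (5,1,3));
  Some (Inf [:: (1,(1,2)); (1,(2,1)); (1,(2,0)); (2,(2,0)); (3,(2,0))] [:: 0; 3; 4; 1] (0,2,1));
  Some (Inf [:: (0,(2,0)); (0,(1,0)); (1,(2,0)); (1,(1,0)); (2,(2,0)); (2,(1,0)); (3,(2,0));
    (4,(2,0))] [:: 3; 4; 7; 2; 6; 7; 5; 0; 1; 0; 2; 3] (3,7,1));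
  Some (Inf [:: (0,(2,0)); (0,(1,0)); (1,(1,1)); (1,(1,0)); (2,(2,0)); (2,(1,0)); (3,(2,0));
    (3,(1,0)); (4,(2,0)); (4,(1,0))] [:: 3; 5; 2; 9; 6; 8; 5; 9; 1; 9; 5; 0; 4; 7; 2; 1] (1,2,8));
  Some (Inf [:: (0,(2,0)); (0,(1,0)); (1,(1,1)); (1,(1,0)); (2,(2,0)); (2,(1,0)); (3,(2,0));
    (4,(2,0))] [:: 3; 4; 6; 4; 5; 0; 2; 6; 1; 0; 6] (7,1,6));
  None; None; Some (Star 2); None;
  Some (Inf [:: (0,(2,0)); (0,(0,1)); (0,(1,0)); (1,(2,0)); (2,(1,1))] [:: 3; 4; 0; 2] (3,1,4));
    None;
  Some (Inf [:: (0,(2,0)); (0,(0,1)); (0,(1,0)); (1,(2,0)); (2,(1,1)); (2,(1,0))] [:: 1; 5; 4; 2;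
    3] (3,5,0));
  Some (Inf [:: (2,(1,2)); (2,(1,1)); (2,(2,0)); (2,(1,0))] [:: 1; 2; 3] (3,0,2));
  Some (Inf [:: (0,(2,0)); (0,(1,0)); (1,(2,0)); (1,(1,0)); (2,(1,1)); (2,(1,0)); (3,(1,1));
    (3,(2,0)); (3,(1,0)); (4,(1,1))] [:: 8; 3; 5; 0; 2; 0; 3; 2; 8; 2; 0; 6; 4; 1; 6; 2; 9;
    1] (4,7,1));
  Some (Inf [:: (0,(2,0)); (1,(2,0)); (1,(1,0)); (2,(1,1)); (2,(2,0)); (2,(1,0)); (3,(1,1));
    (3,(2,0)); (3,(1,0))] [:: 0; 1; 3; 7; 5; 8; 0; 7; 1; 6; 4; 5] (6,2,5));
  None;
  Some (Inf [:: (0,(0,2)); (0,(2,0)); (1,(2,0)); (1,(1,0)); (2,(1,1)); (2,(1,0)); (3,(1,1));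
    (3,(2,0))] [:: 1; 7; 0; 2; 5; 3; 4] (3,6,4));
  Some (Inf [:: (2,(1,2)); (2,(2,1)); (2,(2,0)); (3,(1,1)); (3,(2,0))] [:: 0; 3; 4; 1] (0,2,1));
  Some (Inf [:: (3,(2,1)); (3,(1,1)); (3,(2,0)); (3,(1,0))] [:: 3] (1,0,2));
  Some (Inf [:: (1,(2,0)); (1,(1,0)); (2,(1,1)); (2,(1,0)); (3,(1,1)); (3,(2,0)); (3,(1,0));
    (4,(2,0)); (5,(1,1))] [:: 3; 7; 2; 1; 3; 4; 0; 5; 6; 3; 8; 2] (2,1,8));
  Some (Inf [:: (1,(2,0)); (1,(1,0)); (2,(1,1)); (2,(2,0)); (2,(1,0)); (3,(2,0)); (3,(1,0));
    (4,(2,0)); (4,(1,0))] [:: 0; 2; 4; 5; 6; 7; 3; 4; 2; 0; 1; 7] (1,8,6));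
  Some (Inf [:: (0,(2,0)); (0,(1,0)); (1,(2,0)); (1,(1,0)); (2,(1,1)); (2,(2,0)); (2,(1,0));
    (3,(1,0)); (4,(1,0))] [:: 7; 2; 4; 6; 1; 5; 2; 4; 7; 5; 8; 0; 5; 4; 2; 3] (3,0,7));
  None; None;
  Some (Inf [:: (0,(0,2)); (0,(2,0)); (0,(0,1)); (1,(2,0)); (2,(1,1)); (2,(1,0))] [:: 3; 1; 5; 2;
    0] (0,4,2));
  Some (Inf [:: (2,(2,1)); (2,(2,0)); (2,(1,0))] [:: 0] (2,1,0));
  Some (Inf [:: (0,(2,0)); (0,(1,0)); (1,(2,0)); (1,(1,0)); (2,(1,1)); (2,(1,0)); (3,(2,0));
    (3,(1,0)); (4,(1,1))] [:: 5; 3; 4; 2; 7; 1; 8; 7; 6; 0; 3] (0,4,3));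
  Some (Inf [:: (0,(2,0)); (0,(1,0)); (1,(2,0)); (1,(1,0)); (2,(1,1)); (2,(1,0)); (3,(2,0));
    (3,(1,0))] [:: 5; 4; 3; 6; 2; 7; 1; 0; 4] (4,3,2));
  None;
  Some (Inf [:: (0,(0,2)); (0,(2,0)); (1,(2,0)); (2,(1,1)); (2,(2,0)); (2,(1,0)); (3,(1,0))] [:: 2;
    5; 1; 3; 6; 5; 0] (4,5,0));
  Some (Inf [:: (2,(1,2)); (2,(2,1)); (2,(1,1)); (2,(2,0)); (3,(2,0))] [:: 0; 4; 3] (3,1,2));
  Some (Inf [:: (1,(2,0)); (1,(1,0)); (2,(1,1)); (2,(1,0)); (3,(2,0)); (3,(1,0)); (4,(2,0));
    (5,(1,1))] [:: 6; 4; 7; 4; 0; 3; 2; 5; 0; 7; 4; 3] (4,1,3));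
  Some (Inf [:: (0,(2,0)); (1,(2,0)); (1,(1,0)); (2,(1,1)); (2,(1,0)); (3,(2,0)); (3,(1,0));
    (4,(2,0))] [:: 1; 4; 5; 3; 7; 6; 4; 1; 5; 1; 0; 2; 7; 1; 5] (2,4,7));
  Some (Inf [:: (0,(2,0)); (0,(1,0)); (1,(2,0)); (1,(1,0)); (2,(1,1)); (2,(1,0)); (3,(2,0));
    (3,(1,0)); (4,(2,0)); (4,(1,0))] [:: 5; 4; 3; 8; 0; 7; 1; 2; 6; 2; 9; 1; 2; 3; 4] (0,3,4));
  None; None; Some (Star 3); None;
  Some (Inf [:: (0,(2,0)); (0,(0,1)); (1,(2,0)); (2,(2,0)); (2,(1,0)); (3,(1,1))] [:: 2; 3; 4; 0;
    5] (0,1,3));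
  None;
  Some (Inf [:: (0,(0,1)); (0,(1,0)); (1,(2,0)); (2,(2,0)); (2,(1,0)); (3,(1,1)); (3,(1,0))] [:: 0;
    2; 1; 5; 3; 6; 5] (5,2,4));
  Some (Inf [:: (3,(2,1)); (3,(1,1)); (3,(2,0)); (3,(1,0)); (4,(1,1))] [:: 3; 0; 4] (4,1,2));
  Some (Inf [:: (0,(2,0)); (0,(1,0)); (1,(2,0)); (1,(1,0)); (2,(2,0)); (3,(1,1)); (3,(2,0));
    (3,(1,0)); (4,(1,0))] [:: 1; 4; 2; 5; 3; 4; 7; 6; 0; 7; 8; 6; 2; 5; 8; 4; 6; 5; 3] (3,5,7));
  Some (Inf [:: (1,(2,0)); (1,(1,0)); (2,(2,0)); (2,(1,0)); (3,(1,1)); (3,(2,0)); (3,(1,0));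
    (4,(1,1)); (4,(2,0)); (4,(1,0))] [:: 2; 4; 3; 6; 5; 7; 3; 9; 0; 6; 1; 4; 8; 7] (8,6,7));
  Some (Inf [:: (0,(2,0)); (1,(2,0)); (2,(2,0)); (2,(1,0)); (3,(1,1)); (3,(1,0)); (4,(1,1));
    (4,(2,0)); (4,(1,0))] [:: 5; 2; 6; 3; 5; 4; 1; 5; 2; 6; 4; 8; 7; 5; 0; 5; 6] (0,2,5));
  None; None;
  Some (Inf [:: (0,(0,2)); (0,(2,0)); (0,(1,0)); (1,(2,0)); (1,(1,0)); (2,(1,0)); (3,(1,0))] [:: 1;
    5; 4; 5; 0; 6; 1; 3] (0,2,6));
  Some (Inf [:: (3,(2,1)); (3,(2,0)); (3,(1,0))] [:: 0] (2,1,0));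
  Some (Inf [:: (1,(2,0)); (1,(1,0)); (2,(2,0)); (2,(1,0)); (3,(1,1)); (3,(1,0)); (4,(2,0));
    (4,(1,0)); (5,(1,1))] [:: 3; 4; 6; 3; 0; 8; 6; 2; 3; 5; 1; 8; 7; 4; 2] (2,1,4));
  Some (Inf [:: (1,(2,0)); (2,(2,0)); (2,(1,0)); (3,(1,1)); (3,(2,0)); (3,(1,0)); (4,(2,0));
    (4,(1,0))] [:: 4; 5; 4; 7; 1; 6; 0; 2; 7; 3] (3,7,1));
  Some (Inf [:: (0,(2,0)); (1,(2,0)); (2,(2,0)); (2,(1,0)); (3,(1,1)); (3,(2,0)); (3,(1,0));
    (4,(1,0))] [:: 2; 6; 0; 5; 4; 3; 5; 7; 6; 4; 1] (0,6,1));
  None; None;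
  Some (Inf [:: (0,(0,2)); (0,(2,0)); (0,(0,1)); (1,(2,0)); (1,(1,0)); (2,(1,0))] [:: 1; 3; 0; 4;
    5] (2,3,5));
  None;
  Some (Inf [:: (0,(0,1)); (0,(1,0)); (1,(1,0)); (2,(2,0)); (2,(1,0)); (3,(2,0)); (4,(1,1))] [:: 1;
    2; 5; 0; 4; 3; 0] (3,6,2));
  Some (Inf [:: (0,(1,0)); (1,(1,0)); (2,(2,0)); (2,(1,0)); (3,(2,0)); (3,(1,0)); (4,(1,1));
    (4,(2,0)); (4,(1,0))] [:: 1; 6; 8; 0; 4; 3; 5; 4; 5; 3; 5; 3; 2; 1; 7; 5; 0; 4; 1; 3; 4;
    2] (3,6,2));
  Some (Inf [:: (0,(2,0)); (1,(2,0)); (1,(1,0)); (2,(2,0)); (2,(1,0)); (3,(2,0)); (3,(1,0));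
    (4,(1,1)); (4,(2,0)); (4,(1,0))] [:: 6; 1; 9; 0; 3; 8; 7; 4; 2; 8; 5; 0; 3; 2; 5; 9; 8; 3; 9;
    5] (5,6,2));
  Some (Inf [:: (0,(1,0)); (1,(2,0)); (1,(1,0)); (2,(2,0)); (2,(1,0)); (3,(2,0)); (3,(1,0));
    (4,(1,1)); (4,(2,0)); (4,(1,0))] [:: 9; 7; 5; 0; 7; 3; 2; 6; 8; 4; 5; 6; 4; 1; 7; 1; 2; 9;
    3] (7,1,3));
  None; None;
  Some (Inf [:: (0,(0,2)); (0,(2,0)); (1,(2,0)); (1,(1,0)); (2,(1,0)); (3,(2,0)); (3,(1,0))] [:: 1;
    4; 3; 0; 2; 4; 6] (3,5,2));
  Some (Inf [:: (0,(2,0)); (0,(1,0)); (1,(2,0)); (1,(1,0)); (2,(2,0)); (2,(1,0)); (3,(2,0));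
    (3,(1,0)); (4,(2,0)); (5,(1,1))] [:: 8; 1; 7; 9; 6; 5; 1; 0; 8; 3; 7; 8; 2; 4; 1; 4; 6; 7; 8;
    5] (5,1,2));
  Some (Inf [:: (0,(2,0)); (0,(1,0)); (1,(2,0)); (1,(1,0)); (2,(1,0)); (3,(2,0)); (3,(1,0));
    (4,(2,0)); (4,(1,0))] [:: 4; 5; 3; 8; 1; 0; 7; 4; 2; 4; 1; 0; 6] (6,2,8));
  None;
  Some (Inf [:: (0,(0,2)); (0,(0,1)); (0,(1,0)); (1,(1,0)); (2,(1,0)); (3,(2,0)); (3,(1,0));
    (4,(2,0))] [:: 7; 0; 5; 3; 6; 5; 2; 1; 7; 5] (1,4,0));
  Some (Inf [:: (0,(1,0)); (1,(1,0)); (2,(1,0)); (3,(2,0)); (3,(1,0)); (4,(2,0)); (4,(1,0));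
    (5,(2,0)); (5,(1,0)); (6,(1,1))] [:: 0; 7; 5; 2; 5; 1; 9; 3; 2; 7; 2; 5; 4; 2; 6; 9; 3; 0; 7;
    9; 5; 1; 8; 2; 3; 5; 1; 0; 4] (4,7,0));
  Some (Inf [:: (0,(1,0)); (1,(2,0)); (1,(1,0)); (2,(2,0)); (3,(2,0)); (3,(1,0)); (4,(2,0));
    (4,(1,0)); (5,(2,0)); (5,(1,0))] [:: 9; 3; 4; 6; 0; 1; 2; 9; 8; 9; 0; 5; 0; 8; 3; 7; 5; 2; 9;
    4; 3] (9,6,5));
  Some (Inf [:: (0,(1,0)); (1,(2,0)); (1,(1,0)); (2,(2,0)); (3,(2,0)); (3,(1,0)); (4,(2,0));
    (4,(1,0)); (5,(1,0))] [:: 7; 2; 3; 8; 4; 5; 2; 6; 4; 8; 1; 0] (2,6,0))].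

Definition cert_A'_4 : seq (option leaf) := [::
  None; None;
  Some (Inf [:: (0,(1,3)); (0,(1,2)); (0,(1,1)); (0,(2,0)); (0,(1,0)); (1,(1,1))] [:: 1; 0; 3;
    4] (5,2,0));
  Some (Inf [:: (0,(0,2)); (0,(1,1)); (0,(1,0)); (1,(1,2)); (1,(1,1))] [:: 0; 3; 2; 4] (4,1,3));
  Some (Inf [:: (0,(2,1)); (0,(3,0)); (0,(1,1)); (0,(1,0)); (1,(1,2)); (1,(1,1)); (1,(2,0));
    (2,(1,2))] [:: 1; 3; 4; 0; 2; 3; 4; 7; 3; 5] (6,2,5));
  Some (Inf [:: (0,(2,1)); (0,(3,0)); (0,(1,1)); (0,(1,0)); (1,(1,2)); (1,(2,1)); (1,(1,1));
    (1,(2,0))] [:: 7; 6; 4; 2; 3; 6; 5; 0; 2; 4] (2,1,6));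
  Some (Inf [:: (0,(2,1)); (0,(3,0)); (0,(1,1)); (0,(1,0)); (1,(1,2)); (1,(2,1)); (1,(1,1));
    (1,(2,0))] [:: 3; 7; 4; 2; 4; 0; 6; 1; 3; 4] (5,2,4));
  None; None; Some (Inf [:: (0,(3,1)); (0,(3,0)); (0,(2,0))] [:: 0] (2,1,0));
  Some (Inf [:: (0,(2,1)); (0,(0,2)); (0,(1,1)); (0,(1,0))] [:: 0; 3; 2] (0,1,2));
  Some (Inf [:: (0,(1,2)); (0,(3,0)); (0,(1,1)); (0,(2,0)); (0,(1,0)); (1,(3,0)); (1,(2,0));
    (2,(1,2)); (2,(1,1))] [:: 2; 5; 7; 2; 3; 8; 4; 0; 7; 0; 1; 6; 8; 3; 7; 2] (0,1,2));
  None; None; Some (Inf [:: (0,(3,1)); (0,(2,1)); (0,(3,0)); (0,(2,0)); (1,(3,0))] [:: 3; 4;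
    0] (1,2,0));
  Some (Inf [:: (0,(0,2)); (0,(1,1)); (0,(1,0)); (1,(2,0)); (1,(1,0))] [:: 0; 4; 1; 3] (0,2,1));
  Some (Inf [:: (0,(2,0)); (0,(1,0)); (1,(2,0)); (1,(1,0)); (2,(3,0)); (2,(2,0)); (2,(1,0));
    (3,(1,2)); (3,(2,1)); (3,(1,1))] [:: 5; 7; 6; 2; 9; 8; 7; 6; 4; 2; 1; 0; 8; 7; 3] (3,0,2));
  Some (Inf [:: (0,(2,1)); (0,(1,1)); (0,(2,0)); (0,(1,0)); (1,(2,0)); (2,(3,0)); (2,(2,0))] [:: 4;
    3; 5; 6; 0; 3; 2] (1,6,2));
  Some (Inf [:: (0,(2,1)); (0,(3,0)); (0,(1,1)); (0,(1,0)); (1,(3,0)); (1,(2,0)); (2,(2,0))] [:: 3;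
    6; 2; 5; 6; 0; 4; 3; 2; 1] (6,4,1));
  None; None; Some (Inf [:: (0,(3,0)); (0,(2,0)); (0,(0,1)); (1,(1,2)); (1,(1,1))] [:: 0; 2;
    4] (3,1,4));
  Some (Inf [:: (0,(1,0)); (1,(1,2)); (1,(2,1)); (1,(1,1)); (1,(2,0)); (1,(1,0)); (2,(1,2));
    (2,(2,1)); (2,(1,1))] [:: 1; 4; 7; 2; 0; 6; 8; 3; 2] (2,5,8));
  None; None; Some (Inf [:: (0,(0,2)); (0,(2,0)); (0,(0,1)); (1,(1,1)); (1,(1,0))] [:: 1; 4; 3;
    0] (2,3,0));
  Some (Inf [:: (1,(3,1)); (1,(2,1)); (1,(3,0)); (1,(2,0))] [:: 3] (1,0,2));
  Some (Inf [:: (0,(2,0)); (0,(1,0)); (1,(1,2)); (1,(2,1)); (1,(1,1)); (1,(1,0)); (2,(2,0));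
    (2,(1,0)); (3,(1,1))] [:: 3; 0; 1; 4; 8; 2; 3; 1; 2; 5; 3; 1; 2; 7; 5; 6] (0,7,6));
  Some (Inf [:: (0,(2,0)); (0,(1,0)); (1,(1,2)); (1,(2,1)); (1,(1,1)); (1,(2,0)); (2,(3,0));
    (2,(2,0))] [:: 5; 6; 7; 2; 4; 1; 5; 3; 0; 2; 1] (5,7,3));
  Some (Inf [:: (0,(2,0)); (0,(1,0)); (1,(2,1)); (1,(3,0)); (1,(1,1)); (1,(1,0)); (2,(3,0));
    (2,(2,0))] [:: 2; 4; 5; 3; 0; 1; 2; 6; 0; 7] (7,3,0));
  None; None; Some (Star 2); None;
  Some (Inf [:: (0,(2,0)); (0,(0,1)); (0,(1,0)); (1,(2,0)); (2,(1,1))] [:: 1; 4; 2; 0] (1,3,4));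
  Some (Inf [:: (0,(3,0)); (1,(3,0)); (1,(2,0)); (2,(1,2)); (2,(2,1)); (2,(1,1)); (2,(2,0));
    (2,(1,0))] [:: 1; 3; 7; 0; 5; 1; 6; 2; 7; 6; 3] (4,7,3));
  Some (Inf [:: (0,(3,0)); (0,(2,0)); (0,(1,0)); (1,(3,0)); (1,(1,0)); (2,(1,2)); (2,(1,1));
    (2,(2,0))] [:: 5; 3; 6; 4; 7; 2; 7; 1; 6; 0; 7; 4] (2,5,1));
  Some (Inf [:: (0,(1,0)); (1,(3,0)); (1,(2,0)); (1,(1,0)); (2,(1,2)); (2,(1,1)); (2,(2,0));
    (2,(1,0))] [:: 1; 5; 3; 4; 6; 0; 2; 7] (2,5,4));
  None; None;
  Some (Inf [:: (0,(0,3)); (0,(0,2)); (0,(2,0)); (0,(0,1)); (0,(1,0)); (1,(1,0))] [:: 1; 0; 5; 2;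
    4] (4,1,3));
  Some (Inf [:: (0,(2,0)); (1,(2,0)); (1,(1,0)); (2,(3,0)); (2,(1,0)); (3,(1,2)); (3,(1,1))] [:: 5;
    2; 3; 2; 1; 0; 6; 2; 5; 1] (1,4,0));
  None; None;
  Some (Inf [:: (0,(3,0)); (0,(0,2)); (0,(2,0)); (1,(3,0)); (2,(3,0)); (2,(2,0))] [:: 1; 5; 2; 3;
    4; 5] (3,0,5));
  Some (Inf [:: (1,(2,0)); (1,(1,0)); (2,(3,0)); (2,(1,0)); (3,(3,0)); (3,(2,0)); (4,(1,1))] [:: 0;
    2; 5; 6; 0; 4; 5; 0; 4; 5; 1; 3; 2; 4] (6,5,3));
  Some (Inf [:: (0,(2,0)); (0,(1,0)); (1,(3,0)); (1,(1,0)); (2,(3,0)); (2,(2,0)); (2,(1,0));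
    (3,(2,0))] [:: 3; 1; 0; 2; 6; 5; 7; 3; 1; 0] (0,4,1));
  Some (Inf [:: (0,(1,0)); (1,(3,0)); (1,(2,0)); (1,(1,0)); (2,(3,0)); (2,(2,0)); (3,(2,0));
    (3,(1,0))] [:: 0; 5; 1; 4; 6; 7; 3; 5] (7,2,5))].

Definition cert_A'_5 : seq (option leaf) := [::
  None;
  Some (Inf [:: (0,(3,1)); (0,(4,0)); (0,(2,1)); (0,(2,0)); (1,(1,3)); (1,(1,2)); (1,(2,1))] [:: 3;
    2; 0; 1; 5; 4; 2] (6,4,2));
  None; None; Some (Inf [:: (0,(4,1)); (0,(4,0)); (0,(3,0))] [:: 0] (2,1,0));
  Some (Inf [:: (0,(0,3)); (0,(0,2)); (0,(1,1)); (0,(1,0))] [:: 3; 2; 1] (0,2,1));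
  Some (Inf [:: (0,(3,0)); (0,(2,0)); (1,(3,0)); (1,(2,0)); (2,(1,3)); (2,(2,2)); (2,(1,2));
    (2,(2,1)); (2,(1,1))] [:: 0; 4; 0; 2; 5; 4; 0; 3; 7; 1; 8] (6,4,8));
  Some (Inf [:: (0,(2,2)); (0,(3,1)); (0,(2,1)); (0,(3,0)); (0,(1,1)); (1,(4,0)); (1,(3,0))] [:: 3;
    5; 1; 6; 5; 2; 4; 0] (2,5,0));
  Some (Inf [:: (0,(1,3)); (0,(3,1)); (0,(4,0)); (0,(1,2)); (0,(2,1)); (0,(2,0)); (1,(4,0));
    (1,(3,0))] [:: 5; 4; 2; 1; 7; 0; 6; 5; 2; 4] (3,6,4));
  None; None; Some (Inf [:: (0,(3,0)); (0,(0,2)); (0,(2,0)); (0,(0,1)); (1,(1,1))] [:: 3; 0;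
    4] (1,2,4));
  Some (Inf [:: (0,(2,0)); (1,(1,2)); (1,(2,1)); (1,(3,0)); (1,(1,1)); (1,(1,0)); (2,(1,2));
    (2,(2,1)); (2,(1,1))] [:: 1; 7; 0; 3; 1; 4; 0; 5; 7; 8; 6; 4; 3; 1; 2] (2,8,5));
  Some (Inf [:: (0,(2,0)); (0,(1,0)); (1,(3,1)); (1,(1,2)); (1,(2,1)); (1,(1,1)); (1,(2,0));
    (1,(1,0))] [:: 1; 4; 7; 2; 3; 0; 6; 1] (5,4,1));
  Some (Inf [:: (0,(4,0)); (0,(3,0)); (1,(1,3)); (1,(2,2)); (1,(1,2)); (1,(2,1)); (1,(3,0));
    (1,(2,0))] [:: 5; 0; 2; 4; 1; 0; 6; 5; 7; 1; 0] (7,3,1));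
  None; None; Some (Inf [:: (0,(0,4)); (0,(0,3)); (0,(3,0)); (0,(2,0)); (0,(0,1))] [:: 0; 3; 4;
    1] (1,2,4));
  Some (Inf [:: (0,(3,0)); (1,(3,0)); (1,(2,0)); (2,(1,3)); (2,(2,2)); (2,(1,2)); (2,(2,1));
    (2,(1,1))] [:: 1; 3; 4; 7; 2; 1; 0; 5; 4; 7; 5; 7; 3; 6] (6,5,7));
  None; None;
  Some (Inf [:: (0,(4,0)); (0,(0,3)); (0,(3,0)); (0,(2,0)); (1,(4,0)); (1,(3,0))] [:: 1; 4; 3; 0;
    2] (0,5,2));
  Some (Inf [:: (0,(3,0)); (0,(2,0)); (0,(1,0)); (1,(4,0)); (1,(3,0)); (1,(2,0)); (1,(1,0));
    (2,(4,0)); (2,(3,0))] [:: 6; 5; 3; 7; 8; 4; 0; 6; 2; 4; 1; 8] (1,3,5));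
  Some (Inf [:: (0,(4,0)); (0,(3,0)); (0,(1,0)); (1,(4,0)); (1,(3,0)); (1,(2,0)); (2,(4,0));
    (2,(2,0))] [:: 7; 1; 3; 4; 7; 6; 7; 5; 3; 1; 3; 4; 3; 1; 2; 1; 0; 7] (2,1,7));
  Some (Inf [:: (0,(3,0)); (0,(2,0)); (1,(4,0)); (1,(3,0)); (1,(2,0)); (1,(1,0)); (2,(4,0));
    (2,(3,0)); (2,(2,0))] [:: 4; 5; 1; 7; 6; 2; 8; 3; 7; 4; 0] (2,3,0))].

Definition cert_A'_6 : seq (option leaf) := [::
  None;
  Some (Inf [:: (0,(4,0)); (0,(2,1)); (0,(3,0)); (1,(1,4)); (1,(2,3)); (1,(3,2)); (1,(1,3));
    (1,(2,2))] [:: 6; 2; 4; 5; 4; 3; 0; 1; 4; 2] (2,7,1));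
  Some (Inf [:: (0,(1,4)); (0,(2,3)); (0,(3,2)); (0,(4,1)); (0,(1,3)); (0,(2,2)); (0,(3,1));
    (0,(2,1)); (0,(3,0))] [:: 5; 8; 7; 2; 4; 6; 3; 6; 1; 5] (0,3,5));
  Some (Inf [:: (0,(2,3)); (0,(3,2)); (0,(1,3)); (0,(3,1)); (0,(1,2)); (0,(2,1)); (0,(1,1));
    (0,(2,0))] [:: 3; 7; 1; 7; 3; 5; 0; 7; 5; 3; 4; 7; 2] (2,7,6));
  None;
  Some (Inf [:: (0,(3,0)); (0,(1,0)); (1,(3,2)); (1,(4,1)); (1,(1,3)); (1,(2,2)); (1,(3,1));
    (1,(1,2)); (1,(1,1))] [:: 8; 3; 5; 7; 1; 4; 6; 0; 1; 4; 2; 0; 7] (2,8,0));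
  None; None;
  Some (Inf [:: (0,(4,0)); (0,(0,3)); (0,(3,0)); (0,(0,2)); (0,(2,0)); (0,(0,1))] [:: 0; 2; 5;
    3] (1,4,3));
  Some (Inf [:: (0,(4,0)); (0,(3,0)); (1,(5,0)); (1,(3,0)); (2,(1,4)); (2,(1,3)); (2,(2,2));
    (2,(3,1))] [:: 0; 2; 0; 1; 4; 6; 7; 3; 0; 5] (5,1,7));
  None; None;
  Some (Inf [:: (0,(0,4)); (0,(4,0)); (0,(3,0)); (1,(4,0)); (1,(3,0)); (1,(2,0))] [:: 4; 2; 0; 1;
    5] (3,4,1));
  Some (Inf [:: (0,(2,0)); (0,(1,0)); (1,(3,0)); (1,(2,0)); (1,(1,0)); (2,(3,0)); (2,(1,0));
    (3,(1,2)); (3,(1,1))] [:: 6; 5; 3; 4; 3; 8; 6; 1; 0; 1; 5; 2; 7] (7,6,1));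
  Some (Inf [:: (0,(4,0)); (0,(3,0)); (0,(2,0)); (0,(1,0)); (1,(3,0)); (1,(2,0)); (1,(1,0));
    (2,(3,0)); (2,(1,0))] [:: 6; 7; 5; 1; 2; 7; 2; 6; 1; 8; 0; 5; 6; 4; 3] (3,7,5));
  Some (Inf [:: (0,(5,0)); (0,(4,0)); (0,(3,0)); (1,(5,0)); (1,(4,0)); (1,(3,0)); (1,(2,0));
    (2,(4,0)); (2,(3,0)); (2,(2,0))] [:: 9; 5; 4; 8; 6; 2; 7; 9; 8; 3; 0; 7; 4] (8,1,6))].

Definition cert_A'_7 : seq (option leaf) := [::

  Some (Inf [:: (0,(1,5)); (0,(2,4)); (0,(1,4)); (0,(2,3)); (0,(3,2)); (0,(2,2)); (0,(3,1));
    (0,(1,2)); (0,(2,1))] [:: 6; 2; 3; 2; 5; 8; 7; 4; 5; 3; 0; 1; 0] (1,4,2));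
  None;
  Some (Inf [:: (1,(2,4)); (1,(3,3)); (1,(1,4)); (1,(2,3)); (1,(3,2)); (1,(4,1)); (1,(1,3));
    (1,(2,2))] [:: 0; 4; 1; 0; 6; 2; 7; 4; 3; 1] (3,5,4));
  None; None; Some (Inf [:: (0,(0,5)); (0,(4,0)); (0,(0,3)); (0,(3,0)); (0,(0,2))] [:: 4; 1; 3;
    2] (2,3,0));
  Some (Inf [:: (0,(2,0)); (0,(1,0)); (1,(3,0)); (1,(1,0)); (2,(2,2)); (2,(1,2)); (2,(2,1));
    (2,(1,1))] [:: 2; 3; 7; 5; 0; 1; 4; 6; 3] (3,2,5));
  None;
  Some (Inf [:: (0,(4,0)); (0,(3,0)); (0,(2,0)); (0,(1,0)); (1,(6,0)); (1,(5,0)); (1,(4,0));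
    (1,(3,0)); (1,(2,0)); (1,(1,0))] [:: 2; 5; 0; 9; 1; 6; 4; 9; 6; 0; 3; 1; 3; 9; 0; 7; 4; 5; 2;
    8] (0,9,5))].

(** In these certificates [true] claims that the pattern is the star, and [false] that it is a
    misfit. *)
Definition count_A_2 : seq (option bool) := [::
  None; None; None; Some false; Some false; None; None; Some true; Some false; Some false;
    Some false;
  Some false].

Definition count_A'_3 : seq (option bool) := [::
  None; None; None; Some false; Some false; Some false; Some false; None; Some false; Some false;
    Some false;
  Some false; Some false; Some false; Some false; None; None; None; Some false; Some false;
    Some false; None;
  Some false; Some false; Some false; Some false; Some false; Some false; None; None; None;
    Some false;
  Some false; Some false; Some false; Some false; Some false; None; None; Some false; Some false;
    None; None;
  Some true; Some false; Some false; Some false].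

(** Both root patterns contain at least two arcs, whereas a single triangle with three boundary
    intervals has none. *)
Definition count_A'_3_mono : seq (option bool) := [::
  Some false; Some false].

(** The last matrix is the familiar quiver of D_4^(1,1): a double arrow closed into oriented
    triangles by each of four further vertices. *)
Definition class_D4_11 : seq (seq (seq int) * seq (nat * seq nat)) := [::
  ([:: [:: 0; (-1); 0; 0; 0; 1]; [:: 1; 0; (-1); (-1); 1; 0]; [:: 0; 1; 0; 0; 0; (-1)]; [:: 0; 1;
    0; 0; 0; (-1)]; [:: 0; (-1); 0; 0; 0; 1]; [:: (-1); 0; 1; 1; (-1); 0]]%Z,
   [:: (1, [:: 0; 1; 2; 3; 4; 5]); (2, [:: 0; 1; 2; 3; 4; 5]); (1, [:: 0; 5; 2; 4; 3; 1]);
    (1, [:: 0; 5; 4; 2; 3; 1]); (1, [:: 4; 1; 0; 2; 3; 5]); (2, [:: 0; 2; 1; 5; 4; 3])]);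
  ([:: [:: 0; 1; 0; 0; 0; (-1)]; [:: (-1); 0; (-1); (-1); 1; 1]; [:: 0; 1; 0; 0; 0; (-1)]; [:: 0;
    1; 0; 0; 0; (-1)]; [:: 0; (-1); 0; 0; 0; 1]; [:: 1; (-1); 1; 1; (-1); 0]]%Z,
   [:: (0, [:: 0; 1; 2; 3; 4; 5]); (1, [:: 0; 5; 2; 3; 1; 4]); (0, [:: 0; 5; 2; 4; 3; 1]);
    (0, [:: 0; 5; 4; 2; 3; 1]); (3, [:: 0; 1; 2; 3; 4; 5]); (1, [:: 0; 4; 2; 3; 5; 1])]);
  ([:: [:: 0; 1; (-1); (-1); 0; 1]; [:: (-1); 0; 1; 1; (-1); 0]; [:: 1; (-1); 0; 0; 1; (-1)];
    [:: 1; (-1); 0; 0; 1; (-1)]; [:: 0; 1; (-1); (-1); 0; 1]; [:: (-1); 0; 1; 1; (-1); 0]]%Z,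
   [:: (0, [:: 1; 2; 0; 4; 5; 3]); (0, [:: 0; 1; 2; 3; 4; 5]); (0, [:: 0; 2; 5; 1; 4; 3]);
    (0, [:: 0; 2; 1; 5; 4; 3]); (0, [:: 1; 0; 2; 3; 5; 4]); (0, [:: 0; 5; 2; 3; 4; 1])]);
  ([:: [:: 0; 1; 0; 0; 0; (-1)]; [:: (-1); 0; (-1); (-1); (-1); 2]; [:: 0; 1; 0; 0; 0; (-1)];
    [:: 0; 1; 0; 0; 0; (-1)]; [:: 0; 1; 0; 0; 0; (-1)]; [:: 1; (-2); 1; 1; 1; 0]]%Z,
   [:: (1, [:: 4; 1; 0; 2; 3; 5]); (3, [:: 0; 5; 2; 3; 4; 1]); (1, [:: 0; 1; 4; 2; 3; 5]);
    (1, [:: 0; 1; 2; 4; 3; 5]); (1, [:: 0; 1; 2; 3; 4; 5]); (3, [:: 0; 5; 2; 3; 4; 1])])].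

(** In the star of valency 2 both arcs are sides of triangle 0; its codes and the interior point of
    triangle 1 represent all mutable vertices. *)
Definition codes_A_3_2 : seq code := [::
  (0,(0,2)); (0,(1,1)); (0,(2,0)); (0,(0,1)); (0,(1,0)); (1,(1,1))].

(** The first matrix is the oriented 4-cycle, and the last two are orientations of the Dynkin
    diagram D_4. *)
Definition class_D4 : seq (seq (seq int) * seq (nat * seq nat)) := [::
  ([:: [:: 0; 0; 1; (-1)]; [:: 0; 0; (-1); 1]; [:: (-1); 1; 0; 0]; [:: 1; (-1); 0; 0]]%Z,
   [:: (1, [:: 0; 1; 2; 3]); (1, [:: 0; 1; 3; 2]); (1, [:: 3; 2; 0; 1]); (1, [:: 2; 3; 0; 1])]);
  ([:: [:: 0; 0; (-1); 1]; [:: 0; 0; (-1); 1]; [:: 1; 1; 0; (-1)]; [:: (-1); (-1); 1; 0]]%Z,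
   [:: (0, [:: 0; 1; 2; 3]); (0, [:: 0; 1; 3; 2]); (2, [:: 0; 1; 2; 3]); (3, [:: 0; 1; 2; 3])]);
  ([:: [:: 0; 0; 1; 0]; [:: 0; 0; 1; 0]; [:: (-1); (-1); 0; 1]; [:: 0; 0; (-1); 0]]%Z,
   [:: (3, [:: 0; 2; 3; 1]); (3, [:: 2; 0; 3; 1]); (1, [:: 0; 1; 2; 3]); (4, [:: 0; 1; 2; 3])]);
  ([:: [:: 0; 0; 0; (-1)]; [:: 0; 0; 0; (-1)]; [:: 0; 0; 0; 1]; [:: 1; 1; (-1); 0]]%Z,
   [:: (2, [:: 0; 3; 1; 2]); (2, [:: 3; 0; 1; 2]); (5, [:: 0; 1; 2; 3]); (1, [:: 0; 1; 2; 3])]);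
  ([:: [:: 0; 0; 1; 0]; [:: 0; 0; 1; 0]; [:: (-1); (-1); 0; (-1)]; [:: 0; 0; 1; 0]]%Z,
   [:: (2, [:: 3; 0; 2; 1]); (2, [:: 0; 3; 2; 1]); (5, [:: 0; 1; 3; 2]); (2, [:: 0; 1; 2; 3])]);
  ([:: [:: 0; 0; 0; (-1)]; [:: 0; 0; 0; (-1)]; [:: 0; 0; 0; (-1)]; [:: 1; 1; 1; 0]]%Z,
   [:: (3, [:: 2; 0; 1; 3]); (3, [:: 0; 2; 1; 3]); (3, [:: 0; 1; 2; 3]); (4, [:: 0; 1; 3; 2])])].

Definition codes_A'_3_2 : seq code := [::
  (0,(0,2)); (0,(2,0)); (0,(0,1)); (0,(1,0))].

Definition codes_A'_4_2 : seq code := [::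
  (0,(0,3)); (0,(3,0)); (0,(0,2)); (0,(2,0)); (0,(0,1)); (0,(1,0))].

Definition codes_A'_3_3 : seq code := [::
  (0,(0,2)); (0,(2,0)); (0,(0,1)); (0,(1,0)); (1,(2,0)); (1,(1,0))].

Lemma explores_A_3 :
  explores false (closing false 3 [:: 2]) (root_patterns false) cert_A_3.
Proof. by vm_compute. Qed.

Lemma explores_A_4 :
  explores false (closing false 4 [::]) (root_patterns false) cert_A_4.
Proof. by vm_compute. Qed.

Lemma explores_A_5 :
  explores false (closing false 5 [::]) (root_patterns false) cert_A_5.
Proof. by vm_compute. Qed.

Lemma explores_A_6 :
  explores false (closing false 6 [::]) (root_patterns false) cert_A_6.
Proof. by vm_compute. Qed.

Lemma explores_A_7 :
  explores false (closing false 7 [::]) (root_patterns false) cert_A_7.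
Proof. by vm_compute. Qed.

Lemma explores_A'_3 :
  explores true (closing true 3 [:: 2; 3]) (root_patterns true) cert_A'_3.
Proof. by vm_compute. Qed.

Lemma explores_A'_4 :
  explores true (closing true 4 [:: 2]) (root_patterns true) cert_A'_4.
Proof. by vm_compute. Qed.

Lemma explores_A'_5 :
  explores true (closing true 5 [::]) (root_patterns true) cert_A'_5.
Proof. by vm_compute. Qed.

Lemma explores_A'_6 :
  explores true (closing true 6 [::]) (root_patterns true) cert_A'_6.
Proof. by vm_compute. Qed.

Lemma explores_A'_7 :
  explores true (closing true 7 [::]) (root_patterns true) cert_A'_7.
Proof. by vm_compute. Qed.

Section PuncturedSurface.
Variables (S : marked_surface) (T : triangulation).
Hypotheses (TS : triangulates T S) (pS : 0 < punctures S) (regT : regular T).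

Lemma no_bottomP st (ss : seq (side T)) (s0 : side T) n :
  embeds st ss s0 -> n < size ss -> typed false st n ->
  (fun _ : triangle T => None : option 'I_3) (nth s0 ss n).1 =
  omap (fun e => iter e (@ordS 3) (nth s0 ss n).2) (pattern_bottom false st n).
Proof. by []. Qed.

Lemma quiver_A_infinite_or_star k : 3 <= k ->
  ~ finite_mutation_type (quiver_A T k) \/ k = 3 /\ star_of T 2.
Proof.
move=> k3; have go K stars cert : K = k \/ (K == 7) && (7 <= k) ->
    explores false (closing false K stars) (root_patterns false) cert ->
    ~ finite_mutation_type (quiver_A T k) \/ exists2 n, n \in stars & star_of T n.
  move=> Kk ex; have tT : false -> forall (t : triangle T) (i j : 'I_3),
    bd_interval (t, i) -> bd_interval (t, j) -> i = j by [].
  exact (@infinite_or_star T k _ false no_bottomP regT tT S K stars cert TS pS Kk ex).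
case: k k3 go => [|[|[|[|[|[|[|k]]]]]]] // _ go.
- have [h|[n]] := go 3 _ _ (or_introl erefl) explores_A_3; first by left.
  by rewrite inE => /eqP-> st; right.
- by have [h|[]] := go 4 _ _ (or_introl erefl) explores_A_4; first by left.
- by have [h|[]] := go 5 _ _ (or_introl erefl) explores_A_5; first by left.
- by have [h|[]] := go 6 _ _ (or_introl erefl) explores_A_6; first by left.
(* All k >= 7 are treated together, through leaves checked at 7. *)
by have [h|[]] := go 7 _ _ (or_intror isT) explores_A_7; first by left.
Qed.

Lemma quiver_A'_infinite_or_star k : taut T -> 3 <= k ->
  [\/ ~ finite_mutation_type (quiver_A' T k), (k = 3 \/ k = 4) /\ star_of T 2 |
      k = 3 /\ star_of T 3].
Proof.
move=> tT k3; have go K stars cert : K = k \/ (K == 7) && (7 <= k) ->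
    explores true (closing true K stars) (root_patterns true) cert ->
    ~ finite_mutation_type (quiver_A' T k) \/ exists2 n, n \in stars & star_of T n.
  move=> Kk ex; have tT' : true -> forall (t : triangle T) (i j : 'I_3),
    bd_interval (t, i) -> bd_interval (t, j) -> i = j by case: tT.
  have bP st ss s0 n := @bottomP T st ss s0 n tT.
  exact (@infinite_or_star T k _ true bP regT tT' S K stars cert TS pS Kk ex).
case: k k3 go => [|[|[|[|[|[|[|k]]]]]]] // _ go.
- have [h|[n]] := go 3 _ _ (or_introl erefl) explores_A'_3; first by constructor 1.
  rewrite !inE => /orP[]/eqP-> st; first by constructor 2; split; first left.
  by constructor 3.
- have [h|[n]] := go 4 _ _ (or_introl erefl) explores_A'_4; first by constructor 1.
  by rewrite inE => /eqP-> st; constructor 2; split; first right.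
- by have [h|[]] := go 5 _ _ (or_introl erefl) explores_A'_5; first by constructor 1.
- by have [h|[]] := go 6 _ _ (or_introl erefl) explores_A'_6; first by constructor 1.
by have [h|[]] := go 7 _ _ (or_intror isT) explores_A'_7; first by constructor 1.
Qed.

Lemma bigon_star : S = once_punctured_polygon 2 -> star_of T 2.
Proof.
move=> SE; have [B [V V3 FV]] := card_triangles TS SE.
(* From F + 4 = 2 V <= 6, the number F is even, positive and at most 2. *)
have F : #|triangle T| = 2 by have := triangle_gt0 T; lia.
have nottaut : false -> forall (t : triangle T) (i j : 'I_3),
  bd_interval (t, i) -> bd_interval (t, j) -> i = j by [].
apply: (counted_star TS pS regT nottaut F B (cert := count_A_2)); by vm_compute.
Qed.

Lemma triangle_star : taut T -> S = once_punctured_polygon 3 -> star_of T 3.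
Proof.
move=> [_ ttT] SE; have [B [V V3 FV]] := card_triangles TS SE.
have tT : true -> forall (t : triangle T) (i j : 'I_3),
  bd_interval (t, i) -> bd_interval (t, j) -> i = j by [].
(* From F + 5 = 2 V <= 8, the number F is odd and at most 3. The value 1 is refuted by the search,
   as it would make all three sides boundary intervals. *)
have [F|F] : #|triangle T| = 3 \/ #|triangle T| = 1 by have := triangle_gt0 T; lia.
  by apply: (counted_star TS pS regT tT F B (cert := count_A'_3)); vm_compute.
by apply: (counted_star TS pS regT tT F B (cert := count_A'_3_mono)); vm_compute.
Qed.

Lemma quiver_A_star_finite : star_of T 2 -> finite_mutation_type (quiver_A T 3).
Proof.
case=> ss [s0 emb].
by apply: (finite_star (no_bottomP) emb (vs := codes_A_3_2) (reps := class_D4_11)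
  (start := (0, [:: 0; 1; 2; 3; 4; 5]))); vm_compute.
Qed.

Lemma quiver_A'_star_finite (tT : taut T) :
  [/\ star_of T 2 -> finite_mutation_type (quiver_A' T 3),
      star_of T 2 -> finite_mutation_type (quiver_A' T 4) &
      star_of T 3 -> finite_mutation_type (quiver_A' T 3)].
Proof.
have bP st ss s0 n := @bottomP T st ss s0 n tT.
split=> -[ss [s0 emb]].
- by apply: (finite_star bP emb (vs := codes_A'_3_2) (reps := class_D4)
    (start := (0, [:: 0; 1; 2; 3]))); vm_compute.
- by apply: (finite_star bP emb (vs := codes_A'_4_2) (reps := class_D4_11)
    (start := (0, [:: 0; 2; 5; 1; 3; 4]))); vm_compute.
by apply: (finite_star bP emb (vs := codes_A'_3_3) (reps := class_D4_11)
  (start := (2, [:: 0; 2; 1; 4; 5; 3]))); vm_compute.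
Qed.

End PuncturedSurface.

Theorem proposition10p1 (S : marked_surface) (k : nat)
    (hS : admissible S) (hp : 1 <= punctures S) (hk : 3 <= k) :
  (forall T : triangulation, triangulates T S -> regular T ->
     (finite_mutation_type (quiver_A T k) <->
      S = once_punctured_polygon 2 /\ k = 3))
  /\
  (forall T : triangulation, triangulates T S -> taut T ->
     (finite_mutation_type (quiver_A' T k) <->
      (S = once_punctured_polygon 2 /\ (k = 3 \/ k = 4)) \/
      (S = once_punctured_polygon 3 /\ k = 3))).
Proof.
have star_n n T : (n == 2) || (n == 3) -> triangulates T S -> star_of T n ->
    S = once_punctured_polygon n.
  by move=> n23 TS [ss [s0 emb]]; exact (star_polygon n23 emb TS hp).
split=> T TS => [regT|tT].
  split=> [fin|[S2 ->]]; last exact (quiver_A_star_finite (bigon_star TS hp regT S2)).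
  have [//|[k3 st2]] := quiver_A_infinite_or_star TS hp regT hk.
  by split; first exact (star_n 2 T isT TS st2).
have regT : regular T by case: tT.
have [fin32 fin42 fin33] := quiver_A'_star_finite tT.
split=> [fin|[[S2 [->|->]]|[S3 ->]]].
- have [//|[k34 st]|[k3 st]] := quiver_A'_infinite_or_star TS hp regT tT hk.
    by left; split; first exact (star_n 2 T isT TS st).
  by right; split; first exact (star_n 3 T isT TS st).
- exact (fin32 (bigon_star TS hp regT S2)).
- exact (fin42 (bigon_star TS hp regT S2)).
exact (fin33 (triangle_star TS hp regT tT S3)).
Qed.
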